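(* There is a universal constant $C<\infty$ such that: for every log-concave random vector $X$ in $\mathbb{R}^d$, every $p\geq 1$, $A>0$, and every $T\subset\mathbb{R}^d$ with $|T|\geq e^{e^p}$ and $\|\langle t-s,X\rangle\|_p\geq A$ for all distinct $t,s\in T$, one has \[ \mathbb{E}\sup_{t,s\in T}\langle t-s,X\rangle\geq\frac{1}{C}A. \]
   Context: $\|Y\|_p:=(\mathbb{E}|Y|^p)^{1/p}$. A random vector is log-concave if its law $\mu$ satisfies $\mu(\lambda K+(1-\lambda)L)\geq\mu(K)^\lambda\mu(L)^{1-\lambda}$ for all nonempty compact $K,L$ and $\lambda\in[0,1]$. *)

(* Defs.v *)
From HB Require Import structures.
From mathcomp Require Import all_boot all_order all_algebra.
From mathcomp Require Import all_classical all_reals all_analysis.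
Set Implicit Arguments. Unset Strict Implicit. Unset Printing Implicit Defensive.
Import Order.TTheory GRing.Theory Num.Theory.
Import numFieldNormedType.Exports.
Local Open Scope classical_set_scope.
Local Open Scope ring_scope.

Definition inner (R : realType) (d : nat) (t x : 'rV[R]_d) : R :=
  \sum_(i < d) t 0 i * x 0 i.

Definition mink_comb (R : realType) (d : nat) (l : R) (K L : set 'rV[R]_d)
  : set 'rV[R]_d :=
  [set l *: x + (1 - l) *: y | x in K & y in L].

Definition random_vector (R : realType) (m : measure_display)
  (Omega : measurableType m) (d : nat) (X : Omega -> 'rV[R]_d) : Prop :=
  forall i : 'I_d, measurable_fun setT (fun w => X w 0 i).

Definition log_concave (R : realType) (m : measure_display)
  (Omega : measurableType m) (P : probability Omega R) (d : nat)
  (X : Omega -> 'rV[R]_d) : Prop :=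
  forall (K L : set 'rV[R]_d) (l : R),
    compact K -> compact L -> K !=set0 -> L !=set0 -> 0 <= l <= 1 ->
    ((P (X @^-1` K) `^ l) * (P (X @^-1` L) `^ (1 - l))
      <= P (X @^-1` mink_comb l K L))%E.

Definition sup_diff (R : realType) (m : measure_display)
  (Omega : measurableType m) (d : nat) (T : set 'rV[R]_d)
  (X : Omega -> 'rV[R]_d) (w : Omega) : \bar R :=
  ereal_sup [set (inner (t - s) (X w))%:E | t in T & s in T].

(* Main.v *)
(** Suppose that E sup <t - s, X> < A / C and write V_ts = <t - s, X> / a with a comparable to A.
Then all |V_ts| are at most 1/2 with probability 3/4, whereas the exponential decay of tails
under a log-concave law turns the moment hypothesis into P(|V_ts| >= 1) >= 1/m for all t <> s,
where m = 2^l is comparable to e^(p/128).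

As |T| is doubly exponential in p, the pigeonhole principle yields n = m^40 differences
v_1, ..., v_n whose coordinates V_k = <v_k, X> / a are almost orthogonal in L^2.  Let
Q = (V_1^2 + ... + V_n^2) / n.  The midpoint of a point where many V_k are large and one where
all are small has a markedly smaller Q, so the Brunn-Minkowski property produces two separated
windows {Q ~ alpha_1} and {Q ~ alpha_3} of probability at least m^(-12).

For random signs, g = n^(-1/2) (+-v_1 ... +-v_n) makes <g, X> behave like a centred Gaussian of
variance Q(X).  So the weight exp(-(<g, X> - r)^2 / 2H) has average sqrt(H / (H + Q))
exp(-r^2 / 2(H + Q)), which for given r is largest when H + Q = r^2, with a maximum proportional
to 1/r.  Take r_j = sqrt(H + alpha_j) on the two windows and r_2 = (r_1 + r_3) / 2 on the whole
space.  As r_1 r_3 < r_2^2, each g multiplies the product of the two window masses by a larger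
factor than the square of the mass with centre r_2; variance estimates allow one to choose
k = m^8 sign vectors one after the other, and the gain becomes exponential in m^2.  But the
product of the weights is log-concave, and the centre r_2 is the midpoint of r_1 and r_3, so the
Prekopa-Leindler inequality bounds this product by the square, up to a factor polynomial in m. *)

Require Import Defs.
From HB Require Import structures.
From mathcomp Require Import all_boot all_order all_algebra.
From mathcomp Require Import all_classical all_reals all_analysis.
From mathcomp Require Import measurable_realfun.
From mathcomp Require Import ring lra zify.
Import Order.TTheory GRing.Theory Num.Theory.
Import numFieldNormedType.Exports.
Set Implicit Arguments.
Unset Strict Implicit.
Unset Printing Implicit Defensive.
Local Open Scope classical_set_scope.
Local Open Scope ring_scope.

(** * Log-concave vectors *)

(** No density, centring or symmetry of the law is assumed; log-concavity enters only at weight 1/2,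
    through [log_concave_midpoint]. One Gaussian factor gains merely 1 + q^2 with q of order m^(-3),
    while the windows have mass m^(-12) and level sets cost a further power of m; hence k = m^8
    factors. The obstacle is that each new sign vector is chosen for a measure already weighted by
    the earlier factors. Its mass may be as small as 4^(-k) m^(-12), whereas orthogonality is known
    only under [P]. Log-concave tails bridge this: outside an event negligible even against that
    mass, a linear combination of the V_i exceeds its L^2 size by at most a factor polynomial in k.
    The Bessel constant is thus of order m^9 and the variance of order m^18 / n. It has to stay
    below the cube of a tolerance of order q^2, that is, below about m^(-18); n = m^40 leaves room.
    Each of the n pigeonholes uses 16 m^42 classes, so 2 (16 m^42)^n points are required. This is at
    most 2^(m^41), and with m comparable to e^(p/128) it is below e^(e^p). *)

Lemma innerDr (R : realType) d (t x y : 'rV[R]_d) :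
  inner t (x + y) = inner t x + inner t y.
Proof. by rewrite /inner -big_split; apply: eq_bigr => i _; rewrite mxE mulrDr. Qed.

Lemma innerZr (R : realType) d (t x : 'rV[R]_d) c :
  inner t (c *: x) = c * inner t x.
Proof. by rewrite /inner big_distrr; apply: eq_bigr => i _; rewrite mxE /= mulrCA. Qed.

Lemma innerDl (R : realType) d (t s x : 'rV[R]_d) :
  inner (t + s) x = inner t x + inner s x.
Proof. by rewrite /inner -big_split; apply: eq_bigr => i _; rewrite mxE mulrDl. Qed.

Lemma innerZl (R : realType) d (t x : 'rV[R]_d) c :
  inner (c *: t) x = c * inner t x.
Proof. by rewrite /inner big_distrr; apply: eq_bigr => i _; rewrite mxE /= mulrA. Qed.

Lemma inner0l (R : realType) d (x : 'rV[R]_d) : inner 0 x = 0.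
Proof. by rewrite -(scale0r 0) innerZl mul0r. Qed.

Lemma innerNl (R : realType) d (t x : 'rV[R]_d) : inner (- t) x = - inner t x.
Proof. by rewrite -scaleN1r innerZl mulN1r. Qed.

Lemma innerBl (R : realType) d (t s x : 'rV[R]_d) :
  inner (t - s) x = inner t x - inner s x.
Proof. by rewrite innerDl innerNl. Qed.

Lemma inner_suml (R : realType) d (I : finType) (v : I -> 'rV[R]_d) (x : 'rV[R]_d) :
  inner (\sum_i v i) x = \sum_i inner (v i) x.
Proof.
elim/big_ind2 : _ => [|u a w b <- <-|//]; [exact: inner0l|exact: innerDl].
Qed.

Lemma continuous_sumr (R : realType) (T : topologicalType) (I : Type) (r : seq I)
    (f : I -> T -> R) :
  (forall i, continuous (f i)) -> continuous (fun x => \sum_(i <- r) f i x).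
Proof.
move=> cf x; elim: r => [|i r IH].
  under eq_fun do rewrite big_nil; exact: cvg_cst.
under eq_fun do rewrite big_cons.
by rewrite /continuous_at; apply: (cvgD (cf i x) IH).
Qed.

Lemma continuous_inner (R : realType) d (t : 'rV[R]_d) : continuous (inner t).
Proof.
apply: continuous_sumr => i x.
apply: (@continuousM R _ (fun=> t 0 i) (fun z : 'rV[R]_d => z 0 i)).
  exact: cst_continuous.
exact: coord_continuous.
Qed.

(** Only the coordinates of [X] are known to be measurable. An open set is the union of the
    countably many balls with rational centre and radius that it contains, and a ball of the sup
    norm is a finite intersection of coordinate conditions. *)
Lemma random_vector_open (R : realType) m (Omega : measurableType m) d
  (X : Omega -> 'rV[R]_d) (O : set 'rV[R]_d) :
  random_vector X -> open O -> measurable (X @^-1` O).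
Proof.
move=> rX oO.
pose D := [set cr : 'rV[rat]_d * rat |
  ball (map_mx ratr cr.1 : 'rV[R]_d) (ratr cr.2) `<=` O].
have -> : X @^-1` O = \bigcup_(cr in D)
    (X @^-1` ball (map_mx ratr cr.1 : 'rV[R]_d) (ratr cr.2)).
  apply/seteqP; split => w /=; last by move=> [cr Dcr] /Dcr.
  move=> Ow.
  have /nbhs_ballP[e /= e0 He] : nbhs (X w) O by exact: open_nbhs_nbhs.
  have [r] := @rat_in_itvoo R 0 (e / 2) (divr_gt0 e0 (ltr0n _ 2)).
  rewrite in_itv /= => /andP[r0 re].
  have Hc : forall i : 'I_d, exists c : rat, `|X w 0 i - ratr c| < ratr r.
    move=> i; have /(@rat_in_itvoo R)[c] : X w 0 i - ratr r < X w 0 i + ratr r by lra.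
    by rewrite in_itv /= => /andP[c1 c2]; exists c; rewrite ltr_norml; lra.
  have {Hc}[c Hc] := choice Hc.
  exists (\row_i c i, r) => /=; last first.
    split=> //= i j; rewrite !mxE /ball/= ord1 distrC; exact: Hc.
  move=> y [_ By]; apply: He; split=> // i j.
  have := By i j; rewrite !mxE /ball /= !ord1 => h.
  have := Hc j; move: h.
  move: (X w 0 j) (y 0 j) (ratr (c j)) (ratr r) r0 re => a b c' r' ? ?.
  by rewrite !ltr_norml; lra.
rewrite bigcup_mkcond.
apply: countable_bigcupT_measurable => [|cr]; first exact: countableP.
case: ifPn => // _.
set c := map_mx _ _; set r := ratr _.
have [r0|r0] := ltP 0 r; last first.
  rewrite (_ : _ @^-1` _ = set0) //.
  by apply/seteqP; split => // w /= [r1 _]; move: (lt_le_trans r1 r0); rewrite ltxx.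
rewrite (_ : _ @^-1` _ = \bigcap_(i in [set: 'I_d]) ((fun w => X w 0 i) @^-1` ball (c 0 i) r)).
  apply: fin_bigcap_measurable => // i _; rewrite -[X in measurable X]setTI.
  by apply: rX => //; exact: measurable_ball.
apply/seteqP; split => w /=.
  by move=> [_ h] i _; exact: h.
by move=> h; split=> // i j; rewrite ord1; exact: h.
Qed.

Lemma random_vector_closed (R : realType) m (Omega : measurableType m) d
  (X : Omega -> 'rV[R]_d) (K : set 'rV[R]_d) :
  random_vector X -> closed K -> measurable (X @^-1` K).
Proof.
move=> rX cK; rewrite -(setCK K) -preimage_setC.
by apply: measurableC; apply: random_vector_open => //; exact: closed_openC.
Qed.

Lemma measurable_comp_random_vector (R : realType) m (Omega : measurableType m) d
  (X : Omega -> 'rV[R]_d) (f : 'rV[R]_d -> R) :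
  random_vector X -> continuous f -> measurable_fun setT (fun w => f (X w)).
Proof.
move=> rX cf.
apply: (measurability _ (RGenOpens.measurableE R)) => _ [_ [a [b ->] <-]].
rewrite setTI (_ : _ @^-1` _ = X @^-1` (f @^-1` `]a, b[)) //.
apply: random_vector_open => //.
by apply: open_comp => [y _|]; [exact: cf|exact: interval_open].
Qed.

Lemma compact_midpoint (R : realType) d (K L : set 'rV[R]_d) (l : R) :
  compact K -> compact L -> compact (mink_comb l K L).
Proof.
move=> cK cL.
have -> : mink_comb l K L =
    (fun z : 'rV[R]_d * 'rV[R]_d => l *: z.1 + (1 - l) *: z.2) @` (K `*` L).
  apply/seteqP; split => z /=.
    by move=> [x Kx [y Ly <-]]; exists (x, y).
  by move=> [[x y] [/= Kx Ly] <-]; exists x => //; exists y.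
apply: continuous_compact; last exact: compact_setX.
apply: continuous_subspaceT => z.
apply: cvgD; apply: cvgZr; [exact: cvg_fst|exact: cvg_snd].
Qed.

Lemma measure_probR d (T : measurableType d) (R : realType) (P : probability T R) (A : set T) :
  measurable A -> P A = (fine (P A))%:E.
Proof. by move=> mA; rewrite fineK // fin_num_measure. Qed.

Lemma log_concave_midpoint_compact (R : realType) m (Omega : measurableType m)
  (P : probability Omega R) d (X : Omega -> 'rV[R]_d) (K L E : set 'rV[R]_d) :
  random_vector X -> log_concave P X -> compact K -> compact L ->
  measurable (X @^-1` E) ->
  (forall x y, K x -> L y -> E (2^-1 *: x + 2^-1 *: y)) ->
  fine (P (X @^-1` K)) * fine (P (X @^-1` L)) <= fine (P (X @^-1` E)) ^+ 2.
Proof.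
move=> rX lc cK cL mE KLE.
have haus : hausdorff_space 'rV[R]_d by exact: norm_hausdorff.
have mK : measurable (X @^-1` K) by apply: random_vector_closed => //; exact: compact_closed.
have mL : measurable (X @^-1` L) by apply: random_vector_closed => //; exact: compact_closed.
have [->|/set0P K0] := eqVneq K set0.
  by rewrite preimage_set0 measure0 mul0r sqr_ge0.
have [->|/set0P L0] := eqVneq L set0.
  by rewrite preimage_set0 measure0 mulr0 sqr_ge0.
have half : 1 - 2^-1 = 2^-1 :> R by lra.
have := lc K L 2^-1 cK cL K0 L0; rewrite half => /(_ _)/wrap[|]; first by lra.
have mM : measurable (X @^-1` mink_comb 2^-1 K L).
  by apply: random_vector_closed => //; apply: compact_closed => //; exact: compact_midpoint.
have sub : X @^-1` mink_comb 2^-1 K L `<=` X @^-1` E.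
  by move=> w /= [x Kx [y Ly <-]]; rewrite half; exact: KLE.
have le : (P (X @^-1` mink_comb 2^-1 K L) <= P (X @^-1` E))%E.
  by apply: le_measure => //; rewrite inE.
move=> /le_trans /(_ le).
rewrite (measure_probR P mK) (measure_probR P mL) (measure_probR P mE).
have k0 : 0 <= fine (P (X @^-1` K)) by rewrite fine_ge0.
have l0 : 0 <= fine (P (X @^-1` L)) by rewrite fine_ge0.
have e0 : 0 <= fine (P (X @^-1` E)) by rewrite fine_ge0.
rewrite !poweR_EFin -EFinM lee_fin !powR12_sqrt // -sqrtrM //.
by move=> h; rewrite -(@ler_sqrt _ _ (_ ^+ 2)) ?sqr_ge0 // sqrtr_sqr ger0_norm.
Qed.

(** [log_concave] speaks of compact sets, whereas the sets used below are closed and may be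
    unbounded. The boxes [-n, n]^d exhaust them, and the probabilities converge by continuity from
    below. *)
Lemma log_concave_midpoint (R : realType) m (Omega : measurableType m)
  (P : probability Omega R) d (X : Omega -> 'rV[R]_d) (K L E : set 'rV[R]_d) :
  random_vector X -> log_concave P X -> closed K -> closed L ->
  measurable (X @^-1` E) ->
  (forall x y, K x -> L y -> E (2^-1 *: x + 2^-1 *: y)) ->
  fine (P (X @^-1` K)) * fine (P (X @^-1` L)) <= fine (P (X @^-1` E)) ^+ 2.
Proof.
move=> rX lc cK cL mE KLE.
pose box (n : nat) := [set v : 'rV[R]_d | forall i, `[- n%:R, n%:R]%classic (v ord0 i)].
have cbox n : compact (box n) 
  by apply: (@rV_compact R d (fun=> `[- n%:R, n%:R]%classic)) => i; exact: segment_compact.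
have haus : hausdorff_space 'rV[R]_d by exact: norm_hausdorff.
have ccompact (K' : set 'rV[R]_d) n : closed K' -> compact (K' `&` box n).
  move=> cK'; apply: (subclosed_compact _ (cbox n)) => [|x []//].
  by apply: closedI => //; exact: compact_closed.
have lim (K' : set 'rV[R]_d) : closed K' ->
    fine (P (X @^-1` (K' `&` box n))) @[n --> \oo] --> fine (P (X @^-1` K')).
  move=> cK'.
  have mn n : measurable (X @^-1` (K' `&` box n)).
    by apply: random_vector_closed => //; apply: compact_closed => //; exact: ccompact.
  have U : \bigcup_n (X @^-1` (K' `&` box n)) = X @^-1` K'.
    apply/seteqP; split => w /=; first by move=> [n _ []].
    move=> Kw; pose M := \sum_(i < d) `|X w 0 i|.
    exists (Num.truncn M).+1 => //; split => // i; rewrite /= in_itv /= -ler_norml.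
    have M0 : 0 <= M by apply: sumr_ge0.
    apply: (@le_trans _ _ M); last by rewrite ltW// truncnS_gt.
    by rewrite /M (bigD1 i)//= lerDl sumr_ge0.
  have mU : measurable (\bigcup_n (X @^-1` (K' `&` box n))) by exact: bigcup_measurable.
  have nd : nondecreasing_seq (fun n => X @^-1` (K' `&` box n)).
    move=> n k nk; apply/subsetPset => w /= [Kw bw]; split => // i.
    have := bw i; rewrite /= !in_itv /= => /andP[a b].
    have : n%:R <= k%:R :> R by rewrite ler_nat.
    by move=> ?; apply/andP; split; lra.
  have := nondecreasing_cvg_mu (mu := P) mn mU nd; rewrite U => h.
  apply: fine_cvg; rewrite -measure_probR // ; last by rewrite -U.
apply: (@ler_cvg_to _ (nbhs \oo) _ _ (fun n => fine (P (X @^-1` (K `&` box n))) * fine (P (X @^-1` (L `&` box n))))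
   (fun=> fine (P (X @^-1` E)) ^+ 2)).
- by apply: cvgM; apply: lim.
- exact: cvg_cst.
- apply: nearW => n; apply: log_concave_midpoint_compact => //; try exact: ccompact.
  by move=> x y [Kx _] [Ly _]; exact: KLE.
Qed.

(** * Real-valued probabilities, tail decay, and integrals of bounded functions *)

Definition prR d (T : measurableType d) (R : realType) (P : probability T R) (A : set T) : R :=
  fine (P A).

Lemma prR_ge0 d (T : measurableType d) (R : realType) (P : probability T R) (A : set T) :
  0 <= prR P A.
Proof. exact: fine_ge0. Qed.

Lemma prR_le d (T : measurableType d) (R : realType) (P : probability T R) (A B : set T) :
  measurable A -> measurable B -> A `<=` B -> prR P A <= prR P B.
Proof.
move=> mA mB AB; apply: fine_le; rewrite ?fin_num_measure //.
by apply: le_measure => //; rewrite inE.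
Qed.

Lemma prR_setT d (T : measurableType d) (R : realType) (P : probability T R) : prR P setT = 1.
Proof. by rewrite /prR probability_setT. Qed.

Lemma prR_setC d (T : measurableType d) (R : realType) (P : probability T R) (A : set T) :
  measurable A -> prR P (~` A) = 1 - prR P A.
Proof.
by move=> mA; rewrite /prR probability_setC // fineB ?fin_num_measure.
Qed.

Lemma prR_le1 d (T : measurableType d) (R : realType) (P : probability T R) (A : set T) :
  measurable A -> prR P A <= 1.
Proof. by move=> mA; rewrite -(prR_setT P); apply: prR_le. Qed.

Lemma prR_setU d (T : measurableType d) (R : realType) (P : probability T R) (A B : set T) :
  measurable A -> measurable B -> prR P (A `|` B) <= prR P A + prR P B.
Proof.
move=> mA mB; rewrite /prR -fineD ?fin_num_measure //.
apply: fine_le; rewrite ?fin_numD ?fin_num_measure //; first exact: measurableU.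
exact: measureU2.
Qed.

Lemma prR_setI_ge d (T : measurableType d) (R : realType) (P : probability T R) (A B : set T) :
  measurable A -> measurable B -> prR P A - prR P (~` B) <= prR P (A `&` B).
Proof.
move=> mA mB; rewrite lerBlDr.
apply: le_trans (prR_setU _ (measurableI _ _ mA mB) (measurableC mB)).
apply: prR_le => //.
  by apply: measurableU; [exact: measurableI|exact: measurableC].
by move=> w Aw /=; have [Bw|nBw] := pselect (B w); [left|right].
Qed.

(* {N >= c} and {N <= a} average into {N >= (c - a) / 2}, so the tail is squared whenever
   the threshold a (2^(i+1) - 1) passes from i to i + 1. *)
Lemma log_concave_tail (R : realType) m (Omega : measurableType m)
  (P : probability Omega R) d (X : Omega -> 'rV[R]_d) (N : 'rV[R]_d -> R) (a delta : R) :
  random_vector X -> log_concave P X -> continuous N -> 0 < a -> delta <= 4^-1 ->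
  (forall x y, 2^-1 * N x - 2^-1 * N y <= N (2^-1 *: x + 2^-1 *: y)) ->
  prR P [set w | a <= N (X w)] <= delta ->
  forall i, prR P [set w | (2 ^+ i.+1 - 1) * a <= N (X w)] <= (4 / 3 * delta) ^+ (2 ^ i).
Proof.
move=> rX lc cN a0 d4 HN Hd.
have clo (c : R) : closed [set x | c <= N x].
  by apply: (@closed_comp _ _ N [set y | c <= y]) => [x _|]; [exact: cN|exact: closed_ge].
have clo' (c : R) : closed [set x | N x <= c].
  by apply: (@closed_comp _ _ N [set y | y <= c]) => [x _|]; [exact: cN|exact: closed_le].
have mge (c : R) : measurable [set w | c <= N (X w)].
  exact: (random_vector_closed rX (clo c)).
have mle (c : R) : measurable [set w | N (X w) <= c].
  exact: (random_vector_closed rX (clo' c)).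
have Ba : 3 / 4 <= prR P [set w | N (X w) <= a].
  apply: (@le_trans _ _ (prR P (~` [set w | a <= N (X w)]))).
    by rewrite prR_setC //; lra.
  apply: prR_le => //; first exact: measurableC.
  by move=> w /= /negP; rewrite -ltNge => /ltW.
(* The midpoint inequality has the mass of {N <= a}, at least 3/4, on its left. Carrying the factor
   4/3 along absorbs it and makes the recursion an exact squaring. *)
suff H i : 4 / 3 * prR P [set w | (2 ^+ i.+1 - 1) * a <= N (X w)] <= (4 / 3 * delta) ^+ (2 ^ i).
  move=> i; apply: le_trans (H i); have := prR_ge0 P [set w | (2 ^+ i.+1 - 1) * a <= N (X w)]; lra.
elim: i => [|i IH].
  rewrite expr1 expn0 expr1 (_ : 2 - 1 = 1) ?mul1r; last by lra.
  by rewrite ler_pM2l //; lra.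
have bm : prR P [set w | (2 ^+ i.+2 - 1) * a <= N (X w)] * prR P [set w | N (X w) <= a]
    <= prR P [set w | (2 ^+ i.+1 - 1) * a <= N (X w)] ^+ 2.
  apply: (@log_concave_midpoint R m Omega P d X [set x | (2 ^+ i.+2 - 1) * a <= N x]
    [set x | N x <= a] [set x | (2 ^+ i.+1 - 1) * a <= N x] rX lc (clo _) (clo' _) (mge _)) => x y /= hx hy.
  apply: le_trans (HN x y).
  by move: hx; rewrite [2 ^+ i.+2]exprS; move: (2 ^+ i.+1) => z; nra.
have p0 := prR_ge0 P [set w | (2 ^+ i.+2 - 1) * a <= N (X w)].
have q0 := prR_ge0 P [set w | (2 ^+ i.+1 - 1) * a <= N (X w)].
rewrite expnSr exprM; apply: (@le_trans _ _ ((4 / 3 * prR P [set w | (2 ^+ i.+1 - 1) * a <= N (X w)]) ^+ 2)).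
  by move: bm p0 q0 Ba; move: (prR _ _) (prR _ _) (prR _ _) => u v z; nra.
by rewrite lerXn2r ?nnegrE //; [lra|apply: le_trans IH; lra].
Qed.

(* A class of integrable functions that is closed under products. *)
Definition bmf d (T : measurableType d) (R : realType) (f : T -> R) : Prop :=
  measurable_fun setT f /\ exists M : R, forall w, `|f w| <= M.

Lemma bmf_cst d (T : measurableType d) (R : realType) (c : R) : bmf (fun _ : T => c).
Proof. by split; [exact: measurable_cst|exists `|c|]. Qed.

Lemma bmfD d (T : measurableType d) (R : realType) (f g : T -> R) :
  bmf f -> bmf g -> bmf (fun w => f w + g w).
Proof.
move=> [mf [M fM]] [mg [M' gM]]; split; first exact: measurable_funD.
by exists (M + M') => w; apply: le_trans (ler_normD _ _) _; apply: lerD.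
Qed.

Lemma bmfM d (T : measurableType d) (R : realType) (f g : T -> R) :
  bmf f -> bmf g -> bmf (fun w => f w * g w).
Proof.
move=> [mf [M fM]] [mg [M' gM]]; split; first exact: measurable_funM.
by exists (M * M') => w; rewrite normrM; apply: ler_pM.
Qed.

Lemma bmfZ d (T : measurableType d) (R : realType) (c : R) (f : T -> R) :
  bmf f -> bmf (fun w => c * f w).
Proof. by move=> bf; apply: bmfM => //; exact: bmf_cst. Qed.

Lemma bmfB d (T : measurableType d) (R : realType) (f g : T -> R) :
  bmf f -> bmf g -> bmf (fun w => f w - g w).
Proof.
move=> bf bg; rewrite (_ : (fun w => _) = (fun w => f w + (-1) * g w)).
  by apply: bmfD => //; exact: bmfZ.
by apply/funext => w; rewrite mulN1r.
Qed.

Lemma bmf_norm d (T : measurableType d) (R : realType) (f : T -> R) :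
  bmf f -> bmf (fun w => `|f w|).
Proof.
move=> [mf [M fM]]; split; first exact: measurableT_comp.
by exists M => w; rewrite normr_id.
Qed.

Lemma bmf_sum d (T : measurableType d) (R : realType) (I : Type) (r : seq I) (f : I -> T -> R) :
  (forall i, bmf (f i)) -> bmf (fun w => \sum_(i <- r) f i w).
Proof.
move=> bf; elim: r => [|i r IH].
  by under eq_fun do rewrite big_nil; exact: bmf_cst.
by under eq_fun do rewrite big_cons; exact: bmfD.
Qed.

Lemma bmf_indic d (T : measurableType d) (R : realType) (A : set T) :
  measurable A -> bmf (\1_A : T -> R).
Proof.
move=> mA; split; first exact: measurable_indic.
by exists 1 => w; rewrite indicE ger0_norm ?ler0n // lern1; case: (_ \in _).
Qed.

Lemma bmf_integrable d (T : measurableType d) (R : realType) (P : probability T R) (f : T -> R) :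
  bmf f -> P.-integrable setT (EFin \o f).
Proof.
move=> [mf [M fM]]; apply: measurable_bounded_integrable => //.
  by apply: (le_lt_trans (probability_le1 P measurableT)); rewrite ltry.
by exists M; split; [exact: num_real|move=> x xM w _; exact: le_trans (fM w) (ltW xM)].
Qed.

Lemma RintD d (T : measurableType d) (R : realType) (P : probability T R) (f g : T -> R) :
  bmf f -> bmf g -> \int[P]_w (f w + g w) = \int[P]_w f w + \int[P]_w g w.
Proof. by move=> bf bg; apply: RintegralD => //; exact: bmf_integrable. Qed.

Lemma RintB d (T : measurableType d) (R : realType) (P : probability T R) (f g : T -> R) :
  bmf f -> bmf g -> \int[P]_w (f w - g w) = \int[P]_w f w - \int[P]_w g w.
Proof. by move=> bf bg; apply: RintegralB => //; exact: bmf_integrable. Qed.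

Lemma RintZ d (T : measurableType d) (R : realType) (P : probability T R) (c : R) (f : T -> R) :
  bmf f -> \int[P]_w (c * f w) = c * \int[P]_w f w.
Proof. by move=> bf; apply: RintegralZl => //; exact: bmf_integrable. Qed.

Lemma Rint_sum d (T : measurableType d) (R : realType) (P : probability T R)
    (I : Type) (r : seq I) (f : I -> T -> R) :
  (forall i, bmf (f i)) ->
  \int[P]_w (\sum_(i <- r) f i w) = \sum_(i <- r) \int[P]_w f i w.
Proof.
move=> bf; elim: r => [|i r IH].
  under eq_Rintegral do rewrite big_nil.
  by rewrite Rintegral_cst // mul0r big_nil.
under eq_Rintegral do rewrite big_cons.
by rewrite RintD ?big_cons ?IH //; exact: bmf_sum.
Qed.

Lemma Rint_le d (T : measurableType d) (R : realType) (P : probability T R) (f g : T -> R) :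
  bmf f -> bmf g -> (forall w, f w <= g w) -> \int[P]_w f w <= \int[P]_w g w.
Proof. by move=> bf bg fg; apply: le_Rintegral => //; exact: bmf_integrable. Qed.

Lemma Rint_cst d (T : measurableType d) (R : realType) (P : probability T R) (c : R) :
  \int[P]_w c = c.
Proof. by rewrite Rintegral_cst // -/(prR P setT) prR_setT mulr1. Qed.

Lemma Rint_indic d (T : measurableType d) (R : realType) (P : probability T R) (A : set T) :
  measurable A -> \int[P]_w (\1_A w : R) = prR P A.
Proof. by move=> mA; rewrite /Rintegral integral_indic // setIT. Qed.

Lemma Rint_norm d (T : measurableType d) (R : realType) (P : probability T R) (f : T -> R) :
  bmf f -> `|\int[P]_w f w| <= \int[P]_w `|f w|.
Proof. by move=> bf; apply: le_normr_Rintegral => //; exact: bmf_integrable. Qed.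

(** * Random signs *)

(** Odd terms cancel in the exponential series. The first two even terms give the lower bound;
    [2 ^ k * k! <= (2k)!] compares the even series term by term with that of exp(z^2 / 2). *)
Lemma expR_add_expRN (R : realType) (z : R) :
  2 + z ^+ 2 <= expR z + expR (- z) <= 2 * expR (z ^+ 2 / 2).
Proof.
pose c n : R := series (exp_coeff z) n.*2 + series (exp_coeff (- z)) n.*2.
have cE n : c n = 2 * \sum_(0 <= k < n) z ^+ k.*2 / (k.*2)`!%:R.
  elim: n => [|n IH]; first by rewrite /c /series /= !big_nil; ring.
  rewrite big_nat_recr //= mulrDr -IH /c /series /= doubleS !big_nat_recr //= /exp_coeff /=.
  have e1 : (- z) ^+ n.*2 = z ^+ n.*2 by rewrite exprNn -signr_odd odd_double mul1r.
  have e2 : (- z) ^+ n.*2.+1 = - z ^+ n.*2.+1 by rewrite !exprS e1 mulNr.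
  rewrite e1 e2.
  rewrite mulNr; move: (z ^+ n.*2 / (n.*2)`!%:R) (z ^+ n.*2.+1 / (n.*2.+1)`!%:R)
    (\sum_(0 <= i < n.*2) z ^+ i / i`!%:R) (\sum_(0 <= i < n.*2) (- z) ^+ i / i`!%:R).
  by move=> A B C D; lra.
have dbl : (fun n => n.*2) @ \oo --> \oo.
  by move=> A [N _ AN]; exists N => // n /= Nn; apply: AN => /=; lia.
have cvc : c @ \oo --> expR z + expR (- z).
  apply: cvgD.
    exact: (cvg_comp _ _ dbl (is_cvg_series_exp_coeff z)).
  exact: (cvg_comp _ _ dbl (is_cvg_series_exp_coeff (- z))).
apply/andP; split.
  apply: (ler_cvg_to (cvg_cst _) cvc); exists 2%N => // n /= n2.
  rewrite cE -(subnK n2) addnC big_nat_recl // big_nat_recl //=.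
  have : 0 <= \sum_(0 <= i < n - 2) z ^+ i.+2.*2 / (i.+2.*2)`!%:R :> R.
    by apply: sumr_ge0 => i _; rewrite divr_ge0 // -mul2n exprM exprn_ge0 // sqr_ge0.
  rewrite [z ^+ 0.*2]expr0 -[(0.*2)`!]/1%N -[(1.*2)`!]/2%N -[1.*2]/2%N divr1.
  by move: (\sum_(0 <= i < n - 2) _) (z ^+ 2) => S q; lra.
apply: (ler_cvg_to cvc (cvg_cst _)); apply: nearW => n.
rewrite cE ler_pM2l //.
apply: (@le_trans _ _ (series (exp_coeff (z ^+ 2 / 2)) n)); last first.
  apply: nondecreasing_cvgn_le; last exact: is_cvg_series_exp_coeff.
  by apply/nondecreasing_seqP => k; rewrite /series /= big_nat_recr //= lerDl
    exp_coeff_ge0 // divr_ge0 // sqr_ge0.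
apply: ler_sum_nat => k _; rewrite /exp_coeff /= expr_div_n -exprM mul2n -mulrA.
apply: ler_wpM2l; first by rewrite -mul2n exprM exprn_ge0 // sqr_ge0.
rewrite -invfM lef_pV2 ?posrE ?mulr_gt0 ?exprn_gt0 ?ltr0n ?fact_gt0 //.
rewrite -natrX -natrM ler_nat; elim: k => [|k IH] //.
rewrite doubleS !factS expnS; move: IH; move: (2 ^ k)%N (k`!) ((k.*2)`!) => a b c'; nia.
Qed.

Lemma mul_expRN_le (R : realType) (t : R) : t * expR (- t) <= 1.
Proof.
rewrite -[X in _ <= X](expRxMexpNx_1 t) ler_pM2r ?expR_gt0 //.
have := expR_ge1Dx t; lra.
Qed.

Lemma sqr_mul_expRN_le (R : realType) (t : R) : 0 <= t -> t ^+ 2 * expR (- t) <= 2.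
Proof.
move=> t0; rewrite -(mulr1 2) -[X in _ <= 2 * X](expRxMexpNx_1 t) mulrA.
rewrite ler_pM2r ?expR_gt0 //.
have := expR_ge1Dxn 1 t0; rewrite (_ : 2`!%:R = 2) //; move: (t ^+ 2) => q; lra.
Qed.

(** With Y = y^2 and v = a^2 the average is exp(-Y/2) exp(-v/2) cosh(y a). It agrees with the second
    term to first order in v, and the powers of Y in the remainder are absorbed by exponential decay
    in Y, uniformly in y. *)
Lemma sign_step_normalized (R : realType) (y a : R) : a ^+ 2 <= 1 / 2 ->
  `|(expR (- ((y + a) ^+ 2 / 2)) + expR (- ((y - a) ^+ 2 / 2))) / 2
    - (Num.sqrt (1 + a ^+ 2))^-1 * expR (- (y ^+ 2 / (2 * (1 + a ^+ 2))))| <= 9 * a ^+ 4.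
Proof.
set v := a ^+ 2 => v12.
have v0 : 0 <= v by exact: sqr_ge0.
have -> : a ^+ 4 = v ^+ 2 by rewrite /v -exprM.
set S := Num.sqrt (1 + v).
have S2 : S ^+ 2 = 1 + v by rewrite sqr_sqrtr //; lra.
have S1 : 1 <= S by rewrite -sqrtr1 ler_sqrt; lra.
have S0 : 0 < S by lra.
pose Y := y ^+ 2; have Y0 : 0 <= Y by exact: sqr_ge0.
have -> : (expR (- ((y + a) ^+ 2 / 2)) + expR (- ((y - a) ^+ 2 / 2))) / 2 =
    expR (- (Y / 2)) * expR (- (v / 2)) * ((expR (y * a) + expR (- (y * a))) / 2).
  rewrite mulrA; congr (_ / 2); rewrite mulrDr -!expRD addrC.
  by congr (expR _ + expR _); rewrite /Y /v; field.
have /andP[] := expR_add_expRN (y * a).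
have -> : (y * a) ^+ 2 = Y * v by rewrite exprMn.
set ch := expR (y * a) + _ => ch1 ch2.
have eS : expR (- (v / 2)) <= S^-1.
  rewrite expRN lef_pV2 ?posrE ?expR_gt0 //.
  rewrite -(@ler_pXn2r _ 2) ?nnegrE ?(ltW S0) ?expR_ge0 // S2.
  rewrite -expRM_natl mulrC divfK //; exact: expR_ge1Dx.
have Sv : S^-1 <= 1 - v / 2 + v ^+ 2 / 2.
  rewrite -(@ler_pM2r _ S) // mulVf ?gt_eqF //.
  have : 1 <= ((1 - v / 2 + v ^+ 2 / 2) * S) ^+ 2.
    by rewrite exprMn S2; nra.
  have h : 0 <= (1 - v / 2 + v ^+ 2 / 2) * S by apply: mulr_ge0; nra.
  by move=> h2; rewrite -(@ler_pXn2r _ 2) ?nnegrE // expr1n.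
have ev := expR_ge1Dx (- (v / 2)).
have eY1 : expR (- (Y / 2)) <= 1 by rewrite expR_le1; lra.
have eY0 := expR_gt0 (- (Y / 2)).
have ev0 := expR_gt0 (- (v / 2)).
have SV0 : 0 < S^-1 by rewrite invr_gt0.
have SV1 : S^-1 <= 1 by rewrite invf_le1.
rewrite ler_norml; apply/andP; split.
(* Gaussian term minus average: extract exp(-Y/2) and expand the remaining exp(x) to first order. As
   v <= 1/2 forces x <= Y/4, the quadratic remainder is at most 8 v^2. *)
- pose x := Y * v / (2 * (1 + v)).
  have x0 : 0 <= x by apply: divr_ge0; [exact: mulr_ge0|lra].
  have xY : x <= Y * v / 2.
    rewrite /x invfM mulrA ler_piMr //; first by rewrite divr_ge0 // mulr_ge0.
    by rewrite invf_le1; lra.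
  have -> : - (Y / (2 * (1 + v))) = - (Y / 2) + x by rewrite /x; field; lra.
  have ex : expR x <= 1 + x + x ^+ 2 * expR x.
    have h : 1 <= (1 + x) * expR (- x) + x ^+ 2 by have := expR_ge1Dx (- x); nra.
    have := expRxMexpNx_1 x; have := expR_gt0 x; move: h.
    by move: (expR x) (expR (- x)) => A B; nra.
  have tail : expR (- (Y / 2) + x) * x ^+ 2 <= 8 * v ^+ 2.
    have le1 : expR (- (Y / 2) + x) <= expR (- (Y / 4)) by rewrite ler_expR; nra.
    have := @sqr_mul_expRN_le R (Y / 4); rewrite divr_ge0 // => /(_ isT) h.
    apply: (@le_trans _ _ (expR (- (Y / 4)) * (Y * v / 2) ^+ 2)).
      by apply: ler_pM; rewrite ?expR_ge0 ?sqr_ge0 // lerXn2r ?nnegrE ?(le_trans x0).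
    by move: h; move: (expR _) (expR_ge0 (- (Y / 4))) => E E0 h; nra.
  rewrite expRD in tail *.
  have E2 : expR (- (Y / 2)) * (1 + Y / 4) <= 1.
    have := expRxMexpNx_1 (Y / 2); have := expR_ge1Dx (Y / 2); nra.
  have := expR_gt0 x; move: ex tail E2 eS Sv ev ch1 eY0 ev0 SV0 SV1 xY.
  rewrite -/Y; move: (expR x) (expR (- (Y / 2))) (expR (- (v / 2))) (S^-1) => A B C D.
  move=> ex tail E2 eS Sv ev ch1 B0 C0 D0 D1 xY A0.
  have h1 : D * (B * A) <= D * B * (1 + Y * v / 2) + 8 * v ^+ 2.
    have : D * (B * A) <= D * B * (1 + x) + D * (B * A * x ^+ 2).
      have : 0 <= D * B * (1 + x + x ^+ 2 * A - A) by rewrite !mulr_ge0 //; lra.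
      nra.
    have : D * (B * A * x ^+ 2) <= B * A * x ^+ 2.
      by apply: ler_piMl => //; apply: mulr_ge0; [apply: mulr_ge0; exact: ltW|exact: sqr_ge0].
    have : D * B * (1 + x) <= D * B * (1 + Y * v / 2) by rewrite ler_pM2l ?mulr_gt0 //; lra.
    lra.
  have h2 : B * C * (ch / 2) >= B * C * (1 + Y * v / 2).
    by rewrite ler_pM2l ?mulr_gt0 //; lra.
  have h3 : D * B * (1 + Y * v / 2) - B * C * (1 + Y * v / 2) <= v ^+ 2 / 2.
    have -> : D * B * (1 + Y * v / 2) - B * C * (1 + Y * v / 2) = (D - C) * (B * (1 + Y * v / 2)) by ring.
    have b1 : B * (1 + Y * v / 2) <= 1 by nra.
    have b0 : 0 <= B * (1 + Y * v / 2) by nra.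
    nra.
  have := sqr_ge0 v; lra.
(* Average minus Gaussian term: the upper bound on cosh turns the average into a Gaussian with 1 - v
   in place of 1 / (1 + v), and these two differ by v^2 / (1 + v). *)
- have c1 : expR (- (Y / 2)) * expR (- (v / 2)) * (ch / 2) <=
     S^-1 * expR (- (Y * (1 - v) / 2)).
    have -> : - (Y * (1 - v) / 2) = - (Y / 2) + Y * v / 2 by field.
    rewrite expRD; move: ch2 eS eY0 ev0.
    have := expR_gt0 (Y * v / 2).
    move: (expR _) (expR _) (expR _) (S^-1) => A B C D A0 ch2 eS B0 C0.
    have : A * B * (ch / 2) <= A * B * C by rewrite ler_pM2l ?mulr_gt0 //; lra.
    have : 0 <= (D - B) * (A * C).
      by apply: mulr_ge0; [lra|apply: mulr_ge0; exact: ltW].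
    lra.
  have c2 : expR (- (Y * (1 - v) / 2)) - expR (- (Y / (2 * (1 + v)))) <= 2 * v ^+ 2.
    set al := Y * (1 - v) / 2; set be := Y / (2 * (1 + v)).
    have d : be - al = Y / 2 * (v ^+ 2 / (1 + v)) by rewrite /al /be; field; lra.
    have d1 : be - al <= Y / 2 * v ^+ 2.
      rewrite d; apply: ler_wpM2l; first lra.
      by rewrite ler_piMr ?sqr_ge0 // invf_le1; lra.
    have -> : - be = - al + - (be - al) by ring.
    rewrite expRD.
    have e1 := expR_ge1Dx (- (be - al)).
    have al4 : expR (- al) <= expR (- (Y / 4)) by rewrite ler_expR /al; nra.
    have := mul_expRN_le (Y / 4).
    have := expR_gt0 (- al); have := expR_gt0 (- (Y / 4)).
    move: al4 e1; move: (expR (- al)) (expR (- (be - al))) (expR (- (Y / 4))) => A B C.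
    move=> al4 e1 C0 A0 h.
    have : A - A * B <= A * (Y / 2 * v ^+ 2) by nra.
    have : A * (Y / 2 * v ^+ 2) <= C * (Y / 2 * v ^+ 2).
      by apply: ler_wpM2r => //; rewrite mulr_ge0 ?sqr_ge0 //; lra.
    have : C * (Y / 2 * v ^+ 2) = 2 * v ^+ 2 * (Y / 4 * C) by field.
    have := sqr_ge0 v; nra.
  rewrite -/Y; move: c1 c2 SV1 SV0; move: (expR (- (Y * _ / 2))) (expR (- (Y / (2 * _)))) => E F.
  have := sqr_ge0 v; nra.
Qed.

(** The density at [y] of a centred Gaussian of variance [T], without the factor (2 pi)^(-1/2). *)
Definition heat (R : realType) (T y : R) : R :=
  (Num.sqrt T)^-1 * expR (- (y ^+ 2 / (2 * T))).

(* One random sign costs only a^4: averaging over +-a agrees with increasing the variance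
   by a^2 up to the fourth order. *)
Lemma sign_step (R : realType) (T y a : R) : 1 <= T -> a ^+ 2 <= 1 / 2 ->
  `|(heat T (y + a) + heat T (y - a)) / 2 - heat (T + a ^+ 2) y| <= 9 * a ^+ 4.
Proof.
move=> T1 a12; set S := Num.sqrt T.
have T0 : 0 < T by lra.
have S2 : S ^+ 2 = T by rewrite sqr_sqrtr //; lra.
have S1 : 1 <= S by rewrite -sqrtr1 ler_sqrt; lra.
have S0 : 0 < S by lra.
have Sn : S != 0 by rewrite gt_eqF.
have aT : (a / S) ^+ 2 <= 1 / 2.
  rewrite expr_div_n S2; apply: le_trans a12.
  by rewrite ler_pdivrMr // ler_peMr ?sqr_ge0.
have := @sign_step_normalized R (y / S) (a / S) aT.
rewrite /heat -/S.
have e1 (z : R) : (z / S) ^+ 2 / 2 = z ^+ 2 / (2 * T).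
  by rewrite expr_div_n S2 invfM; ring.
rewrite -mulrDl -mulrBl !e1.
have -> : Num.sqrt (T + a ^+ 2) = S * Num.sqrt (1 + (a / S) ^+ 2).
  by rewrite -sqrtrM ?(ltW T0) //; congr Num.sqrt; rewrite expr_div_n S2; field; rewrite gt_eqF.
have -> : (y / S) ^+ 2 / (2 * (1 + (a / S) ^+ 2)) = y ^+ 2 / (2 * (T + a ^+ 2)).
  by rewrite !expr_div_n S2; field; rewrite ?gt_eqF //; have := sqr_ge0 a; lra.
move=> h; rewrite (invfM S).
have -> (A B C D : R) : (S^-1 * A + S^-1 * B) / 2 - S^-1 * C * D = S^-1 * ((A + B) / 2 - C * D).
  by ring.
rewrite normrM gtr0_norm ?invr_gt0 //.
apply: (@le_trans _ _ (S^-1 * (9 * (a / S) ^+ 4))).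
  by rewrite ler_pM2l ?invr_gt0.
have SV1 : S^-1 <= 1 by rewrite invf_le1.
have SV0 : 0 < S^-1 by rewrite invr_gt0.
have p4 : S^-1 ^+ 4 <= 1 by rewrite exprn_ile1 // ltW.
rewrite exprMn; have a4 : 0 <= a ^+ 4 by rewrite (exprM a 2 2) sqr_ge0.
rewrite (mulrCA _ 9) ler_pM2l // mulrCA ler_piMr // mulr_ile1 ?exprn_ge0 //; exact: ltW.
Qed.

(** Expectation over [n] independent fair signs; the recursion lets inductions condition on the
    first sign without a probability space of signs. *)
Fixpoint savg (R : realType) (n : nat) (F : seq bool -> R) : R :=
  if n is n'.+1 then (savg n' (fun s => F (true :: s)) + savg n' (fun s => F (false :: s))) / 2
  else F [::].

Fixpoint signsum (V : zmodType) (vs : seq V) (s : seq bool) : V :=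
  match vs, s with
  | v :: vs', b :: s' => (if b then v else - v) + signsum vs' s'
  | _, _ => 0
  end.

Lemma savg_le (R : realType) n (F G : seq bool -> R) :
  (forall s, F s <= G s) -> savg n F <= savg n G.
Proof.
elim: n F G => [|n IH] F G FG /=; first exact: FG.
by rewrite ler_pM2r ?invr_gt0 //; apply: lerD; apply: IH.
Qed.

Lemma eq_savg (R : realType) n (F G : seq bool -> R) : F =1 G -> savg n F = savg n G.
Proof. by move=> /funext ->. Qed.

Lemma savgD (R : realType) n (F G : seq bool -> R) :
  savg n (fun s => F s + G s) = savg n F + savg n G.
Proof. by elim: n F G => [|n IH] F G //=; rewrite !IH; field. Qed.

Lemma savgZ (R : realType) n c (F : seq bool -> R) :
  savg n (fun s => c * F s) = c * savg n F.
Proof. by elim: n F => [|n IH] F //=; rewrite !IH; field. Qed.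

Lemma savgB (R : realType) n (F G : seq bool -> R) :
  savg n (fun s => F s - G s) = savg n F - savg n G.
Proof. by elim: n F G => [|n IH] F G //=; rewrite !IH; field. Qed.

Lemma savg_cst (R : realType) n (c : R) : savg n (fun=> c) = c.
Proof. by elim: n => [|n IH] //=; rewrite !IH; field. Qed.

Lemma savg_sqr (R : realType) n (F : seq bool -> R) :
  savg n F ^+ 2 <= savg n (fun s => F s ^+ 2).
Proof.
set c := savg n F.
have : 0 <= savg n (fun s => (F s - c) ^+ 2).
  by rewrite -(savg_cst n 0); apply: savg_le => s; exact: sqr_ge0.
rewrite (_ : savg n _ = savg n (fun s => F s ^+ 2 - (2 * c) * F s + c ^+ 2)); last first.
  by apply: eq_savg => s; ring.
by rewrite savgD savgB savgZ savg_cst -/c; nra.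
Qed.

(** Lindeberg replacement: each sign is exchanged for a Gaussian of the same variance, and the
    errors of [sign_step] add up. Its condition 1 <= T survives because variances only grow. *)
Lemma heat_signsum (R : realType) (a : seq R) (T y : R) : 1 <= T ->
  (forall x, x \in a -> x ^+ 2 <= 1 / 2) ->
  `|savg (size a) (fun s => heat T (y + signsum a s)) - heat (T + \sum_(x <- a) x ^+ 2) y|
    <= 9 * \sum_(x <- a) x ^+ 4.
Proof.
move=> T1; elim: a y => [|x a IH] y ha /=.
  by rewrite !big_nil !addr0 subrr normr0 mulr0.
have ha' z : z \in a -> z ^+ 2 <= 1 / 2 by move=> za; apply: ha; rewrite inE za orbT.
have h1 := IH (y + x) ha'; have h2 := IH (y - x) ha'.
have s0 : 0 <= \sum_(z <- a) z ^+ 2 by apply: sumr_ge0 => z _; exact: sqr_ge0.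
have T1' : 1 <= T + \sum_(z <- a) z ^+ 2 by lra.
have h3 := sign_step y T1' (ha x (mem_head _ _)).
rewrite !big_cons (addrC (x ^+ 2)) addrA.
rewrite (_ : savg _ (fun s => heat T (y + (x + signsum a s))) =
             savg (size a) (fun s => heat T (y + x + signsum a s))); last first.
  by apply: eq_savg => s; rewrite addrA.
rewrite (_ : savg _ (fun s => heat T (y + (- x + signsum a s))) =
             savg (size a) (fun s => heat T (y - x + signsum a s))); last first.
  by apply: eq_savg => s; rewrite addrA.
move: h1 h2 h3; move: (savg _ _) (savg _ _) (heat _ _) (heat _ _) (heat _ _) => A B C D E.
by rewrite !ler_norml => /andP[? ?] /andP[? ?] /andP[? ?]; apply/andP; split; lra.
Qed.

(* Efron-Stein, with the discrete derivatives of f replaced by linearizations dd with error e. *)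
Lemma savg_variance (R : realType) (V : zmodType) (f : V -> R) (dd : V -> V -> R)
    (e : V -> R) (vs : seq V) :
  (forall g v, v \in vs -> `|f (g + v + v) - f g - 2 * dd v g| <= e v /\
     `|f g - f (g - v - v) - 2 * dd v g| <= e v) ->
  forall g, savg (size vs) (fun s => f (g + signsum vs s) ^+ 2)
     - savg (size vs) (fun s => f (g + signsum vs s)) ^+ 2 <=
   savg (size vs) (fun s => \sum_(v <- vs) (2 * dd v (g + signsum vs s) ^+ 2 + 2^-1 * e v ^+ 2)).
Proof.
elim: vs => [|v vs IH] H g /=.
  by rewrite big_nil addr0 subrr.
have H' : forall g' v', v' \in vs -> `|f (g' + v' + v') - f g' - 2 * dd v' g'| <= e v' /\
     `|f g' - f (g' - v' - v') - 2 * dd v' g'| <= e v'.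
  by move=> g' v' v'vs; apply: H; rewrite inE v'vs orbT.
have E (u : V) (F : V -> R) : savg (size vs) (fun s => F (g + (u + signsum vs s))) =
    savg (size vs) (fun s => F (g + u + signsum vs s)).
  by apply: eq_savg => s; rewrite addrA.
rewrite !(E _ (fun z => f z ^+ 2)) !(E _ f).
rewrite !(E _ (fun z => \sum_(v' <- v :: vs) (2 * dd v' z ^+ 2 + 2^-1 * e v' ^+ 2))).
have {}IH u := IH H' (g + u).
have := IH v; have := IH (- v).
set mp := savg _ (fun s => f (g + v + signsum vs s)).
set mm := savg _ (fun s => f (g - v + signsum vs s)).
(* By the law of total variance the first sign contributes (mp - mm)^2 / 4. The difference of [f]
   across [v] is linearized at both of its ends, so that the bound is again an average over that
   sign. *)
have key : (mp - mm) ^+ 2 / 4 <=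
    (savg (size vs) (fun s => 2 * dd v (g + v + signsum vs s) ^+ 2 + 2^-1 * e v ^+ 2) +
     savg (size vs) (fun s => 2 * dd v (g - v + signsum vs s) ^+ 2 + 2^-1 * e v ^+ 2)) / 2.
  rewrite -savgB -savgD.
  rewrite ler_pdivrMr // -mulrA (_ : 2^-1 * 4 = 2); last by field.
  apply: le_trans (savg_sqr _ _) _; rewrite mulrC -savgZ; apply: savg_le => s.
  have [h1 _] := H (g - v + signsum vs s) v (mem_head _ _).
  have [_ h2] := H (g + v + signsum vs s) v (mem_head _ _).
  move: h1 h2.
  rewrite (_ : g - v + signsum vs s + v + v = g + v + signsum vs s); last first.
    by rewrite -!addrA; congr (g + _); rewrite !addrA (addrC (- v)) subrK addrC.
  rewrite (_ : g + v + signsum vs s - v - v = g - v + signsum vs s); last first.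
    by rewrite -!addrA; congr (g + _); rewrite !addrA (addrC v) addrK addrC.
  move: (f _) (f _) (dd _ _) (dd _ _) (e v) => A B C D e'.
  have sq (x z : R) : `|x - 2 * z| <= e' -> x ^+ 2 <= 8 * z ^+ 2 + 2 * e' ^+ 2.
    move=> h; have : `|x - 2 * z| ^+ 2 <= e' ^+ 2.
      by rewrite lerXn2r ?nnegrE // (le_trans _ h).
    by rewrite real_normK ?num_real //; have := sqr_ge0 (2 * z - (x - 2 * z)); nra.
  by move=> /sq ? /sq ?; lra.
rewrite (_ : savg (size vs) (fun s => \sum_(v' <- v :: vs) (2 * dd v' (g + v + signsum vs s) ^+ 2 + 2^-1 * e v' ^+ 2))
  = savg (size vs) (fun s => 2 * dd v (g + v + signsum vs s) ^+ 2 + 2^-1 * e v ^+ 2) +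
    savg (size vs) (fun s => \sum_(v' <- vs) (2 * dd v' (g + v + signsum vs s) ^+ 2 + 2^-1 * e v' ^+ 2))); last first.
  by rewrite -savgD; apply: eq_savg => s; rewrite big_cons.
rewrite (_ : savg (size vs) (fun s => \sum_(v' <- v :: vs) (2 * dd v' (g - v + signsum vs s) ^+ 2 + 2^-1 * e v' ^+ 2))
  = savg (size vs) (fun s => 2 * dd v (g - v + signsum vs s) ^+ 2 + 2^-1 * e v ^+ 2) +
    savg (size vs) (fun s => \sum_(v' <- vs) (2 * dd v' (g - v + signsum vs s) ^+ 2 + 2^-1 * e v' ^+ 2))); last first.
  by rewrite -savgD; apply: eq_savg => s; rewrite big_cons.
move: key; move: (savg _ _) (savg _ _) (savg _ _) (savg _ _) (savg _ _) (savg _ _) mp mm.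
by move=> a b c d' x y mp mm; nra.
Qed.

(** * Moments *)

(** The lower ends are the thresholds of [log_concave_tail]. The least [i] meeting the upper bound
    works, because failure at i - 1 gives more than the lower bound asks. *)
Lemma dyadic_layer (R : realType) (a y : R) : 0 < a -> a <= y ->
  exists i : nat, (2 ^+ i.+1 - 1) * a <= y < 2 ^+ i.+2 * a.
Proof.
move=> a0 ay.
have ex : exists i : nat, y < 2 ^+ i.+2 * a.
  exists (Num.truncn (y / a)).+1; rewrite -ltr_pdivrMr //.
  apply: lt_trans (truncnS_gt _) _.
  apply: (@lt_trans _ _ ((Num.truncn (y / a)).+3)%:R); first by rewrite ltr_nat ltnS leqnSn.
  by rewrite -natrX ltr_nat ltn_expl.
case: (ex_minnP ex) => i hi min; exists i; rewrite hi andbT.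
case: i hi min => [|i] _ min; first by rewrite expr1; lra.
rewrite leNgt; apply/negP => h; have /min : y < 2 ^+ i.+2 * a.
  by apply: lt_le_trans h _; rewrite ler_pM2r //; lra.
by rewrite ltnn.
Qed.

(** The left side is a [p]-th power, so t^2 exp(-t) <= 2 at t = 2^i / K suffices. It leaves a spare
    factor 2^(-ip) <= 2^(-i), which makes the layers summable. *)
Lemma layer_moment (R : realType) (K a p : R) (i : nat) : 0 < K -> 0 < a -> 1 <= p ->
  (2 ^+ i.+2 * a) `^ p * expR (- (p / K * 2 ^+ i)) <=
  (8 * K ^+ 2 * a) `^ p * 2^-1 ^+ i.
Proof.
move=> K0 a0 p1; have p0 : 0 <= p by lra.
have -> : expR (- (p / K * 2 ^+ i)) = expR (- (2 ^+ i / K)) `^ p.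
  by rewrite -expRM; congr expR; rewrite mulNr; congr (- _); ring.
set u : R := 2 ^+ i; have u1 : 1 <= u by rewrite exprn_ege1 //; lra.
have u0 : 0 < u by lra.
have t0 : 0 <= u / K by rewrite divr_ge0 // ltW.
have k0 j : 0 <= 2 ^+ j * a by rewrite mulr_ge0 ?exprn_ge0 // ltW.
rewrite -powRM ?expR_ge0 //.
have l0 : 0 <= 2 ^+ i.+2 * a * expR (- (u / K)) by exact: mulr_ge0 (k0 _) (expR_ge0 _).
have c0 : 0 <= 8 * K ^+ 2 * a by rewrite !mulr_ge0 ?sqr_ge0 // ltW.
have r0 : 0 <= 8 * K ^+ 2 * a / u by apply: mulr_ge0 c0 _; rewrite invr_ge0 ltW.
apply: (@le_trans _ _ ((8 * K ^+ 2 * a * u^-1) `^ p)).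
  apply: ge0_ler_powR => //.
  rewrite ler_pdivlMr //.
  have := sqr_mul_expRN_le t0.
  rewrite expr_div_n mulrAC ler_pdivrMr ?exprn_gt0 // => h.
  have -> : 2 ^+ i.+2 = 4 * u by rewrite /u !exprS; ring.
  have -> : 4 * u * a * expR (- (u / K)) * u = 4 * (u ^+ 2 * expR (- (u / K))) * a by ring.
  by rewrite ler_pM2r //; lra.
rewrite powRM ?invr_ge0 ?(ltW u0) //.
apply: ler_wpM2l; first exact: powR_ge0.
have -> : 2^-1 ^+ i = u^-1 by rewrite exprVn.
rewrite -[X in _ <= X]powRr1 ?invr_ge0 ?(ltW u0) //.
by apply: ger_powR => //; rewrite invr_gt0 u0 invf_le1.
Qed.

(** Pointwise, |Y|^p is at most a^p plus the sum over the dyadic layers of the upper end to the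
    power [p]; [layer_moment] bounds the resulting series by a geometric one. *)
Lemma moment_le (R : realType) d (T : measurableType d) (P : probability T R)
    (Y : T -> R) (K a p : R) :
  measurable_fun setT Y -> 1 <= K -> 0 < a -> 1 <= p ->
  (forall i, prR P [set w | (2 ^+ i.+1 - 1) * a <= `|Y w|] <= expR (- (p / K * 2 ^+ i))) ->
  (\int[P]_w (`|Y w| `^ p)%:E <= ((32 * K ^+ 2 * a) `^ p)%:E)%E.
Proof.
move=> mY K1 a0 p1 hP; have K0 : 0 < K by lra.
 have p0 : 0 <= p by lra.
pose E i := [set w | (2 ^+ i.+1 - 1) * a <= `|Y w|].
have mE i : measurable (E i).
  have -> : E i = setT `&` (fun w => `|Y w|) @^-1` [set` `[(2 ^+ i.+1 - 1) * a, +oo[].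
    by apply/seteqP; split=> w /=; rewrite in_itv /= andbT; [split|case].
  have mN : measurable_fun setT (fun w => `|Y w|) by exact: measurableT_comp.
  exact: mN.
pose b i : R := (2 ^+ i.+2 * a) `^ p.
pose F i w : \bar R := (b i * \1_(E i) w)%:E.
have F0 i w : (0 <= F i w)%E by rewrite lee_fin mulr_ge0 ?powR_ge0.
have mF i : measurable_fun setT (F i).
  apply/measurable_EFinP; apply: measurable_funM; first exact: measurable_cst.
  exact: measurable_indic.
have mS : measurable_fun setT (fun w => \sum_(n <oo) F n w)%E.
  exact: ge0_emeasurable_sum.
have mYp : measurable_fun setT (fun w => (`|Y w| `^ p)%:E).
  apply/measurable_EFinP; apply: (@measurableT_comp _ _ _ _ _ _ (fun x : R => x `^ p) _ (fun w => `|Y w|)).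
    exact: measurable_powR.
  exact: measurableT_comp.
apply: (@le_trans _ _ (\int[P]_w ((a `^ p)%:E + \sum_(n <oo) F n w))%E).
  apply: ge0_le_integral => //.
  - by apply: emeasurable_funD => //; exact: measurable_cst.
  move=> w _; have [Ya|Ya] := ltP `|Y w| a.
    apply: (@le_trans _ _ (a `^ p)%:E).
      by rewrite lee_fin ge0_ler_powR ?nnegrE ?(ltW a0) ?(ltW Ya).
    by rewrite leeDl // nneseries_ge0.
  have [i /andP[i1 i2]] := dyadic_layer a0 Ya.
  apply: (@le_trans _ _ (F i w)).
    rewrite /F indicE mem_set // mulr1 lee_fin ge0_ler_powR ?nnegrE ?(ltW i2) //.
    by rewrite mulr_ge0 ?exprn_ge0 // ltW.
  apply: (@le_trans _ _ (\sum_(n <oo) F n w)%E); last by rewrite leeDr // lee_fin powR_ge0.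
  apply: (@le_trans _ _ (\sum_(0 <= n < i.+1) F n w)%E).
    by rewrite big_nat_recr //= leeDr // sume_ge0.
  by apply: nneseries_lim_ge => n _ _.
rewrite ge0_integralD //; last 2 first.
- by move=> w _; rewrite lee_fin powR_ge0.
- by move=> w _; rewrite nneseries_ge0.
have -> : (\int[P]_w (a `^ p)%:E = (a `^ p)%:E)%E.
  by rewrite integral_cst // -[RHS]mule1; congr (_ * _)%E; exact: probability_setT.
rewrite integral_nneseries //.
have I i : (\int[P]_w F i w <= ((8 * K ^+ 2 * a) `^ p * 2^-1 ^+ i)%:E)%E.
  rewrite /F; under eq_integral do rewrite EFinM.
  rewrite ge0_integralZl_EFin ?powR_ge0 //; last first.
    by apply/measurable_EFinP; exact: measurable_indic.
  have -> : (\int[P]_x (\1_(E i) x)%:E)%E = (prR P (E i))%:E.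
    by rewrite integral_indic // setIT; exact: measure_probR.
  rewrite -EFinM lee_fin.
  apply: le_trans (layer_moment i K0 a0 p1); apply: ler_wpM2l; [exact: powR_ge0|exact: hP].
set D := (8 * K ^+ 2 * a) `^ p in I.
have D0 : 0 <= D by exact: powR_ge0.
have S : (\sum_(n <oo) \int[P]_w F n w <= (2 * D)%:E)%E.
  apply: lime_le; first by apply: is_cvg_nneseries => n _ _; exact: integral_ge0.
  apply: nearW => n; apply: (@le_trans _ _ (\sum_(0 <= i < n) (D * 2^-1 ^+ i)%:E)%E).
    by apply: lee_sum => i _; exact: I.
  rewrite sumEFin lee_fin; suff -> : \sum_(0 <= i < n) D * 2^-1 ^+ i = 2 * D - 2 * D * 2^-1 ^+ n.
    by rewrite lerBlDr lerDl !mulr_ge0 // exprn_ge0 // invr_ge0.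
  elim: n => [|n IH]; first by rewrite big_nil expr0; ring.
  by rewrite big_nat_recr //= IH exprS; field.
apply: (@le_trans _ _ ((a `^ p)%:E + (2 * D)%:E)%E); first exact: leeD2l.
(* The total is at most 3 D; since p >= 1, the factor 3 is absorbed by 4^p, which turns the constant
   8 into 32. *)
rewrite -EFinD lee_fin.
have K2 : 1 <= K ^+ 2 by rewrite exprn_ege1.
have e : (32 * K ^+ 2 * a) `^ p = 4 `^ p * D.
  have c0 : 0 <= 8 * K ^+ 2 * a by apply: mulr_ge0 (ltW a0); lra.
  by rewrite /D -powRM //; congr (powR _ p); ring.
have q4 : 4 <= 4 `^ p :> R.
  by rewrite -[X in X <= _]powRr1 // ler_powR //; lra.
have aD : a `^ p <= D.
  have aK : a <= 8 * K ^+ 2 * a by rewrite ler_peMl ?(ltW a0) //; lra.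
  by apply: ge0_ler_powR => //; rewrite nnegrE; lra.
by rewrite e; nra.
Qed.

(** Used in the contrapositive: a large [p]-th moment forces {|<v, X>| >= a} to have probability
    above [delta]. Repeated squaring of the tail raises exp(-p/K) to the power 2^i on the [i]-th
    layer. *)
Lemma Lnorm_inner_le (R : realType) m (Omega : measurableType m)
    (P : probability Omega R) d (X : Omega -> 'rV[R]_d) (v : 'rV[R]_d) (K a p delta : R) :
  random_vector X -> log_concave P X -> 1 <= K -> 0 < a -> 1 <= p ->
  0 <= delta <= 4^-1 -> 4 / 3 * delta <= expR (- (p / K)) ->
  prR P [set w | a <= `|inner v (X w)|] <= delta ->
  ('N[P]_(p%:E)[(fun w => (inner v (X w))%:E)] <= (32 * K ^+ 2 * a)%:E)%E.
Proof.
move=> rX lc K1 a0 p1 /andP[d0 d4] dp hd.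
have c0 : 0 <= 32 * K ^+ 2 * a by apply: mulr_ge0 (ltW a0); rewrite mulr_ge0 ?sqr_ge0.
have pn0 : p != 0 by rewrite gt_eqF //; lra.
have cv : continuous (fun x : 'rV[R]_d => `|inner v x|).
  by move=> x; apply: (@continuous_comp _ _ _ (inner v) Num.norm);
    [exact: continuous_inner|exact: norm_continuous].
have tail := log_concave_tail (N := fun x => `|inner v x|) rX lc cv a0 d4.
have I : (\int[P]_w (`|inner v (X w)| `^ p)%:E <= ((32 * K ^+ 2 * a) `^ p)%:E)%E.
  apply: moment_le => //.
    exact: (measurable_comp_random_vector rX (@continuous_inner _ _ v)).
  move=> i; apply: (@le_trans _ _ ((4 / 3 * delta) ^+ (2 ^ i))).
    apply: tail => // x y; rewrite innerDr !innerZr.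
    have := ler_normD (2^-1 * inner v x + 2^-1 * inner v y) (- (2^-1 * inner v y)).
    by rewrite addrK normrN !normrM ger0_norm ?invr_ge0 //; lra.
  apply: (@le_trans _ _ (expR (- (p / K)) ^+ (2 ^ i))).
    by rewrite lerXn2r ?nnegrE ?expR_ge0 //; lra.
  by rewrite -expRM_natl natrX mulrN mulrC.
have -> : ('N[P]_(p%:E)[(fun w => (inner v (X w))%:E)])%E =
    (('N[P]_(p%:E)[(fun w => (inner v (X w))%:E)] `^ p) `^ p^-1)%E.
  by rewrite -poweRrM mulfV // poweRe1 // Lnorm_ge0.
rewrite poweR_Lnorm //.
have -> : (32 * K ^+ 2 * a)%:E = (((32 * K ^+ 2 * a) `^ p)%:E `^ p^-1)%E.
  by rewrite poweR_EFin -powRrM mulfV // powRr1.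
apply: gt0_ler_poweR => //.
- by rewrite invr_ge0; lra.
- by rewrite in_itv /= integral_ge0 ?leey //.
- by rewrite in_itv /= lee_fin powR_ge0 leey.
Qed.

(** * Windows of the quadratic form *)

Lemma sumr_le_const (R : realType) n (F : 'I_n -> R) c :
  (forall i, F i <= c) -> \sum_i F i <= n%:R * c.
Proof.
move=> h; apply: le_trans (ler_sum _ (fun i _ => h i)) _.
by rewrite sumr_const card_ord mulr_natl.
Qed.

Lemma sumr_ge_const (R : realType) n (F : 'I_n -> R) c :
  (forall i, c <= F i) -> n%:R * c <= \sum_i F i.
Proof.
move=> h; apply: le_trans (ler_sum _ (fun i _ => h i)).
by rewrite sumr_const card_ord mulr_natl.
Qed.

Lemma prR_cover d (T : measurableType d) (R : realType) (P : probability T R) (L : nat)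
    (F : nat -> set T) (E : set T) : measurable E -> (forall c, measurable (F c)) ->
  (forall w, E w -> exists2 c, (c < L)%N & F c w) ->
  prR P E <= \sum_(c < L) prR P (E `&` F c).
Proof.
move=> + mF; elim: L E => [|L IH] E mE hE.
  by rewrite big_ord0 (_ : E = set0) ?/prR ?measure0 //; apply/seteqP; split=> // w /hE[].
rewrite big_ord_recr /=.
have mEF : measurable (E `&` F L) by exact: measurableI.
have mED : measurable (E `\` F L) by exact: measurableD.
apply: (@le_trans _ _ (prR P (E `\` F L) + prR P (E `&` F L))).
  apply: le_trans (prR_setU _ mED mEF); apply: prR_le => //; first exact: measurableU.
  by move=> w Ew; have [Fw|nFw] := pselect (F L w); [right|left].
rewrite lerD2r; apply: le_trans (IH _ mED _) _.
  move=> w [/hE[c cL Fc] nF]; exists c => //.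
  by move: cL; rewrite ltnS leq_eqVlt => /orP[/eqP cL|//]; rewrite cL in Fc.
apply: ler_sum => c _; apply: prR_le; [exact: measurableI|exact: measurableI|].
by move=> w [[]].
Qed.

Lemma prR_pigeonhole d (T : measurableType d) (R : realType) (P : probability T R) (L : nat)
    (F : nat -> set T) (E : set T) : measurable E -> (forall c, measurable (F c)) ->
  (forall w, E w -> exists2 c, (c <= L)%N & F c w) ->
  exists2 c, (c <= L)%N & prR P E / L.+1%:R <= prR P (E `&` F c).
Proof.
move=> mE mF hE; apply: contrapT => H.
have : prR P E < prR P E; last by rewrite ltxx.
have cov : forall w, E w -> exists2 c, (c < L.+1)%N & F c w.
  by move=> w /hE[c cL Fw]; exists c.
have L0 : 0 < L.+1%:R :> R by rewrite ltr0n.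
apply: le_lt_trans (prR_cover P mE mF cov) _.
apply: (@lt_le_trans _ _ (\sum_(c < L.+1) prR P E / L.+1%:R)); last first.
  by apply: le_trans (sumr_le_const (fun _ => lexx _)) _; rewrite mulrC divfK // gt_eqF.
apply: ltr_sum => [|c _].
  by apply/hasP; exists ord0 => //; rewrite mem_index_enum.
by rewrite ltNge; apply/negP => h; apply: H; exists c => //; rewrite -ltnS.
Qed.

Lemma prR_gt0_nonempty d (T : measurableType d) (R : realType) (P : probability T R) (E : set T) :
  0 < prR P E -> exists w, E w.
Proof.
move=> h; apply: contrapT => /forallNP hE; move: h.
by rewrite (_ : E = set0) ?/prR ?measure0 ?ltxx //; apply/seteqP; split => // w /hE.
Qed.

Definition qform (R : realType) (d n : nat) (v : 'I_n -> 'rV[R]_d) (x : 'rV[R]_d) : R :=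
  n%:R^-1 * \sum_i inner (v i) x ^+ 2.

Lemma continuous_qform (R : realType) (d n : nat) (v : 'I_n -> 'rV[R]_d) :
  continuous (qform v).
Proof.
move=> x; apply: (@continuousM R _ (fun=> n%:R^-1)); first exact: cst_continuous.
apply: continuous_sumr => i y.
by apply: (@continuous_comp _ _ _ (inner (v i)) (fun z : R => z ^+ 2)); [exact: continuous_inner|exact: exprn_continuous].
Qed.

Lemma closed_ge_fun (R : realType) (T : topologicalType) (f : T -> R) (c : R) :
  continuous f -> closed [set x | c <= f x].
Proof.
by move=> cf; apply: (@closed_comp _ _ f [set y | c <= y]) => [x _|]; [exact: cf|exact: closed_ge].
Qed.

Lemma closed_le_fun (R : realType) (T : topologicalType) (f : T -> R) (c : R) :
  continuous f -> closed [set x | f x <= c].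
Proof.
by move=> cf; apply: (@closed_comp _ _ f [set y | y <= c]) => [x _|]; [exact: cf|exact: closed_le].
Qed.

Definition qwindow (R : realType) (d n : nat) (G : set 'rV[R]_d) (v : 'I_n -> 'rV[R]_d) (a w : R) :=
  [set x | G x /\ a <= qform v x <= a + w].

Lemma closed_qwindow (R : realType) (d n : nat) (G : set 'rV[R]_d) (v : 'I_n -> 'rV[R]_d) (a w : R) :
  closed G -> closed (qwindow G v a w).
Proof.
move=> cG; have -> : qwindow G v a w = G `&` ([set x | a <= qform v x] `&` [set x | qform v x <= a + w]).
  by apply/seteqP; split => x /=; [move=> [? /andP[]]|move=> [? [? ?]]; split => //; apply/andP].
apply: closedI => //; apply: closedI; [apply: closed_ge_fun|apply: closed_le_fun];
  exact: continuous_qform.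
Qed.

(* A continuous substitute for the number of i with |inner (v i) x| >= 1, so that superlevel sets are closed. *)
Definition excess (R : realType) (d n : nat) (v : 'I_n -> 'rV[R]_d) (x : 'rV[R]_d) : R :=
  n%:R^-1 * \sum_i Num.max (`|inner (v i) x| - 2^-1) 0 ^+ 2.

Lemma continuous_excess (R : realType) (d n : nat) (v : 'I_n -> 'rV[R]_d) :
  continuous (excess v).
Proof.
move=> x; apply: (@continuousM R _ (fun=> n%:R^-1)); first exact: cst_continuous.
apply: continuous_sumr => i y.
apply: (@continuous_comp _ _ _ (fun y => Num.max (`|inner (v i) y| - 2^-1) 0) (fun z : R => z ^+ 2)); last exact: exprn_continuous.
apply: continuous_max; last exact: cst_continuous.
apply: continuousB; last exact: cst_continuous.
by apply: (@continuous_comp _ _ _ (inner (v i)) Num.norm); [exact: continuous_inner|exact: norm_continuous].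
Qed.

(** The square of a midpoint falls short of the mean of the squares by (a - b)^2 / 4, and |b| <= 1/2
    gives |a - b| >= |a| - 1/2 for each coordinate. *)
Lemma qform_midpoint (R : realType) (d n : nat) (v : 'I_n -> 'rV[R]_d) (x y : 'rV[R]_d) :
  (forall i, `|inner (v i) y| <= 2^-1) ->
  qform v (2^-1 *: x + 2^-1 *: y) <= 2^-1 * qform v x + 2^-1 * qform v y - 4^-1 * excess v x.
Proof.
move=> hy; rewrite /qform /excess !(mulrCA _ n%:R^-1) -!mulrDr -mulrBr.
apply: ler_wpM2l; first by rewrite invr_ge0.
rewrite -big_split /= !big_distrr /= -sumrB; apply: ler_sum => i _.
rewrite innerDr !innerZr; have := hy i; move: (inner (v i) x) (inner (v i) y) => a b.
rewrite ler_norml => /andP[b1 b2].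
suff : Num.max (`|a| - 2^-1) 0 ^+ 2 <= (a - b) ^+ 2 by nra.
have [h|h] := leP (`|a| - 2^-1) 0; first by rewrite expr0n sqr_ge0.
have [a0|a0] := leP 0 a; move: h; rewrite ?(ger0_norm a0) ?(ltr0_norm a0) => h; nra.
Qed.

(** A reverse Markov inequality: the expectation of the excess on [G] is at least 1 / (8 r), since
    each summand is at least 1/4 with probability 1 / (2 r). As the excess is at most 4 r^2 on [G],
    it must reach half of that mean with probability 1 / (64 r^3). *)
Lemma excess_probability (R : realType) m (Omega : measurableType m)
    (P : probability Omega R) d (X : Omega -> 'rV[R]_d) (n : nat) (r : R) (v : 'I_n -> 'rV[R]_d)
    (G : set 'rV[R]_d) :
  random_vector X -> (0 < n)%N -> 1 <= r -> closed G ->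
  (forall x, G x -> forall i, `|inner (v i) x| <= 2 * r) ->
  prR P (X @^-1` ~` G) <= (2 * r)^-1 ->
  (forall i, r^-1 <= prR P [set w | 1 <= `|inner (v i) (X w)|]) ->
  (64 * r ^+ 3)^-1 <= prR P (X @^-1` (G `&` [set x | (16 * r)^-1 <= excess v x])).
Proof.
move=> rX n0 r1 cG GM PG PV; have r0 : 0 < r by lra.
have n0' : 0 < n%:R :> R by rewrite ltr0n.
have mcl K : closed K -> measurable (X @^-1` K) by exact: random_vector_closed.
set S := G `&` _; have cS : closed S.
  by apply: closedI => //; apply: closed_ge_fun; exact: continuous_excess.
have mG := mcl _ cG; have mS := mcl _ cS.
pose D i := X @^-1` [set x | 1 <= `|inner (v i) x|].
have mD i : measurable (D i).
  apply: mcl; apply: closed_ge_fun => x.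
  by apply: (@continuous_comp _ _ _ (inner (v i)) Num.norm); [exact: continuous_inner|exact: norm_continuous].
have mGD i : measurable (X @^-1` G `&` D i) by exact: measurableI.
have PD i : (2 * r)^-1 <= prR P (X @^-1` G `&` D i).
  rewrite setIC; apply: le_trans (prR_setI_ge P (mD i) mG).
  rewrite preimage_setC; have := PV i; rewrite -/(D i); move: PG; rewrite invfM; lra.
pose F w : R := n%:R^-1 * \sum_i (4^-1 * \1_(X @^-1` G `&` D i) w).
have bF i : bmf (fun w => 4^-1 * \1_(X @^-1` G `&` D i) w : R).
  by apply: bmfZ; exact: bmf_indic.
have IF : (8 * r)^-1 <= \int[P]_w F w.
  rewrite /F RintZ; last exact: bmf_sum.
  rewrite Rint_sum // ler_pdivlMl //.
  apply: sumr_ge_const => i.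
  rewrite RintZ ?Rint_indic //; last exact: bmf_indic.
  by have := PD i; rewrite !invfM; lra.
have le : \int[P]_w F w <= \int[P]_w ((16 * r)^-1 + 4 * r ^+ 2 * \1_(X @^-1` S) w).
  apply: Rint_le.
  - by apply: bmfZ; exact: bmf_sum.
  - by apply: bmfD; [exact: bmf_cst|apply: bmfZ; exact: bmf_indic].
  move=> w; rewrite /F; have [Gw|nGw] := pselect (G (X w)); last first.
    rewrite big1 ?mulr0 => [|i _]; last by rewrite indicE memNset ?mulr0 // => -[].
    by rewrite addr_ge0 ?mulr_ge0 ?invr_ge0 ?mulr_ge0 ?sqr_ge0 // ltW.
  have Fle : n%:R^-1 * (\sum_i (4^-1 * \1_(X @^-1` G `&` D i) w)) <= excess v (X w).
    rewrite /excess ler_pM2l ?invr_gt0 //; apply: ler_sum => i _; rewrite indicE.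
    have [h|h] := boolP (w \in _); last by rewrite mulr0 sqr_ge0.
    have : 2^-1 <= Num.max (`|inner (v i) (X w)| - 2^-1) 0.
      by move: h; rewrite inE /D => -[_] /= h; rewrite le_max; apply/orP; left; lra.
    by move=> h'; rewrite mulr1; nra.
  apply: le_trans Fle _; rewrite indicE; have [h|h] := boolP (w \in _).
    rewrite mulr1 (@le_trans _ _ (4 * r ^+ 2)) ?lerDr ?invr_ge0 ?mulr_ge0 ?(ltW r0) //.
    rewrite /excess ler_pdivrMl //.
    apply: sumr_le_const => i; rewrite (_ : 4 * r ^+ 2 = (2 * r) ^+ 2); last by ring.
    have r2 : 0 <= 2 * r by lra.
    apply: lerXn2r; rewrite ?nnegrE ?le_max ?lexx ?orbT //.
    by rewrite ge_max r2 andbT; have := GM _ Gw i; lra.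
  rewrite mulr0 addr0 leNgt; apply/negP => h'; move: h; rewrite notin_setE; apply.
  by split => //=; exact: ltW.
move: (le_trans IF le); rewrite RintD ?RintZ ?Rint_indic ?Rint_cst //; last 3 first.
- exact: bmf_indic.
- exact: bmf_cst.
- by apply: bmfZ; exact: bmf_indic.
move=> h; rewrite -(@ler_pM2l _ (4 * r ^+ 2)); last by rewrite mulr_gt0 ?exprn_gt0.
rewrite (_ : 4 * r ^+ 2 * (64 * r ^+ 3)^-1 = (16 * r)^-1); last by field; rewrite gt_eqF.
by move: h; rewrite !invfM; lra.
Qed.

(** Each pigeonhole among at most r^4 windows of width [w] costs a factor r^(-4). Points of large
    excess, and points of [B], thus fall into one window each with probability r^(-8). Their
    midpoints then have probability at least the geometric mean r^(-8), and a third pigeonhole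
    leaves r^(-12). *)
Lemma separated_windows (R : realType) m (Omega : measurableType m)
    (P : probability Omega R) d (X : Omega -> 'rV[R]_d) (n L : nat) (r w : R) (v : 'I_n -> 'rV[R]_d)
    (G B : set 'rV[R]_d) :
  random_vector X -> log_concave P X -> (0 < n)%N -> 64 <= r ->
  0 < w -> 64 * w = (64 * r)^-1 -> L%:R * w = 4 * r ^+ 2 -> L.+1%:R <= r ^+ 4 ->
  closed G -> closed B -> B `<=` G ->
  (forall x y, G x -> G y -> G (2^-1 *: x + 2^-1 *: y)) ->
  (forall x, G x -> forall i, `|inner (v i) x| <= 2 * r) ->
  (forall x, B x -> forall i, `|inner (v i) x| <= 2^-1) ->
  3 / 4 <= prR P (X @^-1` B) ->
  prR P (X @^-1` ~` G) <= (2 * r)^-1 ->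
  (forall i, r^-1 <= prR P [set w | 1 <= `|inner (v i) (X w)|]) ->
  exists a1 a3 : R, [/\ 0 <= a1, a1 + 60 * w <= a3, a3 <= 4 * r ^+ 2,
    r^-1 ^+ 12 <= prR P (X @^-1` qwindow G v a1 w) &
    r^-1 ^+ 12 <= prR P (X @^-1` qwindow G v a3 w)].
Proof.
move=> rX lc n0 r64 w0 w64 Lw L4 cG cB BG mG GM Bh PB PG PV.
have r0 : 0 < r by lra.
have n0' : 0 < n%:R :> R by rewrite ltr0n.
have mcl K : closed K -> measurable (X @^-1` K) by exact: random_vector_closed.
have q01 : 0 <= r^-1 <= 1 by rewrite invr_ge0 ltW //= invf_le1 //; lra.
have /andP[q0 q1] := q01.
pose S := G `&` [set x | (16 * r)^-1 <= excess v x].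
have cS : closed S by apply: closedI => //; apply: closed_ge_fun; exact: continuous_excess.
have PS : r^-1 ^+ 4 <= prR P (X @^-1` S).
  have r1 : 1 <= r by lra.
  apply: le_trans (excess_probability rX n0 r1 cG GM PG PV).
  rewrite exprVn lef_pV2 ?posrE ?mulr_gt0 ?exprn_gt0 // [r ^+ 4]exprS.
  by rewrite ler_pM2r ?exprn_gt0.
pose W (c : nat) := [set x | c%:R * w <= qform v x] `&` [set x | qform v x <= c.+1%:R * w].
have cW c : closed (W c).
  by apply: closedI; [apply: closed_ge_fun|apply: closed_le_fun]; exact: continuous_qform.
have qf0 x : 0 <= qform v x by rewrite mulr_ge0 ?invr_ge0 // sumr_ge0 // => i _; exact: sqr_ge0.
have qG x : G x -> qform v x <= 4 * r ^+ 2.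
  move=> Gx; rewrite /qform ler_pdivrMl //.
  apply: sumr_le_const => i.
  rewrite -real_normK ?num_real // (_ : 4 * r ^+ 2 = (2 * r) ^+ 2); last by ring.
  by rewrite lerXn2r ?nnegrE ?mulr_ge0 ?(ltW r0) // GM.
have cover x : G x -> exists2 c, (c <= L)%N & W c x.
  move=> Gx; have qw0 : 0 <= qform v x / w by rewrite divr_ge0 // ltW.
  exists (Num.truncn (qform v x / w)).
    rewrite -(ler_nat R); apply: (@le_trans _ _ (qform v x / w)); first by rewrite truncn_le.
    by rewrite ler_pdivrMr // Lw qG.
  have /andP[h1 h2] := truncn_itv qw0.
  by split => /=; [rewrite -ler_pdivlMr|rewrite -ler_pdivrMr // ltW].
have pig K p : closed K -> K `<=` G -> p <= prR P (X @^-1` K) -> 0 <= p ->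
    exists2 c, (c <= L)%N & r^-1 ^+ 4 * p <= prR P (X @^-1` (K `&` W c)).
  move=> cK KG pK p0.
  have [|||c cL h] := @prR_pigeonhole _ _ R P L (fun c => X @^-1` W c) (X @^-1` K).
  - exact: mcl.
  - by move=> c; exact: mcl.
  - by move=> w' Kw; exact/cover/KG.
  exists c => //; rewrite preimage_setI; apply: le_trans h.
  rewrite mulrC; apply: ler_pM; rewrite ?exprn_ge0 //.
  by rewrite exprVn lef_pV2 ?posrE ?exprn_gt0 ?ltr0n.
have sub K c : closed K -> K `<=` G ->
    prR P (X @^-1` (K `&` W c)) <= prR P (X @^-1` qwindow G v (c%:R * w) w).
  move=> cK KG; apply: prR_le; first by apply: mcl; exact: closedI.
    by apply: mcl; exact: closed_qwindow.
  move=> w' [/= Kw [h1 h2]]; split; [exact: KG|apply/andP; split => //].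
  by move: h2; rewrite /= -natr1 mulrDl mul1r.
have SG : S `<=` G by exact: subIsetl.
have [c cL Pc] := pig S _ cS SG PS (exprn_ge0 _ q0).
have PB' : r^-1 ^+ 4 <= prR P (X @^-1` B).
  apply: le_trans PB; apply: (@le_trans _ _ (r^-1 ^+ 1)).
    by rewrite ler_wiXn2l.
  by rewrite expr1 (@le_trans _ _ 64^-1) ?lef_pV2 ?posrE //; lra.
have [c' cL' Pc'] := pig B _ cB BG PB' (exprn_ge0 _ q0).
rewrite -exprD in Pc Pc'.
(* The mean of the two lower ends, plus [w] for the width of the windows, minus the drop (1/4) (1 /
   (16 r)) = 64 w supplied by [qform_midpoint]. *)
pose al := (c%:R * w + c'%:R * w) / 2 + w - 64 * w.
pose E := G `&` [set x | qform v x <= al].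
have cE : closed E by apply: closedI => //; apply: closed_le_fun; exact: continuous_qform.
have cSW : closed (S `&` W c) by exact: closedI.
have cBW : closed (B `&` W c') by exact: closedI.
have PE : prR P (X @^-1` (S `&` W c)) * prR P (X @^-1` (B `&` W c')) <= prR P (X @^-1` E) ^+ 2.
  apply: (@log_concave_midpoint R m Omega P d X (S `&` W c) (B `&` W c') E rX lc cSW cBW (mcl _ cE)).
  have hS (j : nat) : j.+1%:R = j%:R + 1 :> R by rewrite natr1.
  move=> x y [[Gx Jx] [_ qx]] [By [_ qy]]; split; first by apply: mG => //; exact: BG.
  move: Jx qx qy; rewrite /= (hS c) (hS c') => Jx qx qy.
  apply: le_trans (qform_midpoint _ (Bh _ By)) _; rewrite /al.
  have : 4^-1 * (16 * r)^-1 = 64 * w by rewrite w64; field; rewrite gt_eqF.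
  lra.
have PE' : r^-1 ^+ 8 <= prR P (X @^-1` E).
  rewrite -(@ler_pXn2r _ 2) ?nnegrE ?prR_ge0 ?exprn_ge0 //.
  by apply: le_trans PE; rewrite expr2; apply: ler_pM; rewrite ?exprn_ge0.
have EG : E `<=` G by exact: subIsetl.
have [e eL Pe] := pig E _ cE EG PE' (exprn_ge0 _ q0).
rewrite -exprD in Pe.
have r12 : 0 < r^-1 ^+ 12 by rewrite exprn_gt0 // invr_gt0.
have [x [[Gx qx] [ex _]]] := prR_gt0_nonempty (lt_le_trans r12 Pe).
have cw (j : nat) : (j <= L)%N -> j%:R * w <= 4 * r ^+ 2.
  by move=> jL; rewrite -Lw ler_pM2r // ler_nat.
have eal : e%:R * w <= al by exact: le_trans ex qx.
have le812 : r^-1 ^+ 12 <= r^-1 ^+ 8 by rewrite ler_wiXn2l.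
exists (e%:R * w).
(* The larger of the two lower ends is at least their mean, hence exceeds [e%:R * w] by at least 63
   w; that window becomes the upper one. *)
have [cc|cc] := leP (c%:R * w) (c'%:R * w).
  exists (c'%:R * w); split.
  - by rewrite mulr_ge0 // ltW.
  - by move: eal; rewrite /al; lra.
  - exact: cw.
  - exact: le_trans Pe (sub E e cE EG).
  - exact: le_trans (le_trans le812 Pc') (sub B c' cB BG).
exists (c%:R * w); split.
- by rewrite mulr_ge0 // ltW.
- by move: eal; rewrite /al; lra.
- exact: cw.
- exact: le_trans Pe (sub E e cE EG).
- exact: le_trans (le_trans le812 Pc) (sub S c cS SG).
Qed.

(** * Gaussian weights *)

Definition gaussw (R : realType) (H y : R) : R := expR (- (y ^+ 2 / (2 * H))).

Definition dgaussw (R : realType) (H y : R) : R := - (y / H) * gaussw H y.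

Lemma gaussw_le1 (R : realType) (H y : R) : 0 < H -> gaussw H y <= 1.
Proof. by move=> H0; rewrite expR_le1 oppr_le0 divr_ge0 ?sqr_ge0 // mulr_ge0 // ltW. Qed.

Lemma norm_mul_gaussw1 (R : realType) (z : R) : `|z| * gaussw 1 z <= 1.
Proof.
rewrite -[X in _ <= X](expRxMexpNx_1 (z ^+ 2 / 2)) /gaussw mulr1 ler_pM2r ?expR_gt0 //.
apply: le_trans (expR_ge1Dx _); rewrite -(real_normK (num_real z)).
by have := sqr_ge0 (`|z| - 1); move: (`|z|) => a; nra.
Qed.

Lemma sqr_mul_gaussw1 (R : realType) (z : R) : z ^+ 2 * gaussw 1 z <= 2.
Proof.
by have := mul_expRN_le (z ^+ 2 / 2); rewrite /gaussw mulr1; lra.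
Qed.

(** The inequality 1 + x <= exp x is applied to the ratio of the two values and to its inverse,
    which gives the lower and the upper estimate. The leftover terms are controlled by the
    boundedness of z^2 exp(-z^2 / 2). *)
Lemma gaussw1_taylor (R : realType) (z d : R) :
  `|gaussw 1 (z + d) - gaussw 1 z + z * d * gaussw 1 z| <= 7 * d ^+ 2.
Proof.
have E0 := expR_gt0 (- (z ^+ 2 / (2 * 1))); have E1 := gaussw_le1 z (@ltr01 R).
have E'0 := expR_gt0 (- ((z + d) ^+ 2 / (2 * 1))); have E'1 := gaussw_le1 (z + d) (@ltr01 R).
have zE := norm_mul_gaussw1 z; have z2E := sqr_mul_gaussw1 z.
have z2E' := sqr_mul_gaussw1 (z + d).
have up : gaussw 1 z * (1 - z * d - d ^+ 2 / 2) <= gaussw 1 (z + d).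
  have -> : gaussw 1 (z + d) = gaussw 1 z * expR (- (z * d) - d ^+ 2 / 2).
    by rewrite /gaussw -expRD; congr expR; field.
  by rewrite ler_pM2l // (le_trans _ (expR_ge1Dx _)) //; lra.
have lo : gaussw 1 (z + d) * (1 + z * d + d ^+ 2 / 2) <= gaussw 1 z.
  have -> : gaussw 1 z = gaussw 1 (z + d) * expR (z * d + d ^+ 2 / 2).
    by rewrite /gaussw -expRD; congr expR; field.
  by rewrite ler_pM2l // (le_trans _ (expR_ge1Dx _)) //; lra.
move: E0 E1 E'0 E'1 zE z2E z2E' up lo; rewrite -![expR _]/(gaussw _ _).
move: (gaussw 1 z) (gaussw 1 (z + d)) => E E' E0 E1 E'0 E'1 zE z2E z2E' up lo.
have d0 := sqr_ge0 d.
have Ed : E * d ^+ 2 <= d ^+ 2 by rewrite ler_piMl.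
have Ed' : 0 <= E' * d ^+ 2 by rewrite mulr_ge0 // ltW.
rewrite ler_norml; apply/andP; split; first by lra.
have zEd : `|z * d * E| <= `|d|.
  by rewrite mulrAC normrM normrM (gtr0_norm E0) ler_piMl.
have [d1|d1] := leP 1 `|d|.
  have dd : `|d| <= d ^+ 2 by rewrite -(real_normK (num_real d)) ler_eXnr.
  by have := ler_norm (z * d * E); lra.
have h1 : E' - E + z * d * E <= z * d * (E - E') - E' * d ^+ 2 / 2 by lra.
suff : z * d * (E - E') <= 6 * d ^+ 2 by lra.
have [zd|zd] := leP 0 (z * d).
  have : z * d * (E - E') <= z * d * (E * (z * d + d ^+ 2 / 2)).
    by apply: ler_wpM2l => //; lra.
  have -> : z * d * (E * (z * d + d ^+ 2 / 2)) = d ^+ 2 * (z ^+ 2 * E) + d ^+ 2 / 2 * (z * d * E) by field.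
  have := ler_wpM2l d0 z2E.
  have : d ^+ 2 / 2 * (z * d * E) <= d ^+ 2 / 2 * 1.
    apply: ler_wpM2l; first lra.
    by apply: le_trans (ler_norm _) _; lra.
  lra.
have -> : z * d * (E - E') = - (z * d) * (E' - E) by ring.
have : - (z * d) * (E' - E) <= - (z * d) * (E' * (- (z * d))).
  by apply: ler_wpM2l; lra.
have -> : - (z * d) * (E' * - (z * d)) = d ^+ 2 * (z ^+ 2 * E') by ring.
have zz : z ^+ 2 * E' <= 6.
  have : z ^+ 2 * E' <= (2 * (z + d) ^+ 2 + 2 * d ^+ 2) * E'.
    by rewrite ler_pM2r //; have := sqr_ge0 (z + 2 * d); nra.
  have : d ^+ 2 * E' <= 1.
    by rewrite mulr_ile1 // ?(ltW E'0) // -(real_normK (num_real d)) exprn_ile1 // ltW.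
  lra.
by have := ler_wpM2l d0 zz; lra.
Qed.

Lemma gaussw_scale (R : realType) (H y : R) : 0 < H -> gaussw H y = gaussw 1 (y / Num.sqrt H).
Proof.
move=> H0; rewrite /gaussw expr_div_n sqr_sqrtr ?(ltW H0) //; congr expR; congr (- _).
by field; rewrite gt_eqF.
Qed.

Lemma gaussw_taylor (R : realType) (H y h : R) : 0 < H ->
  `|gaussw H (y + h) - gaussw H y - h * dgaussw H y| <= 7 * (h ^+ 2 / H).
Proof.
move=> H0; have s0 : 0 < Num.sqrt H by rewrite sqrtr_gt0.
have s2 : Num.sqrt H ^+ 2 = H by rewrite sqr_sqrtr // ltW.
have := gaussw1_taylor (y / Num.sqrt H) (h / Num.sqrt H).
rewrite -mulrDl -!gaussw_scale // expr_div_n s2 /dgaussw.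
rewrite (_ : y / Num.sqrt H * (h / Num.sqrt H) = y * h / H); last by rewrite mulf_div -expr2 s2.
by rewrite (_ : - (h * _) = y * h / H * gaussw H y) //; ring.
Qed.

Lemma norm_dgaussw (R : realType) (H y : R) : 1 <= H -> `|dgaussw H y| <= 1.
Proof.
move=> H1; have H0 : 0 < H by lra.
have s1 : 1 <= Num.sqrt H by rewrite -sqrtr1 ler_sqrt; lra.
have s0 : 0 < Num.sqrt H by lra.
have s2 : Num.sqrt H ^+ 2 = H by rewrite sqr_sqrtr // ltW.
rewrite /dgaussw gaussw_scale // normrM normrN.
rewrite (_ : `|y / H| = `|y / Num.sqrt H| / Num.sqrt H); last first.
  rewrite -{1}s2 expr2 invfM mulrA [LHS]normrM; congr (_ * _).
  by rewrite gtr0_norm // invr_gt0.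
rewrite (gtr0_norm (expR_gt0 _)) mulrAC ler_pdivrMr // mul1r.
exact: le_trans (norm_mul_gaussw1 _) s1.
Qed.

Lemma gaussw_heat (R : realType) (H y : R) : 0 < H -> gaussw H y = Num.sqrt H * heat H y.
Proof. by move=> H0; rewrite /heat mulrA mulfV ?mul1r // gt_eqF // sqrtr_gt0. Qed.

Lemma continuous_gaussw (R : realType) (H : R) : continuous (gaussw H).
Proof.
move=> y; apply: (@continuous_comp _ _ _ (fun y : R => - (y ^+ 2 / (2 * H))) expR); last exact: continuous_expR.
apply: continuousN; apply: continuousM; [exact: exprn_continuous|exact: cst_continuous].
Qed.

Lemma continuous_dgaussw (R : realType) (H : R) : continuous (dgaussw H).
Proof.
have -> : dgaussw H = (fun y => - (y / H) * gaussw H y) by [].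
move=> y; apply: (@continuousM R R (fun y => - (y / H)) (gaussw H)); last exact: continuous_gaussw.
by apply: continuousN; apply: continuousM; [|exact: cst_continuous].
Qed.

(** * Gaussian weights averaged over signs *)

Lemma inner_signsum (R : realType) d (vs : seq 'rV[R]_d) (s : seq bool) (x : 'rV[R]_d) :
  inner (signsum vs s) x = signsum [seq inner u x | u <- vs] s.
Proof.
elim: vs s => [|u vs IH] [|b s] /=; rewrite ?inner0l //.
by rewrite innerDl IH; case: b; rewrite ?innerNl.
Qed.

(** With this normalization a random signed sum, paired with [x], has variance exactly
    [qform v x]. *)
Definition scaled (R : realType) (d n : nat) (v : 'I_n -> 'rV[R]_d) : seq 'rV[R]_d :=
  [seq (Num.sqrt n%:R)^-1 *: v i | i <- enum 'I_n].

Lemma size_scaled (R : realType) (d n : nat) (v : 'I_n -> 'rV[R]_d) : size (scaled v) = n.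
Proof. by rewrite size_map size_enum_ord. Qed.

(** A quantitative central limit theorem: the fourth powers of the [n] summands add up to at most 16
    r^4 / n, which [heat_signsum] multiplies by 9. The condition 8 r^2 <= n makes every squared
    summand at most 1/2. *)
Lemma savg_gaussw (R : realType) (d n : nat) (v : 'I_n -> 'rV[R]_d) (H r t : R) (x : 'rV[R]_d) :
  (0 < n)%N -> 1 <= H -> 8 * r ^+ 2 <= n%:R -> (forall i, `|inner (v i) x| <= 2 * r) ->
  `|savg n (fun s => gaussw H (inner (signsum (scaled v) s) x - t))
    - Num.sqrt H * heat (H + qform v x) t| <= Num.sqrt H * (144 * r ^+ 4 / n%:R).
Proof.
move=> n0 H1 nr hx; have H0 : 0 < H by lra.
have n0' : 0 < n%:R :> R by rewrite ltr0n.
have s2 : (Num.sqrt n%:R)^-1 ^+ 2 = n%:R^-1 :> R by rewrite exprVn sqr_sqrtr // ltW.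
have hx2 i : inner (v i) x ^+ 2 <= 4 * r ^+ 2.
  have r2 : 0 <= 2 * r by exact: le_trans (normr_ge0 _) (hx i).
  rewrite -real_normK ?num_real // (_ : 4 * r ^+ 2 = (2 * r) ^+ 2); last by ring.
  by rewrite lerXn2r ?nnegrE.
pose a := [seq inner u x | u <- scaled v].
have sa : size a = n by rewrite size_map size_scaled.
have Sa (f : R -> R) : \sum_(z <- a) f z = \sum_i f ((Num.sqrt n%:R)^-1 * inner (v i) x).
  by rewrite /a /scaled -map_comp big_map big_enum /=; apply: eq_bigr => i _; rewrite innerZl.
have a2 z : z \in a -> z ^+ 2 <= 1 / 2.
  move=> /mapP[u /mapP[i _ ->] ->]; rewrite innerZl exprMn s2 mulrC ler_pdivrMr //.
  by have := hx2 i; lra.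
have := heat_signsum (- t) H1 a2; rewrite sa !Sa.
have -> : \sum_i ((Num.sqrt n%:R)^-1 * inner (v i) x) ^+ 2 = qform v x.
  by rewrite /qform big_distrr; apply: eq_bigr => i _; rewrite exprMn s2.
have he T : heat T (- t) = heat T t by rewrite /heat sqrrN.
rewrite he.
have -> : savg n (fun s => gaussw H (inner (signsum (scaled v) s) x - t)) =
    Num.sqrt H * savg n (fun s => heat H (- t + signsum a s)).
  by rewrite -savgZ; apply: eq_savg => s; rewrite -gaussw_heat // inner_signsum addrC.
move=> h; rewrite -mulrBr normrM ger0_norm ?sqrtr_ge0 //.
apply: ler_wpM2l; first exact: sqrtr_ge0.
apply: le_trans h _; apply: (@le_trans _ _ (9 * (n%:R * (16 * r ^+ 4 / n%:R ^+ 2)))); last first.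
  by rewrite le_eqVlt; apply/orP; left; apply/eqP; field; rewrite gt_eqF.
rewrite ler_pM2l //; apply: sumr_le_const => i.
rewrite exprMn (exprM _ 2 2) s2 exprVn mulrC ler_pM2r ?invr_gt0 ?exprn_gt0 //.
rewrite (exprM _ 2 2) (_ : 16 * r ^+ 4 = (4 * r ^+ 2) ^+ 2); last by ring.
by rewrite lerXn2r ?nnegrE ?sqr_ge0 // (le_trans (sqr_ge0 _) (hx2 i)).
Qed.

Lemma bmf_savg d (T : measurableType d) (R : realType) n (F : seq bool -> T -> R) :
  (forall s, bmf (F s)) -> bmf (fun w => savg n (fun s => F s w)).
Proof.
elim: n F => [|n IH] F bF /=; first exact: bF.
rewrite (_ : (fun w => _) = (fun w => 2^-1 * (savg n (fun s => F (true :: s) w) + savg n (fun s => F (false :: s) w)))).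
  by apply: bmfZ; apply: bmfD; apply: IH.
by apply/funext => w; rewrite mulrC.
Qed.

Lemma Rint_savg d (T : measurableType d) (R : realType) (P : probability T R) n
    (F : seq bool -> T -> R) : (forall s, bmf (F s)) ->
  \int[P]_w savg n (fun s => F s w) = savg n (fun s => \int[P]_w F s w).
Proof.
elim: n F => [|n IH] F bF //=; rewrite -!IH //.
rewrite -RintD; [|exact: bmf_savg|exact: bmf_savg].
rewrite mulrC -RintZ; last by apply: bmfD; exact: bmf_savg.
by apply: eq_Rintegral => w _; rewrite mulrC.
Qed.

Lemma savg_exists (R : realType) n (F : seq bool -> R) (c : R) :
  savg n F < c -> exists s, F s < c.
Proof.
move=> h; apply: contrapT => /forallNP H; move: h; apply/negP; rewrite -leNgt.
by rewrite -(savg_cst n c); apply: savg_le => s; rewrite leNgt; apply/negP.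
Qed.

Lemma bmf_gaussw (R : realType) m (Omega : measurableType m) d (X : Omega -> 'rV[R]_d)
    (H t : R) (g : 'rV[R]_d) : random_vector X -> 0 < H ->
  bmf (fun w => gaussw H (inner g (X w) - t)).
Proof.
move=> rX H0; split; last by exists 1 => w; rewrite ger0_norm ?expR_ge0 // gaussw_le1.
apply: (@measurable_comp_random_vector _ _ _ _ X (fun x => gaussw H (inner g x - t)) rX) => x.
apply: (@continuous_comp _ _ _ (fun x => inner g x - t) (gaussw H)); last exact: continuous_gaussw.
by apply: continuousB; [exact: continuous_inner|exact: cst_continuous].
Qed.

Lemma bmf_dgaussw (R : realType) m (Omega : measurableType m) d (X : Omega -> 'rV[R]_d)
    (H t : R) (g : 'rV[R]_d) : random_vector X -> 1 <= H ->
  bmf (fun w => dgaussw H (inner g (X w) - t)).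
Proof.
move=> rX H0; split; last by exists 1 => w; rewrite norm_dgaussw.
apply: (@measurable_comp_random_vector _ _ _ _ X (fun x => dgaussw H (inner g x - t)) rX) => x.
apply: (@continuous_comp _ _ _ (fun x => inner g x - t) (dgaussw H)); last exact: continuous_dgaussw.
by apply: continuousB; [exact: continuous_inner|exact: cst_continuous].
Qed.

(** After exchanging the average over signs with the integral, [savg_gaussw] applies at each point
    of the support of [D]. *)
Lemma savg_mean_bounds (R : realType) m (Omega : measurableType m) (P : probability Omega R)
    d (X : Omega -> 'rV[R]_d) n (v : 'I_n -> 'rV[R]_d) (H r t eps k1 k2 : R) (D : Omega -> R) :
  random_vector X -> (0 < n)%N -> 1 <= H -> 8 * r ^+ 2 <= n%:R ->
  Num.sqrt H * (144 * r ^+ 4 / n%:R) <= eps ->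
  bmf D -> (forall w, 0 <= D w) -> (forall w, 0 < D w -> forall i, `|inner (v i) (X w)| <= 2 * r) ->
  (forall w, 0 < D w -> k1 <= Num.sqrt H * heat (H + qform v (X w)) t <= k2) ->
  (k1 - eps) * \int[P]_w D w <=
    savg n (fun s => \int[P]_w (gaussw H (inner (signsum (scaled v) s) (X w) - t) * D w))
    <= (k2 + eps) * \int[P]_w D w.
Proof.
move=> rX n0 H1 nr he bD D0 DG hk; have H0 : 0 < H by lra.
have bF s : bmf (fun w => gaussw H (inner (signsum (scaled v) s) (X w) - t) * D w).
  by apply: bmfM => //; exact: bmf_gaussw.
rewrite -Rint_savg // -!RintZ //.
have bS : bmf (fun w => savg n (fun s => gaussw H (inner (signsum (scaled v) s) (X w) - t) * D w)).
  exact: bmf_savg.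
suff pt w : (k1 - eps) * D w <= savg n (fun s => gaussw H (inner (signsum (scaled v) s) (X w) - t) * D w)
    <= (k2 + eps) * D w.
  by apply/andP; split; apply: Rint_le => //; try exact: bmfZ; move=> w; have /andP[] := pt w.
have -> : savg n (fun s => gaussw H (inner (signsum (scaled v) s) (X w) - t) * D w) =
    D w * savg n (fun s => gaussw H (inner (signsum (scaled v) s) (X w) - t)).
  by rewrite -savgZ; apply: eq_savg => s; rewrite mulrC.
have [->|Dn0] := eqVneq (D w) 0; first by rewrite !mulr0 mul0r lexx.
have Dw : 0 < D w by rewrite lt_def Dn0 D0.
have := le_trans (savg_gaussw t n0 H1 nr (DG w Dw)) he; have := hk w Dw.
move=> /andP[k1' k2']; rewrite ler_norml => /andP[h1 h2].
by rewrite !(mulrC _ (D w)) !ler_pM2l //; apply/andP; split; lra.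
Qed.

(** * Almost orthogonality and the variance over the signs *)

Lemma bmf_inner_supported (R : realType) m (Omega : measurableType m) d (X : Omega -> 'rV[R]_d)
    (u : 'rV[R]_d) (c : R) (D : Omega -> R) :
  random_vector X -> bmf D -> (forall w, D w != 0 -> `|inner u (X w)| <= c) ->
  bmf (fun w => inner u (X w) * D w).
Proof.
move=> rX [mD [M hM]] hc; split.
  apply: measurable_funM => //.
  exact: (measurable_comp_random_vector rX (@continuous_inner _ _ u)).
exists (`|c| * M) => w; have M0 : 0 <= M by exact: le_trans (normr_ge0 _) (hM w).
have [->|D0] := eqVneq (D w) 0; first by rewrite mulr0 normr0 mulr_ge0.
by rewrite normrM; apply: ler_pM => //; apply: le_trans (hc _ D0) (ler_norm _).
Qed.

(** Off the diagonal, |c_i c_j| / n <= (c_i^2 + c_j^2) / (2 n) sums to at most the sum of the c_i^2;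
    the diagonal contributes the factor M^2 >= 1. *)
Lemma almost_orthogonal_sum (R : realType) d (T : measurableType d) (P : probability T R)
    n (U : 'I_n -> T -> R) (M : R) (c : 'I_n -> R) : (0 < n)%N -> 1 <= M ->
  (forall i, bmf (U i)) -> (forall i w, `|U i w| <= M) ->
  (forall i j, i != j -> `|\int[P]_w (U i w * U j w)| <= n%:R^-1) ->
  \int[P]_w ((\sum_i c i * U i w) ^+ 2) <= 2 * M ^+ 2 * \sum_i c i ^+ 2.
Proof.
move=> n0 M1 bU UM hU; have n0' : 0 < n%:R :> R by rewrite ltr0n.
have -> : \int[P]_w ((\sum_i c i * U i w) ^+ 2) =
    \sum_i \sum_j c i * c j * \int[P]_w (U i w * U j w).
  transitivity (\int[P]_w (\sum_i \sum_j c i * c j * (U i w * U j w))).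
    apply: eq_Rintegral => w _; rewrite expr2 big_distrl /=; apply: eq_bigr => i _.
    by rewrite big_distrr /=; apply: eq_bigr => j _; ring.
  rewrite Rint_sum => [|i]; last by apply: bmf_sum => j; apply: bmfZ; exact: bmfM.
  apply: eq_bigr => i _; rewrite Rint_sum => [|j]; last by apply: bmfZ; exact: bmfM.
  by apply: eq_bigr => j _; rewrite RintZ //; exact: bmfM.
apply: (@le_trans _ _ (\sum_i \sum_j ((if i == j then M ^+ 2 * c i ^+ 2 else 0) +
    (2 * n%:R)^-1 * (c i ^+ 2 + c j ^+ 2)))).
  apply: ler_sum => i _; apply: ler_sum => j _; have [<-|ij] := eqVneq i j.
    apply: (@le_trans _ _ (M ^+ 2 * c i ^+ 2)); last first.
      by rewrite lerDl mulr_ge0 ?invr_ge0 ?mulr_ge0 ?addr_ge0 ?sqr_ge0.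
    rewrite -expr2 mulrC; apply: ler_wpM2r; first exact: sqr_ge0.
    rewrite -[X in _ <= X](Rint_cst P); apply: Rint_le => [||w]; [exact: bmfM|exact: bmf_cst|].
    by rewrite -expr2 -real_normK ?num_real // lerXn2r ?nnegrE // (le_trans _ (UM i w)).
  rewrite add0r; apply: le_trans (ler_norm _) _; rewrite normrM.
  apply: (@le_trans _ _ (`|c i * c j| * n%:R^-1)); first by apply: ler_wpM2l => //; exact: hU.
  rewrite invfM mulrC -mulrA (mulrCA _ n%:R^-1) ler_pM2l ?invr_gt0 // normrM.
  rewrite -(real_normK (num_real (c i))) -(real_normK (num_real (c j))).
  by have := sqr_ge0 (`|c i| - `|c j|); nra.
have -> : \sum_i \sum_j ((if i == j then M ^+ 2 * c i ^+ 2 else 0) +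
    (2 * n%:R)^-1 * (c i ^+ 2 + c j ^+ 2)) = (M ^+ 2 + 1) * \sum_i c i ^+ 2.
  transitivity (\sum_i (M ^+ 2 * c i ^+ 2 + (2^-1 * c i ^+ 2 + (2 * n%:R)^-1 * \sum_j c j ^+ 2))).
    apply: eq_bigr => i _; rewrite big_split /=; congr (_ + _).
      by rewrite -big_mkcond /= (big_pred1 i) // => j; rewrite eq_sym.
    rewrite -big_distrr /= big_split /= sumr_const card_ord -mulr_natl mulrDr; congr (_ + _).
    by field; rewrite gt_eqF.
  rewrite !big_split /= -!big_distrr /= sumr_const card_ord -mulr_natl.
  by field; rewrite gt_eqF.
apply: ler_wpM2r; first by apply: sumr_ge0 => i _; exact: sqr_ge0.
have : 1 <= M ^+ 2 by exact: exprn_ege1.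
lra.
Qed.

(* With c_j the integrals on the left and Y = sum_j c_j V_j, sum_j c_j^2 is the integral of
   Y D kap; and |Y| is of order |c| outside an event so rare that it is negligible even when
   the mass of D is tiny. *)
Lemma bessel_log_concave (R : realType) m (Omega : measurableType m) (P : probability Omega R)
    d (X : Omega -> 'rV[R]_d) n (v : 'I_n -> 'rV[R]_d) (r : R) (G : set 'rV[R]_d)
    (D kap : Omega -> R) (i0 : nat) :
  random_vector X -> log_concave P X -> closed G -> (0 < n)%N -> 1 <= r ->
  (forall x, G x -> forall i, `|inner (v i) x| <= 2 * r) ->
  prR P (X @^-1` ~` G) <= 8^-1 ->
  (forall i j, i != j -> `|\int[P]_w ((inner (v i) (X w) * \1_(X @^-1` G) w)
     * (inner (v j) (X w) * \1_(X @^-1` G) w))| <= n%:R^-1) ->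
  bmf D -> (forall w, 0 <= D w <= 1) -> (forall w, D w != 0 -> G (X w)) ->
  bmf kap -> (forall w, `|kap w| <= 1) ->
  2 * r * n%:R * 3^-1 ^+ (2 ^ i0) <= \int[P]_w D w ->
  \sum_j (\int[P]_w (inner (v j) (X w) * D w * kap w)) ^+ 2 <=
    ((32 * 2 ^+ i0 * r + 1) * \int[P]_w D w) ^+ 2.
Proof.
move=> rX lc cG n0 r1 GM PG hB bD D01 DG bk k1 hZ.
have r0 : 0 < r by lra.
have mG : measurable (X @^-1` G) by exact: random_vector_closed.
have bVD j : bmf (fun w => inner (v j) (X w) * D w).
  by apply: (bmf_inner_supported (c := 2 * r)) => // w /DG Gw; exact: GM.
pose U j w : R := inner (v j) (X w) * \1_(X @^-1` G) w.
have UM j w : `|U j w| <= 2 * r.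
  rewrite /U indicE; have [h|h] := boolP (w \in _); last by rewrite mulr0 normr0; lra.
  by rewrite mulr1; apply: GM; move: h; rewrite inE.
have bU j : bmf (U j).
  apply: (bmf_inner_supported (c := 2 * r)) => //; first exact: bmf_indic.
  move=> w; rewrite indicE; have [h _|h] := boolP (w \in _); last by rewrite eqxx.
  by apply: GM; move: h; rewrite inE.
set Z := \int[P]_w D w in hZ *.
have Z0 : 0 <= Z by rewrite -(Rint_cst P 0); apply: Rint_le => // [|w]; [exact: bmf_cst|case/andP: (D01 w)].
pose c j := \int[P]_w (inner (v j) (X w) * D w * kap w).
rewrite -/(c _); set C2 := \sum_j c j ^+ 2.
have C20 : 0 <= C2 by apply: sumr_ge0 => j _; exact: sqr_ge0.
pose C := Num.sqrt C2; have C0 : 0 <= C by exact: sqrtr_ge0.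
have CC : C ^+ 2 = C2 by rewrite sqr_sqrtr.
have [C2z|C2n] := eqVneq C2 0; first by rewrite C2z sqr_ge0.
have Cp : 0 < C by rewrite sqrtr_gt0 lt_def C2n.
pose u := \sum_j c j *: v j.
have uE x : inner u x = \sum_j c j * inner (v j) x.
  by rewrite inner_suml; apply: eq_bigr => j _; rewrite innerZl.
(* At this threshold Chebyshev's bound on [G] is below 1/8. Together with the mass of the complement
   of [G] this gives the 1/4 from which [log_concave_tail] starts. *)
pose t := 16 * r * C; have t0 : 0 < t by rewrite !mulr_gt0.
have cN : continuous (fun x : 'rV[R]_d => `|inner u x|).
  by move=> x; apply: (@continuous_comp _ _ _ (inner u) Num.norm);
    [exact: continuous_inner|exact: norm_continuous].
have mge (a : R) : measurable [set w | a <= `|inner u (X w)|].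
  have cl : closed [set x : 'rV[R]_d | a <= `|inner u x|] by exact: closed_ge_fun.
  exact: (random_vector_closed rX cl).
have M2 : 1 <= 2 * r by lra.
have Pt : prR P [set w | t <= `|inner u (X w)|] <= 4^-1.
  have h1 := @almost_orthogonal_sum R m Omega P n U (2 * r) c n0 M2 bU UM hB.
  have h2 : \int[P]_w (\1_[set w | t <= `|inner u (X w)|] w : R) <=
      \int[P]_w (\1_(X @^-1` ~` G) w + (t ^+ 2)^-1 * (\sum_i c i * U i w) ^+ 2).
    apply: Rint_le; first exact: bmf_indic.
      apply: bmfD; first by apply: bmf_indic; rewrite preimage_setC; exact: measurableC.
      by apply: bmfZ; apply: bmfM; apply: bmf_sum => j; exact: bmfZ.
    move=> w; rewrite !indicE; have [h|h] := boolP (w \in [set w0 | t <= `|inner u (X w0)|]); last first.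
      by rewrite addr_ge0 // mulr_ge0 ?invr_ge0 ?sqr_ge0.
    have [Gw|nGw] := pselect (G (X w)); last first.
      by rewrite (@mem_set _ (X @^-1` ~` G)) // lerDl mulr_ge0 ?invr_ge0 ?sqr_ge0.
    rewrite (@memNset _ (X @^-1` ~` G)) ?add0r => [|/(_ Gw)//].
    rewrite mulrC ler_pdivlMr ?exprn_gt0 // mul1r.
    rewrite (_ : \sum_i c i * U i w = inner u (X w)); last first.
      by rewrite uE; apply: eq_bigr => i _; rewrite /U indicE mem_set // mulr1.
    rewrite -[X in _ <= X]real_normK ?num_real // lerXn2r ?nnegrE ?(ltW t0) //.
    by move: h; rewrite inE.
  have mGC : measurable (X @^-1` ~` G) by rewrite preimage_setC; exact: measurableC.
  move: h2; rewrite Rint_indic // RintD; [|exact: bmf_indic|by apply: bmfZ; apply: bmfM; apply: bmf_sum => j; exact: bmfZ].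
  rewrite RintZ; last by apply: bmfM; apply: bmf_sum => j; exact: bmfZ.
  rewrite Rint_indic // => h2; apply: (le_trans h2).
  have h3 : (t ^+ 2)^-1 * \int[P]_w (\sum_i c i * U i w) ^+ 2 <= 8^-1.
    rewrite mulrC ler_pdivrMr ?exprn_gt0 //; apply: (le_trans h1).
    rewrite -/C2 -CC /t !exprMn; move: (r ^+ 2) (C ^+ 2) (sqr_ge0 r) (sqr_ge0 C) => a b a0 b0.
    by have := mulr_ge0 a0 b0; lra.
  by move: PG h3; lra.
have tail := log_concave_tail rX lc cN t0 (lexx _) _ Pt i0.
have {tail} Ptail : prR P [set w | (2 ^+ i0.+1 - 1) * t <= `|inner u (X w)|] <= 3^-1 ^+ (2 ^ i0).
  rewrite (_ : 3^-1 = 4 / 3 * 4^-1 :> R); last by field.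
  apply: tail => x y; rewrite innerDr !innerZr.
  have := ler_normD (2^-1 * inner u x + 2^-1 * inner u y) (- (2^-1 * inner u y)).
  by rewrite addrK normrN !normrM ger0_norm ?invr_ge0 //; lra.
set tau := (2 ^+ i0.+1 - 1) * t in Ptail.
have bYD : bmf (fun w => inner u (X w) * D w).
  rewrite (_ : (fun w => _) = (fun w => \sum_j c j * (inner (v j) (X w) * D w))).
    by apply: bmf_sum => j; exact: bmfZ.
  by apply/funext => w; rewrite uE big_distrl; apply: eq_bigr => j _; rewrite mulrA.
have cC j : `|c j| <= C.
  rewrite -(@ler_pXn2r _ 2) ?nnegrE // real_normK ?num_real // CC /C2 (bigD1 j) //= lerDl.
  by apply: sumr_ge0 => k _; exact: sqr_ge0.
have e1 : C2 = \int[P]_w (inner u (X w) * D w * kap w).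
  transitivity (\int[P]_w (\sum_j c j * (inner (v j) (X w) * D w * kap w))).
    rewrite Rint_sum => [|j]; last by apply: bmfZ; exact: bmfM.
    by apply: eq_bigr => j _; rewrite RintZ ?expr2 //; exact: bmfM.
  apply: eq_Rintegral => w _; rewrite uE !big_distrl /=.
  by apply: eq_bigr => j _; rewrite !mulrA.
(* Below [tau] the integrand is at most tau D. Above it, the crude bound 2 r n C holds on the
   support of [D] and is paid for by the tail probability; the hypothesis on the mass [Z] makes that
   part at most C Z. *)
have e2 : C2 <= tau * Z + 2 * r * n%:R * C * 3^-1 ^+ (2 ^ i0).
  rewrite {1}e1; apply: (@le_trans _ _ (\int[P]_w (tau * D w + 2 * r * n%:R * C *
      \1_[set w | tau <= `|inner u (X w)|] w))).
    apply: Rint_le; first exact: bmfM.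
      by apply: bmfD; apply: bmfZ => //; exact: bmf_indic.
    move=> w; apply: le_trans (ler_norm _) _; rewrite 2!normrM.
    have /andP[d0 d1] := D01 w; rewrite (ger0_norm d0).
    apply: (@le_trans _ _ (`|inner u (X w)| * D w)).
      by rewrite ler_piMr // mulr_ge0.
    have tau0 : 0 <= tau by rewrite mulr_ge0 ?(ltW t0) // subr_ge0 exprn_ege1 //; lra.
    have K0 : 0 <= 2 * r * n%:R * C by rewrite !mulr_ge0 // ltW.
    have [D0|Dn] := eqVneq (D w) 0.
      by rewrite D0 !mulr0 add0r mulr_ge0.
    rewrite indicE; have [h|h] := boolP (w \in _); last first.
      rewrite mulr0 addr0; apply: ler_wpM2r => //; move: h; rewrite notin_setE /= => /negP.
      by rewrite -ltNge => /ltW.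
    rewrite mulr1; apply: (@le_trans _ _ (2 * r * n%:R * C)); last by rewrite lerDr mulr_ge0.
    rewrite -[X in _ <= X]mulr1; apply: ler_pM => //.
    rewrite uE; apply: le_trans (ler_norm_sum _ _ _) _.
    rewrite (_ : 2 * r * n%:R * C = n%:R * (C * (2 * r))); last by ring.
    by apply: sumr_le_const => j; rewrite normrM; apply: ler_pM => //; exact: GM (DG _ Dn) _.
  rewrite RintD ?RintZ ?Rint_indic //; last 3 first.
  - exact: bmf_indic.
  - exact: bmfZ.
  - by apply: bmfZ; exact: bmf_indic.
  by rewrite lerD2l; apply: ler_wpM2l => //; rewrite !mulr_ge0 // ltW.
have e3 : C * C <= C * ((32 * 2 ^+ i0 * r + 1) * Z).
  rewrite -expr2 CC; apply: le_trans e2 _.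
  have : tau * Z <= 2 ^+ i0.+1 * t * Z.
    by apply: ler_wpM2r => //; rewrite ler_pM2r //; lra.
  have : C * (2 * r * n%:R * 3^-1 ^+ (2 ^ i0)) <= C * Z by rewrite ler_pM2l.
  rewrite /t exprS; lra.
rewrite -CC lerXn2r ?nnegrE //; last by move: e3; rewrite ler_pM2l.
by rewrite mulr_ge0 // addr_ge0 // !mulr_ge0 ?exprn_ge0 // ltW.
Qed.

(** [savg_variance] is applied to the integral as a function of the direction g. Its derivatives
    along the [scaled] vectors are integrals of the Bessel type with [kap] the derivative of the
    weight, so their squares sum to (b Z)^2 / n. The Taylor errors add n (28/n)^2 / 2 = 392 / n. *)
Lemma gaussw_step_variance (R : realType) m (Omega : measurableType m) (P : probability Omega R)
    d (X : Omega -> 'rV[R]_d) n (v : 'I_n -> 'rV[R]_d) (r H t b : R) (D : Omega -> R) :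
  random_vector X -> (0 < n)%N -> 1 <= H -> 4 * r ^+ 2 <= H ->
  bmf D -> (forall w, 0 <= D w) -> (forall w, D w != 0 -> forall i, `|inner (v i) (X w)| <= 2 * r) ->
  (forall kap, bmf kap -> (forall w, `|kap w| <= 1) ->
    \sum_j (\int[P]_w (inner (v j) (X w) * D w * kap w)) ^+ 2 <= (b * \int[P]_w D w) ^+ 2) ->
  forall F, (forall s, F s = \int[P]_w (gaussw H (inner (signsum (scaled v) s) (X w) - t) * D w)) ->
  savg n (fun s => F s ^+ 2) - savg n F ^+ 2 <= (2 * b ^+ 2 + 392) / n%:R * (\int[P]_w D w) ^+ 2.
Proof.
move=> rX n0 H1 rH bD D0 DV hb F FE; have H0 : 0 < H by lra.
have n0' : 0 < n%:R :> R by rewrite ltr0n.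
set Z := \int[P]_w D w.
have Z0 : 0 <= Z by rewrite -(Rint_cst P 0); apply: Rint_le => //; exact: bmf_cst.
pose f g := \int[P]_w (gaussw H (inner g (X w) - t) * D w).
pose dd u g := \int[P]_w (inner u (X w) * D w * dgaussw H (inner g (X w) - t)).
(* Flipping a sign moves the argument by 2h with h^2 <= 4 r^2 / n <= H / n, and the Taylor error is
   7 (2h)^2 / H. *)
pose e (u : 'rV[R]_d) := 28 / n%:R * Z.
have s2 : (Num.sqrt n%:R)^-1 ^+ 2 = n%:R^-1 :> R by rewrite exprVn sqr_sqrtr // ltW.
have bf g : bmf (fun w => gaussw H (inner g (X w) - t) * D w).
  by apply: bmfM => //; exact: bmf_gaussw.
have bdg g : bmf (fun w => dgaussw H (inner g (X w) - t)) by exact: bmf_dgaussw.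
have bVD j : bmf (fun w => inner (v j) (X w) * D w).
  by apply: (bmf_inner_supported (c := 2 * r)) => // w Dw; exact: DV.
have hin u : u \in scaled v -> exists j, u = (Num.sqrt n%:R)^-1 *: v j.
  by move=> /mapP[j _ ->]; exists j.
have bVs u : u \in scaled v -> bmf (fun w => inner u (X w) * D w).
  move=> /hin[j ->]; rewrite (_ : (fun w => _) = (fun w => (Num.sqrt n%:R)^-1 * (inner (v j) (X w) * D w))).
    exact: bmfZ.
  by apply/funext => w; rewrite innerZl mulrA.
have taylor g u (c : R) : c ^+ 2 = 1 -> u \in scaled v ->
    `|f (g + c *: (u + u)) - f g - c * (2 * dd u g)| <= e u.
  move=> c1 us; rewrite /f /dd.
  have bi := bmfM (bVs u us) (bdg g).
  rewrite -!RintZ //; last exact: bmfZ.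
  rewrite -RintB // -RintB //; [|exact: bmfB|by do 2 apply: bmfZ].
  have bW : bmf (fun w => gaussw H (inner (g + c *: (u + u)) (X w) - t) * D w -
     gaussw H (inner g (X w) - t) * D w -
     c * (2 * (inner u (X w) * D w * dgaussw H (inner g (X w) - t)))).
    by apply: bmfB; [exact: bmfB|do 2 apply: bmfZ].
  apply: le_trans (Rint_norm P bW) _; rewrite /e -RintZ //.
  apply: Rint_le; [exact: bmf_norm|exact: bmfZ|move=> w].
  have [->|Dn] := eqVneq (D w) 0.
    by rewrite !(mulr0, mul0r) !subr0 normr0.
  have [j uj] := hin u us.
  set y := inner g (X w) - t; set h := inner u (X w).
  have -> : inner (g + c *: (u + u)) (X w) - t = y + c * (2 * h).
    by rewrite innerDl innerZl innerDl /y /h; ring.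
  have -> : gaussw H (y + c * (2 * h)) * D w - gaussw H y * D w - c * (2 * (h * D w * dgaussw H y)) =
     (gaussw H (y + c * (2 * h)) - gaussw H y - c * (2 * h) * dgaussw H y) * D w by ring.
  rewrite normrM (ger0_norm (D0 w)); apply: ler_wpM2r; first exact: D0.
  apply: le_trans (gaussw_taylor _ _ H0) _.
  rewrite !exprMn c1 mul1r {}/h uj innerZl exprMn s2.
  have V2 : inner (v j) (X w) ^+ 2 <= 4 * r ^+ 2.
    have hj := DV w Dn j; have r2 : 0 <= 2 * r by exact: le_trans hj.
    rewrite -real_normK ?num_real // (_ : 4 * r ^+ 2 = (2 * r) ^+ 2); last by ring.
    by rewrite lerXn2r ?nnegrE.
  have : inner (v j) (X w) ^+ 2 / H <= 1 by rewrite ler_pdivrMr // mul1r (le_trans V2).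
  move=> h1; rewrite (_ : 7 * (2 ^+ 2 * (n%:R^-1 * inner (v j) (X w) ^+ 2) / H) =
    28 / n%:R * (inner (v j) (X w) ^+ 2 / H)); last by field; rewrite !gt_eqF.
  by rewrite ler_piMr // divr_ge0.
have := @savg_variance R 'rV[R]_d f dd e (scaled v) _ 0.
rewrite size_scaled => hv.
have Fs s : f (0 + signsum (scaled v) s) = F s by rewrite add0r FE.
have {hv} := hv _; rewrite (eq_savg _ (fun s => congr1 (fun z => z ^+ 2) (Fs s))) (eq_savg _ Fs) => hv.
apply: le_trans (hv _) _.
  move=> g u us; split.
    have := taylor g u 1 (expr1n _ _) us; by rewrite scale1r mul1r addrA.
  have sq1 : (-1) ^+ 2 = 1 :> R by rewrite sqrrN expr1n.
  have := taylor g u (-1) sq1 us.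
  rewrite scaleN1r mulN1r opprD addrA opprK -normrN.
  by rewrite (_ : - (f (g - u - u) - f g + 2 * dd u g) = f g - f (g - u - u) - 2 * dd u g) //; ring.
rewrite -[X in _ <= X](savg_cst n); apply: savg_le => s.
rewrite big_split /= -!big_distrr /=.
rewrite [X in _ + X](_ : _ = 392 / n%:R * Z ^+ 2); last first.
  rewrite /e big_const_seq count_predT size_scaled iter_addr_0 -mulr_natl.
  by field; rewrite gt_eqF.
rewrite (_ : (2 * b ^+ 2 + 392) / n%:R * Z ^+ 2 = 2 * b ^+ 2 / n%:R * Z ^+ 2 + 392 / n%:R * Z ^+ 2); last by ring.
rewrite lerD2r.
have := hb _ (bdg (0 + signsum (scaled v) s)) (fun w => norm_dgaussw _ H1) => hs.
rewrite /scaled big_map big_enum /=.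
rewrite (eq_bigr (fun j => n%:R^-1 * (\int[P]_w (inner (v j) (X w) * D w *
    dgaussw H (inner (0 + signsum (scaled v) s) (X w) - t))) ^+ 2)); last first.
  move=> j _; rewrite /dd.
  rewrite (_ : \int[P]_w _ = (Num.sqrt n%:R)^-1 * \int[P]_w (inner (v j) (X w) * D w *
    dgaussw H (inner (0 + signsum (scaled v) s) (X w) - t))); first by rewrite exprMn s2.
  rewrite -RintZ; last exact: bmfM.
  by apply: eq_Rintegral => w _; rewrite innerZl; ring.
rewrite -big_distrr /= mulrA.
rewrite (_ : 2 * b ^+ 2 / n%:R * Z ^+ 2 = 2 * n%:R^-1 * (b * Z) ^+ 2); last by field; rewrite gt_eqF.
by rewrite ler_pM2l // mulr_gt0 // invr_gt0.
Qed.

(* Chebyshev for F1 and F3 and Markov for F0: the three exceptional sets have total weight below 1. *)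
Lemma savg_select (R : realType) n (F1 F3 F0 : seq bool -> R)
    (m1 m3 m0 Z1 Z3 Z0 V eta : R) :
  0 < Z1 -> 0 < Z3 -> 0 < Z0 -> 0 < eta -> 0 <= m0 -> (forall s, 0 <= F0 s) ->
  m1 * Z1 <= savg n F1 -> m3 * Z3 <= savg n F3 -> savg n F0 <= m0 * Z0 ->
  savg n (fun s => F1 s ^+ 2) - savg n F1 ^+ 2 <= V * Z1 ^+ 2 ->
  savg n (fun s => F3 s ^+ 2) - savg n F3 ^+ 2 <= V * Z3 ^+ 2 ->
  2 * V * (m0 + eta) < eta ^+ 3 ->
  exists s, [/\ (m1 - eta) * Z1 <= F1 s, (m3 - eta) * Z3 <= F3 s & F0 s <= (m0 + eta) * Z0].
Proof.
move=> Z10 Z30 Z00 eta0 m00 F00 h1 h3 h0 v1 v3 hV.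
have me : 0 < m0 + eta by lra.
pose ch (F : seq bool -> R) Z s := (eta * Z) ^- 2 * (F s - savg n F) ^+ 2.
have chE F Z : 0 < Z -> savg n (fun s => F s ^+ 2) - savg n F ^+ 2 <= V * Z ^+ 2 ->
    savg n (ch F Z) <= V / eta ^+ 2.
  move=> Z0' hv; rewrite /ch savgZ; set c := savg n F in hv *.
  have -> : savg n (fun s => (F s - c) ^+ 2) = savg n (fun s => F s ^+ 2) - c ^+ 2.
    transitivity (savg n (fun s => F s ^+ 2 - (2 * c) * F s + c ^+ 2)).
      by apply: eq_savg => s; ring.
    by rewrite savgD savgB savgZ savg_cst -/c; ring.
  rewrite mulrC ler_pdivrMr ?exprn_gt0 ?mulr_gt0 //; apply: le_trans hv _.
  by rewrite exprMn le_eqVlt; apply/orP; left; apply/eqP; field; rewrite gt_eqF.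
have chP F Z m s : 0 < Z -> m * Z <= savg n F -> ch F Z s < 1 -> (m - eta) * Z <= F s.
  move=> Z0' hm; rewrite /ch mulrC ltr_pdivrMr ?exprn_gt0 ?mulr_gt0 // mul1r => hs.
  have : `|F s - savg n F| < eta * Z.
    rewrite -(@ltr_pXn2r _ 2) ?nnegrE ?mulr_ge0 ?(ltW eta0) ?(ltW Z0') //.
    by rewrite real_normK ?num_real.
  by rewrite ltr_norml; lra.
have ch0 F Z s : 0 <= ch F Z s by rewrite mulr_ge0 ?invr_ge0 ?sqr_ge0.
have : savg n (fun s => ch F1 Z1 s + ch F3 Z3 s + ((m0 + eta) * Z0)^-1 * F0 s) < 1.
  rewrite !savgD (savgZ n ((m0 + eta) * Z0)^-1 F0).
  have : ((m0 + eta) * Z0)^-1 * savg n F0 <= 1 - eta / (m0 + eta).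
    rewrite mulrC ler_pdivrMr ?mulr_gt0 //; apply: (le_trans h0).
    by rewrite le_eqVlt; apply/orP; left; apply/eqP; field; rewrite gt_eqF.
  have : 2 * (V / eta ^+ 2) < eta / (m0 + eta).
    rewrite ltr_pdivlMr //.
    have -> : 2 * (V / eta ^+ 2) * (m0 + eta) = 2 * V * (m0 + eta) / eta ^+ 2 by ring.
    by rewrite ltr_pdivrMr ?exprn_gt0 // (lt_le_trans hV) // (exprS eta 2).
  by have := chE F1 Z1 Z10 v1; have := chE F3 Z3 Z30 v3; lra.
move=> /savg_exists[s hs]; exists s.
have := ch0 F1 Z1 s; have := ch0 F3 Z3 s.
have : 0 <= ((m0 + eta) * Z0)^-1 * F0 s by rewrite mulr_ge0 // invr_ge0 mulr_ge0 // ltW.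
move=> p0 p3 p1; split.
- by apply: chP => //; lra.
- by apply: chP => //; lra.
have : ((m0 + eta) * Z0)^-1 * F0 s <= 1 by lra.
by rewrite mulrC ler_pdivrMr ?mulr_gt0 // mul1r.
Qed.

(** * Choosing the sign vectors one after the other *)

Definition gdens (R : realType) (d : nat) (A : set 'rV[R]_d) (H t : R) (gs : seq 'rV[R]_d)
  (x : 'rV[R]_d) : R := \1_A x * \prod_(g <- gs) gaussw H (inner g x - t).

Lemma gdens_cons (R : realType) (d : nat) (A : set 'rV[R]_d) (H t : R) (g : 'rV[R]_d) gs x :
  gdens A H t (g :: gs) x = gaussw H (inner g x - t) * gdens A H t gs x.
Proof. by rewrite /gdens big_cons mulrCA. Qed.

Lemma gdens_ge0_le1 (R : realType) (d : nat) (A : set 'rV[R]_d) (H t : R) gs x : 0 < H ->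
  0 <= gdens A H t gs x <= 1.
Proof.
move=> H0; elim: gs => [|g gs /andP[IH0 IH1]].
  by rewrite /gdens big_nil mulr1 indicE; case: (_ \in _); rewrite ?lexx ?ler01.
by rewrite gdens_cons mulr_ge0 ?expR_ge0 // mulr_ile1 ?expR_ge0 ?gaussw_le1.
Qed.

Lemma gdens_neq0 (R : realType) (d : nat) (A : set 'rV[R]_d) (H t : R) gs x :
  gdens A H t gs x != 0 -> A x.
Proof.
rewrite /gdens indicE; have [h|h] := boolP (x \in A); first by move: h; rewrite inE.
by rewrite mul0r eqxx.
Qed.

Lemma bmf_gdens (R : realType) m (Omega : measurableType m) (d : nat) (X : Omega -> 'rV[R]_d)
    (A : set 'rV[R]_d) (H t : R) gs :
  random_vector X -> closed A -> 0 < H -> bmf (fun w => gdens A H t gs (X w)).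
Proof.
move=> rX cA H0; elim: gs => [|g gs IH].
  rewrite (_ : (fun w => _) = (\1_(X @^-1` A) : Omega -> R)).
    by apply: bmf_indic; exact: random_vector_closed.
  by apply/funext => w; rewrite /gdens big_nil mulr1.
under eq_fun do rewrite gdens_cons.
by apply: bmfM => //; exact: bmf_gaussw.
Qed.

Lemma heat_bounds (R : realType) (H q t : R) : 0 < H -> 0 <= q ->
  0 <= Num.sqrt H * heat (H + q) t <= 1.
Proof.
move=> H0 q0; have s0 : 0 < Num.sqrt (H + q) by rewrite sqrtr_gt0; lra.
rewrite mulr_ge0 ?sqrtr_ge0 ?mulr_ge0 ?invr_ge0 ?sqrtr_ge0 ?expR_ge0 //=.
rewrite /heat mulrA mulr_ile1 ?expR_ge0 ?divr_ge0 ?sqrtr_ge0 //.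
  by rewrite ler_pdivrMr // mul1r ler_sqrt; lra.
by rewrite expR_le1 oppr_le0 divr_ge0 ?sqr_ge0 //; lra.
Qed.

Lemma qform_ge0 (R : realType) (d n : nat) (v : 'I_n -> 'rV[R]_d) x : 0 <= qform v x.
Proof. by rewrite mulr_ge0 ?invr_ge0 // sumr_ge0 // => i _; exact: sqr_ge0. Qed.

(** On the two windows a lower bound is wanted, so the variance has to be small, and [zeta] is the
    mass at which the Bessel estimate still applies. On [G] an upper bound is wanted, for which the
    mean suffices. [savg_select] finds one sign vector that serves all three. *)
Lemma gauss_step (R : realType) m (Omega : measurableType m) (P : probability Omega R)
    d (X : Omega -> 'rV[R]_d) n (v : 'I_n -> 'rV[R]_d) (r H t1 t2 t3 k1 k2 k3 eps eta zeta Zb b V : R)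
    (G A1 A3 : set 'rV[R]_d) (i0 : nat) (gs : seq 'rV[R]_d) :
  random_vector X -> log_concave P X -> closed G -> (0 < n)%N -> 1 <= r ->
  1 <= H -> 4 * r ^+ 2 <= H -> 8 * r ^+ 2 <= n%:R ->
  (forall x, G x -> forall i, `|inner (v i) x| <= 2 * r) ->
  prR P (X @^-1` ~` G) <= 8^-1 ->
  (forall i j, i != j -> `|\int[P]_w ((inner (v i) (X w) * \1_(X @^-1` G) w)
     * (inner (v j) (X w) * \1_(X @^-1` G) w))| <= n%:R^-1) ->
  closed A1 -> A1 `<=` G -> closed A3 -> A3 `<=` G ->
  (forall x, A1 x -> k1 <= Num.sqrt H * heat (H + qform v x) t1) ->
  (forall x, A3 x -> k3 <= Num.sqrt H * heat (H + qform v x) t3) ->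
  (forall x, G x -> Num.sqrt H * heat (H + qform v x) t2 <= k2) -> 0 <= k2 ->
  Num.sqrt H * (144 * r ^+ 4 / n%:R) <= eps -> 0 < eta ->
  b = 32 * 2 ^+ i0 * r + 1 -> V = (2 * b ^+ 2 + 392) / n%:R ->
  2 * V * (k2 + eps + eta) < eta ^+ 3 ->
  2 * r * n%:R * 3^-1 ^+ (2 ^ i0) <= zeta -> 0 < zeta -> 0 < Zb ->
  zeta <= \int[P]_w gdens A1 H t1 gs (X w) ->
  zeta <= \int[P]_w gdens A3 H t3 gs (X w) ->
  \int[P]_w gdens G H t2 gs (X w) <= Zb ->
  exists g, [/\ (k1 - eps - eta) * \int[P]_w gdens A1 H t1 gs (X w) <=
                   \int[P]_w gdens A1 H t1 (g :: gs) (X w),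
                (k3 - eps - eta) * \int[P]_w gdens A3 H t3 gs (X w) <=
                   \int[P]_w gdens A3 H t3 (g :: gs) (X w) &
                \int[P]_w gdens G H t2 (g :: gs) (X w) <= (k2 + eps + eta) * Zb].
Proof.
move=> rX lc cG n0 r1 H1 rH nr GM PG hB cA1 A1G cA3 A3G hk1 hk3 hk2 k20 heps eta0 hb hVb hV hz z0 Zb0 hZ1 hZ3 hZ0.
have H0 : 0 < H by exact: lt_le_trans ltr01 H1.
have eps0 : 0 <= eps by apply: le_trans heps; rewrite mulr_ge0 ?sqrtr_ge0 // divr_ge0 // mulr_ge0 // exprn_ge0 // (le_trans ler01 r1).
pose F A t s := \int[P]_w (gaussw H (inner (signsum (scaled v) s) (X w) - t) * gdens A H t gs (X w)).
have FE A t s : F A t s = \int[P]_w gdens A H t (signsum (scaled v) s :: gs) (X w).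
  by apply: eq_Rintegral => w _; rewrite gdens_cons.
have bD A t : closed A -> bmf (fun w => gdens A H t gs (X w)) by move=> cA; exact: bmf_gdens.
have D0 A t w : 0 <= gdens A H t gs (X w) by case/andP: (gdens_ge0_le1 A t gs (X w) H0).
have DA A t w : A `<=` G -> gdens A H t gs (X w) != 0 -> G (X w).
  by move=> AG h; apply: AG; exact: gdens_neq0 h.
have mean A t ka kb : closed A -> A `<=` G ->
    (forall x, A x -> ka <= Num.sqrt H * heat (H + qform v x) t <= kb) ->
    (ka - eps) * \int[P]_w gdens A H t gs (X w) <= savg n (F A t)
      <= (kb + eps) * \int[P]_w gdens A H t gs (X w).
  move=> cA AG hk.
  apply: (@savg_mean_bounds R m Omega P d X n v H r t eps ka kb _ rX n0 H1 nr heps (bD A t cA) (D0 A t)).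
    by move=> w h; apply: GM; apply: (DA A t w AG); rewrite gt_eqF.
  by move=> w h; apply: hk; apply: (@gdens_neq0 _ _ A H t gs); rewrite gt_eqF.
have var A t : closed A -> A `<=` G -> zeta <= \int[P]_w gdens A H t gs (X w) ->
    savg n (fun s => F A t s ^+ 2) - savg n (F A t) ^+ 2 <=
    V * (\int[P]_w gdens A H t gs (X w)) ^+ 2.
  move=> cA AG hZ; rewrite hVb.
  apply: (gaussw_step_variance rX n0 H1 rH (bD A t cA) (D0 A t)) => [w h|kap bk kap1|//].
    by apply: GM; exact: (DA A t w AG).
  rewrite hb; apply: (bessel_log_concave rX lc cG n0 r1 GM PG hB (bD A t cA)) => [w|w h|//|//|].
  - exact: gdens_ge0_le1.
  - exact: (DA A t w AG).
  - exact: le_trans hz hZ.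
have [||||||||||||s [s1 s3 s0]] := @savg_select R n (F A1 t1) (F A3 t3) (F G t2) (k1 - eps) (k3 - eps) (k2 + eps)
   (\int[P]_w gdens A1 H t1 gs (X w)) (\int[P]_w gdens A3 H t3 gs (X w)) Zb
   V eta.
- exact: lt_le_trans z0 hZ1.
- exact: lt_le_trans z0 hZ3.
- exact: Zb0.
- exact: eta0.
- exact: addr_ge0.
- move=> s; rewrite /F -(Rint_cst P 0); apply: Rint_le => [||w]; first exact: bmf_cst.
    by apply: bmfM; [exact: bmf_gaussw|exact: bD].
  by rewrite mulr_ge0 ?expR_ge0.
- have hb1 x : A1 x -> k1 <= Num.sqrt H * heat (H + qform v x) t1 <= 1.
    by move=> Ax; rewrite hk1 //=; case/andP: (heat_bounds t1 H0 (qform_ge0 v x)).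
  by case/andP: (mean A1 t1 k1 1 cA1 A1G hb1).
- have hb3 x : A3 x -> k3 <= Num.sqrt H * heat (H + qform v x) t3 <= 1.
    by move=> Ax; rewrite hk3 //=; case/andP: (heat_bounds t3 H0 (qform_ge0 v x)).
  by case/andP: (mean A3 t3 k3 1 cA3 A3G hb3).
- have hb2 x : G x -> 0 <= Num.sqrt H * heat (H + qform v x) t2 <= k2.
    by move=> Gx; rewrite hk2 // andbT; case/andP: (heat_bounds t2 H0 (qform_ge0 v x)).
  have /andP[_ h] := mean G t2 0 k2 cG (@subset_refl _ G) hb2.
  by apply: le_trans h _; apply: ler_wpM2l => //; exact: addr_ge0.
- exact: var.
- exact: var.
- exact: hV.
by exists (signsum (scaled v) s); rewrite -!FE.
Qed.

(** A step keeps at least a quarter of each window mass, so before each of the [k] steps the masses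
    are still at least 4^(-k) theta, and one value of [i0] serves throughout. *)
Lemma gauss_iterate (R : realType) m (Omega : measurableType m) (P : probability Omega R)
    d (X : Omega -> 'rV[R]_d) n (v : 'I_n -> 'rV[R]_d) (r H t1 t2 t3 k1 k2 k3 eps eta theta b V : R)
    (G A1 A3 : set 'rV[R]_d) (i0 k : nat) :
  random_vector X -> log_concave P X -> closed G -> (0 < n)%N -> 1 <= r ->
  1 <= H -> 4 * r ^+ 2 <= H -> 8 * r ^+ 2 <= n%:R ->
  (forall x, G x -> forall i, `|inner (v i) x| <= 2 * r) ->
  prR P (X @^-1` ~` G) <= 8^-1 ->
  (forall i j, i != j -> `|\int[P]_w ((inner (v i) (X w) * \1_(X @^-1` G) w)
     * (inner (v j) (X w) * \1_(X @^-1` G) w))| <= n%:R^-1) ->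
  closed A1 -> A1 `<=` G -> closed A3 -> A3 `<=` G ->
  (forall x, A1 x -> k1 <= Num.sqrt H * heat (H + qform v x) t1) ->
  (forall x, A3 x -> k3 <= Num.sqrt H * heat (H + qform v x) t3) ->
  (forall x, G x -> Num.sqrt H * heat (H + qform v x) t2 <= k2) -> 0 <= k2 ->
  Num.sqrt H * (144 * r ^+ 4 / n%:R) <= eps -> 0 < eta ->
  b = 32 * 2 ^+ i0 * r + 1 -> V = (2 * b ^+ 2 + 392) / n%:R ->
  2 * V * (k2 + eps + eta) < eta ^+ 3 ->
  2 * r * n%:R * 3^-1 ^+ (2 ^ i0) <= 4^-1 ^+ k * theta -> 0 < theta ->
  theta <= prR P (X @^-1` A1) -> theta <= prR P (X @^-1` A3) ->
  4^-1 <= k1 - eps - eta -> 4^-1 <= k3 - eps - eta ->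
  forall i, (i <= k)%N -> exists gs,
    [/\ (k1 - eps - eta) ^+ i * theta <= \int[P]_w gdens A1 H t1 gs (X w),
        (k3 - eps - eta) ^+ i * theta <= \int[P]_w gdens A3 H t3 gs (X w) &
        \int[P]_w gdens G H t2 gs (X w) <= (k2 + eps + eta) ^+ i].
Proof.
move=> rX lc cG n0 r1 H1 rH nr GM PG hB cA1 A1G cA3 A3G hk1 hk3 hk2 k20 heps eta0 hb hVb hV hz th0 th1 th3 hb1 hb3.
have eps0 : 0 <= eps by apply: le_trans heps; rewrite mulr_ge0 ?sqrtr_ge0 // divr_ge0 // mulr_ge0 // exprn_ge0 // (le_trans ler01 r1).
have base A t : closed A -> \int[P]_w gdens A H t [::] (X w) = prR P (X @^-1` A).
  move=> cA; rewrite -Rint_indic; last exact: random_vector_closed.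
  by apply: eq_Rintegral => w _; rewrite /gdens big_nil mulr1.
have pw (c : R) i : 4^-1 <= c -> (i <= k)%N -> 4^-1 ^+ k * theta <= c ^+ i * theta.
  move=> hc ik; rewrite ler_pM2r //; apply: (@le_trans _ _ (4^-1 ^+ i)).
    by apply: ler_wiXn2l => //; clear; lra.
  by rewrite lerXn2r ?nnegrE //; move: hc; clear; lra.
elim=> [|i IH] ik.
  exists [::]; rewrite !base // !expr0 !mul1r; split => //.
  by apply: prR_le1; exact: random_vector_closed.
have [gs [g1 g3 g0]] := IH (ltnW ik).
have ik' := ltnW ik.
have z0 : 0 < 4^-1 ^+ k * theta by rewrite mulr_gt0 // exprn_gt0 // invr_gt0.
have Zb0 : 0 < (k2 + eps + eta) ^+ i by rewrite exprn_gt0 // ltr_wpDl // addr_ge0.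
have [g [h1 h3 h0]] := gauss_step rX lc cG n0 r1 H1 rH nr GM PG hB cA1 A1G cA3 A3G hk1 hk3 hk2 k20
  heps eta0 hb hVb hV hz z0 Zb0 (le_trans (pw _ _ hb1 ik') g1) (le_trans (pw _ _ hb3 ik') g3) g0.
exists (g :: gs); split.
- apply: le_trans h1; rewrite exprS -mulrA; apply: ler_wpM2l => //; apply: le_trans hb1; by rewrite invr_ge0.
- apply: le_trans h3; rewrite exprS -mulrA; apply: ler_wpM2l => //; apply: le_trans hb3; by rewrite invr_ge0.
- by rewrite exprS.
Qed.

(** * Level sets of the potential and the midpoint inequality for weights *)

Definition gpot (R : realType) (d : nat) (H t : R) (gs : seq 'rV[R]_d) (x : 'rV[R]_d) : R :=
  \sum_(g <- gs) (inner g x - t) ^+ 2 / (2 * H).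

Lemma gdensE (R : realType) (d : nat) (A : set 'rV[R]_d) (H t : R) gs x :
  gdens A H t gs x = \1_A x * expR (- gpot H t gs x).
Proof.
rewrite /gdens; congr (_ * _); elim: gs => [|g gs IH]; rewrite /gpot ?big_nil ?oppr0 ?expR0 //.
by rewrite !big_cons IH opprD expRD.
Qed.

Lemma gpot_ge0 (R : realType) (d : nat) (H t : R) (gs : seq 'rV[R]_d) x : 0 < H -> 0 <= gpot H t gs x.
Proof.
by move=> H0; apply: sumr_ge0 => g _; rewrite divr_ge0 ?sqr_ge0 // mulr_ge0 // ltW.
Qed.

Lemma continuous_gpot (R : realType) (d : nat) (H t : R) (gs : seq 'rV[R]_d) : continuous (gpot H t gs).
Proof.
apply: continuous_sumr => g y.
apply: (@continuousM R _ (fun x => (inner g x - t) ^+ 2)); last exact: cst_continuous.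
apply: (@continuous_comp _ _ _ (fun x => inner g x - t) (fun z : R => z ^+ 2)); last exact: exprn_continuous.
by apply: continuousB; [exact: continuous_inner|exact: cst_continuous].
Qed.

(** Each term is the square of a function affine jointly in the point and the centre, hence jointly
    convex; this is why the middle centre must be the mean of the outer two. *)
Lemma gpot_midpoint (R : realType) (d : nat) (H t1 t3 : R) (gs : seq 'rV[R]_d) x y : 0 < H ->
  gpot H ((t1 + t3) / 2) gs (2^-1 *: x + 2^-1 *: y) <= 2^-1 * gpot H t1 gs x + 2^-1 * gpot H t3 gs y.
Proof.
move=> H0; rewrite /gpot !big_distrr /= -big_split /=; apply: ler_sum => g _.
rewrite !mulrA -mulrDl ler_pM2r ?invr_gt0 ?mulr_gt0 // innerDr !innerZr.
by have := sqr_ge0 ((inner g x - t1) - (inner g y - t3)); nra.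
Qed.

(** Rounding the potential down to an integer i bounds the weight by exp(-i). Potentials of at least
    [I] contribute at most half of the integral, so one of the other [I] levels carries a share 1 /
    (2 I). *)
Lemma gdens_level_set (R : realType) m (Omega : measurableType m) (P : probability Omega R)
    d (X : Omega -> 'rV[R]_d) (A : set 'rV[R]_d) (H t : R) gs (I : nat) :
  random_vector X -> closed A -> 0 < H ->
  expR (- I%:R) <= 2^-1 * \int[P]_w gdens A H t gs (X w) ->
  exists2 i : nat, (i < I)%N & (2 * I%:R)^-1 * \int[P]_w gdens A H t gs (X w) <=
    expR (- i%:R) * prR P (X @^-1` (A `&` [set x | gpot H t gs x <= i.+1%:R])).
Proof.
move=> rX cA H0 hI; set p := \int[P]_w _ in hI *.
have p0 : 0 < p by have := expR_gt0 (- I%:R : R); lra.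
have I0 : (0 < I)%N.
  rewrite lt0n; apply/eqP => I0; move: hI; rewrite I0 oppr0 expR0.
  suff : p <= 1 by lra.
  rewrite -(Rint_cst P 1); apply: Rint_le => [||w]; [exact: bmf_gdens|exact: bmf_cst|].
  by case/andP: (gdens_ge0_le1 A t gs (X w) H0).
have I0' : 0 < I%:R :> R by rewrite ltr0n.
pose K (i : nat) := A `&` [set x | gpot H t gs x <= i.+1%:R].
have cK i : closed (K i) by apply: closedI => //; apply: closed_le_fun; exact: continuous_gpot.
have mK i : measurable (X @^-1` K i) by exact: random_vector_closed.
apply: contrapT => H1.
have : p <= \int[P]_w (\sum_(i < I) expR (- i%:R) * \1_(X @^-1` K i) w + expR (- I%:R)).
  apply: Rint_le; first exact: bmf_gdens.
    apply: bmfD; last exact: bmf_cst.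
    by apply: bmf_sum => i; apply: bmfZ; exact: bmf_indic.
  move=> w; have s0 (Q : pred 'I_I) : 0 <= \sum_(i < I | Q i) expR (- i%:R) * \1_(X @^-1` K i) w :> R.
    by apply: sumr_ge0 => i _; rewrite mulr_ge0 ?expR_ge0.
  have [Aw|nA] := boolP (X w \in A); last first.
    by rewrite gdensE indicE (negbTE nA) mul0r addr_ge0 ?expR_ge0 //; exact: (s0 predT).
  rewrite gdensE indicE Aw mul1r.
  have /andP[q1 q2] := truncn_itv (gpot_ge0 t gs (X w) H0).
  have [iI|Ii] := ltnP (Num.truncn (gpot H t gs (X w))) I.
    rewrite (bigD1 (Ordinal iI)) //= -addrA; apply: (@le_trans _ _ (expR (- (Num.truncn (gpot H t gs (X w)))%:R))).
      by rewrite ler_expR lerN2.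
    rewrite indicE mem_set ?mulr1; last by split; [move: Aw; rewrite inE|exact: ltW].
    by rewrite lerDl addr_ge0 ?expR_ge0 //; exact: s0.
  apply: (@le_trans _ _ (expR (- I%:R))); last by rewrite lerDr; exact: (s0 predT).
  by rewrite ler_expR lerN2; apply: le_trans q1; rewrite ler_nat.
rewrite RintD ?Rint_cst; [|by apply: bmf_sum => i; apply: bmfZ; exact: bmf_indic|exact: bmf_cst].
rewrite Rint_sum => [|i]; last by apply: bmfZ; exact: bmf_indic.
apply/negP; rewrite -ltNge.
suff : \sum_(i < I) \int[P]_w (expR (- i%:R) * \1_(X @^-1` K i) w) < 2^-1 * p by lra.
apply: (@lt_le_trans _ _ (\sum_(i < I) (2 * I%:R)^-1 * p)); last first.
  apply: le_trans (sumr_le_const (fun _ => lexx _)) _.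
  by rewrite le_eqVlt; apply/orP; left; apply/eqP; field; rewrite gt_eqF.
apply: ltr_sum => [|i _].
  by apply/hasP; exists (Ordinal I0) => //; rewrite mem_index_enum.
rewrite RintZ ?Rint_indic //; last exact: bmf_indic.
by rewrite ltNge; apply/negP => h; apply: H1; exists i.
Qed.

(* A Prekopa-Leindler inequality for the weights, deduced from sets through level sets of the
   potential at the price of a factor polynomial in I. *)
Lemma gdens_midpoint (R : realType) m (Omega : measurableType m) (P : probability Omega R)
    d (X : Omega -> 'rV[R]_d) (G A1 A3 : set 'rV[R]_d) (H t1 t3 : R) gs (I : nat) :
  random_vector X -> log_concave P X -> closed G -> closed A1 -> closed A3 ->
  A1 `<=` G -> A3 `<=` G ->
  (forall x y, G x -> G y -> G (2^-1 *: x + 2^-1 *: y)) -> 0 < H ->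
  expR (- I%:R) <= 2^-1 * \int[P]_w gdens A1 H t1 gs (X w) ->
  expR (- I%:R) <= 2^-1 * \int[P]_w gdens A3 H t3 gs (X w) ->
  (\int[P]_w gdens A1 H t1 gs (X w)) * (\int[P]_w gdens A3 H t3 gs (X w)) <=
  (2 * I%:R) ^+ 2 * expR 2 * (\int[P]_w gdens G H ((t1 + t3) / 2) gs (X w)) ^+ 2.
Proof.
move=> rX lc cG cA1 cA3 A1G A3G mG H0 e1 e3.
have [i iI hi] := gdens_level_set rX cA1 H0 e1.
have [j jI hj] := gdens_level_set rX cA3 H0 e3.
set p1 := \int[P]_w _ in e1 hi *; set p3 := \int[P]_w _ in e3 hj *; set p2 := \int[P]_w _.
set K1 := A1 `&` _ in hi; set K3 := A3 `&` _ in hj.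
have I0 : 0 < I%:R :> R by rewrite ltr0n (leq_trans _ iI).
(* The mean of the bounds i + 1 and j + 1 on the two potentials; rounding to integers is what
   produces the factor exp(2). *)
pose c : R := (i%:R + j%:R) / 2 + 1.
pose E := G `&` [set x | gpot H ((t1 + t3) / 2) gs x <= c].
have cK1 : closed K1 by apply: closedI => //; apply: closed_le_fun; exact: continuous_gpot.
have cK3 : closed K3 by apply: closedI => //; apply: closed_le_fun; exact: continuous_gpot.
have cE : closed E by apply: closedI => //; apply: closed_le_fun; exact: continuous_gpot.
have mE : measurable (X @^-1` E) by exact: random_vector_closed.
have bm : prR P (X @^-1` K1) * prR P (X @^-1` K3) <= prR P (X @^-1` E) ^+ 2.
  apply: (log_concave_midpoint rX lc cK1 cK3 mE) => x y [Ax hx] [Ay hy]; split.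
    by apply: mG; [exact: A1G|exact: A3G].
  have hS (l : nat) : l.+1%:R = l%:R + 1 :> R by rewrite natr1.
  move: hx hy; rewrite /= (hS i) (hS j) => hx hy; apply: le_trans (gpot_midpoint _ _ _ _ _ H0) _.
  by rewrite /c; lra.
have pE : expR (- c) * prR P (X @^-1` E) <= p2.
  rewrite -Rint_indic // -RintZ; last exact: bmf_indic.
  apply: Rint_le; [by apply: bmfZ; exact: bmf_indic|exact: bmf_gdens|move=> w].
  rewrite indicE; have [h|h] := boolP (w \in _); last first.
    by rewrite mulr0; case/andP: (gdens_ge0_le1 G ((t1 + t3) / 2) gs (X w) H0).
  move: h; rewrite inE => -[Gw hw].
  by rewrite gdensE indicE mem_set // mul1r mulr1 ler_expR lerN2.
have p20 : 0 <= p2 by apply: le_trans pE; rewrite mulr_ge0 ?expR_ge0 ?prR_ge0.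
have p10 : 0 <= p1 by have := expR_ge0 (- I%:R : R); lra.
have p30 : 0 <= p3 by have := expR_ge0 (- I%:R : R); lra.
have h2 : expR (- c) ^+ 2 * prR P (X @^-1` E) ^+ 2 <= p2 ^+ 2.
  by rewrite -exprMn lerXn2r ?nnegrE ?mulr_ge0 ?expR_ge0 ?prR_ge0.
have ec : expR (- i%:R) * expR (- j%:R) = expR 2 * expR (- c) ^+ 2.
  by rewrite -expRM_natl -!expRD /c; congr expR; field.
have k0 : 0 <= (2 * I%:R)^-1 :> R by rewrite invr_ge0 mulr_ge0.
have h4 := ler_pM (mulr_ge0 k0 p10) (mulr_ge0 k0 p30) hi hj.
have h5 : (2 * I%:R)^-1 * p1 * ((2 * I%:R)^-1 * p3) <= expR 2 * p2 ^+ 2.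
  apply: le_trans h4 _; rewrite mulrACA ec -mulrA ler_pM2l ?expR_gt0 //.
  by apply: le_trans h2; rewrite ler_pM2l // exprn_gt0 // expR_gt0.
rewrite -mulrA -ler_pdivrMl ?exprn_gt0 ?mulr_gt0 //.
by apply: le_trans h5; rewrite le_eqVlt; apply/orP; left; apply/eqP; field; rewrite gt_eqF.
Qed.

(** * Optimal centres and the gain of one factor *)

Lemma expRN1_half (R : realType) : 3^-1 <= expR (- 2^-1) ^+ 2 :> R /\ expR (- 2^-1) <= 1 :> R.
Proof.
split; last by rewrite expR_le1; lra.
(* The eighth power of 1 - 1/8 already exceeds 1/3. *)
have h : (7 / 8) ^+ 4 <= expR (- 2^-1) :> R.
  rewrite (_ : - 2^-1 = 4%:R * (- 8^-1) :> R); last by field.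
  have g : 7 / 8 <= expR (- 8^-1) :> R by have := expR_ge1Dx (- 8^-1 : R); lra.
  by rewrite expRM_natl; apply: lerXn2r => //; rewrite nnegrE ?expR_ge0 //; lra.
apply: (@le_trans _ _ (((7 / 8) ^+ 4) ^+ 2)); first by lra.
by rewrite lerXn2r ?nnegrE ?expR_ge0 // exprn_ge0 //; lra.
Qed.

(* As a function of T the value heat T t is maximal at T = t^2; heat_ge is the matching lower
   bound near the maximum. *)
Lemma heat_le (R : realType) (T t : R) : 0 < T -> 0 < t -> heat T t <= expR (- 2^-1) / t.
Proof.
move=> T0 t0; have s0 : 0 < Num.sqrt T by rewrite sqrtr_gt0.
have s2 : Num.sqrt T ^+ 2 = T by rewrite sqr_sqrtr // ltW.
rewrite ler_pdivlMr // /heat.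
have l0 : 0 <= (Num.sqrt T)^-1 * expR (- (t ^+ 2 / (2 * T))) * t.
  by rewrite !mulr_ge0 ?invr_ge0 ?expR_ge0 // ltW.
rewrite -(@ler_pXn2r _ 2) ?nnegrE ?expR_ge0 // !exprMn exprVn s2 -!expRM_natl.
(* After squaring, the claim is z exp(-z) <= exp(-1), with equality at z = 1. *)
set z := t ^+ 2 / T.
have -> : T^-1 * expR (2 * - (t ^+ 2 / (2 * T))) * t ^+ 2 = z * expR (- z).
  rewrite (_ : 2 * - (t ^+ 2 / (2 * T)) = - z); first by rewrite /z; ring.
  by rewrite /z; field; rewrite gt_eqF.
have -> : expR (2 * - 2^-1) = expR (z - 1) * expR (- z) :> R.
  by rewrite -expRD; congr expR; field.
by rewrite ler_pM2r ?expR_gt0 //; have := expR_ge1Dx (z - 1); rewrite addrCA subrr addr0.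
Qed.

Lemma heat_ge (R : realType) (T u q : R) : 0 < T -> 0 <= u <= q ->
  (1 - q ^+ 2) * (expR (- 2^-1) / Num.sqrt T) <= heat (T * (1 + u)) (Num.sqrt T).
Proof.
move=> T0 /andP[u0 uq]; have s0 : 0 < Num.sqrt T by rewrite sqrtr_gt0.
have s2 : Num.sqrt T ^+ 2 = T by rewrite sqr_sqrtr // ltW.
have u1 : 0 < 1 + u by lra.
have su0 : 0 < Num.sqrt (1 + u) by rewrite sqrtr_gt0.
have su : Num.sqrt (1 + u) <= 1 + u / 2.
  rewrite -[X in _ <= X]ger0_norm -?sqrtr_sqr ?ler_sqrt ?sqr_ge0 //; [have := sqr_ge0 u; lra|lra].
rewrite /heat sqrtrM ?(ltW T0) // invfM s2.
have -> : - (T / (2 * (T * (1 + u)))) = - 2^-1 + u / (2 * (1 + u)).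
  by field; rewrite ?gt_eqF.
rewrite expRD.
rewrite (_ : (1 - q ^+ 2) * _ = (expR (- 2^-1) * (Num.sqrt T)^-1) * (1 - q ^+ 2)); last by ring.
rewrite [X in _ <= X](_ : _ = (expR (- 2^-1) * (Num.sqrt T)^-1) * ((Num.sqrt (1 + u))^-1 * expR (u / (2 * (1 + u))))); last by ring.
rewrite ler_pM2l ?mulr_gt0 ?invr_gt0 ?expR_gt0 // ler_pdivlMl //.
have h1 : 1 - q ^+ 2 <= 1 - u ^+ 2.
  by rewrite lerD2l lerN2 lerXn2r ?nnegrE // (le_trans u0).
have h2 := expR_ge1Dx (u / (2 * (1 + u))).
apply: le_trans h2; have [u2|u2] := leP 0 (1 - q ^+ 2); last first.
  apply: (@le_trans _ _ 0); last by rewrite addr_ge0 // divr_ge0 // mulr_ge0 // ltW.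
  by rewrite pmulr_rle0 // ltW.
(* The growth of sqrt(1 + u) cancels the exponential factor to first order, as it must at a maximum,
   so that only a second-order loss remains. *)
apply: (@le_trans _ _ ((1 + u / 2) * (1 - u ^+ 2))).
  by apply: ler_pM => //; exact: ltW.
rewrite -(@ler_pM2r _ (2 * (1 + u))) ?mulr_gt0 // [X in _ <= X]mulrDl divfK ?gt_eqF ?mulr_gt0 //.
have := mulr_ge0 u0 u0; have := mulr_ge0 u0 (mulr_ge0 u0 u0).
by have := mulr_ge0 (mulr_ge0 u0 u0) (mulr_ge0 u0 u0); nra.
Qed.

(* The gain is the AM-GM defect ((x1 + x3) / 2)^2 - x1 x3. *)
Lemma gaussian_gain (R : realType) (e q xi x1 x3 : R) :
  0 <= e <= 1 -> 3^-1 <= e ^+ 2 -> 0 < q <= 10^-1 -> 0 <= xi <= q ^+ 2 ->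
  1 <= x1 -> 60 * q <= x3 ^+ 2 - x1 ^+ 2 -> 0 <= x3 -> x3 ^+ 2 <= 2 ->
  [/\ 4^-1 <= (1 - q ^+ 2) * (e / x1) - xi, 4^-1 <= (1 - q ^+ 2) * (e / x3) - xi &
   (e / ((x1 + x3) / 2) + xi) ^+ 2 * (1 + q ^+ 2) <=
   ((1 - q ^+ 2) * (e / x1) - xi) * ((1 - q ^+ 2) * (e / x3) - xi)].
Proof.
move=> /andP[e0 e1] e2 /andP[q0 q1] /andP[xi0 xi1] x11 x13 x30 x32.
set Q := q ^+ 2 in xi1 *.
have Q0 : 0 < Q by rewrite exprn_gt0.
have Q1 : Q <= 100^-1 by rewrite /Q; nra.
have eh : 4 / 7 <= e by nra.
have x3x1 : x1 <= x3 by nra.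
have x3b : x3 <= 10 / 7 by nra.
(* The squares are 60 q apart and x1 + x3 <= 3. *)
have d20 : 20 * q <= x3 - x1.
  have : (x3 - x1) * (x1 + x3) <= (x3 - x1) * 3 by apply: ler_wpM2l; lra.
  nra.
have inv (x : R) : 1 <= x -> x <= 10 / 7 -> 4 / 10 <= e / x <= 1.
  move=> xa xb; have xp : 0 < x by lra.
  by rewrite ler_pdivlMr // ler_pdivrMr // mul1r; apply/andP; split; lra.
have x1b : x1 <= 10 / 7 by lra.
have /andP[a1 b1] := inv _ x11 x1b.
have x31 : 1 <= x3 by lra.
have /andP[a3 b3] := inv _ x31 x3b.
set x2 := (x1 + x3) / 2.
have x21 : 1 <= x2 by rewrite /x2; lra.
have x2b : x2 <= 10 / 7 by rewrite /x2; lra.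
have /andP[a2 b2] := inv _ x21 x2b.
have x10 : 0 < x1 by lra.
have x30' : 0 < x3 by lra.
have x20 : 0 < x2 by lra.
have id : (e / x1) * (e / x3) * (x1 * x3) = (e / x2) ^+ 2 * x2 ^+ 2.
  by rewrite -exprMn divfK ?gt_eqF //; field; rewrite !gt_eqF.
(* Here x2^2 - x1 x3 = (x3 - x1)^2 / 4 >= 100 Q, to be compared with x1 x3 <= 2. *)
have gain : (e / x2) ^+ 2 * (1 + 50 * Q) <= (e / x1) * (e / x3).
  have x13p : 0 < x1 * x3 by exact: mulr_gt0.
  rewrite -(@ler_pM2r _ (x1 * x3)) // id -mulrA.
  apply: ler_wpM2l; first exact: sqr_ge0.
  have xx : x1 * x3 <= 2 by nra.
  have dd : (20 * q) ^+ 2 <= (x3 - x1) ^+ 2 by rewrite lerXn2r ?nnegrE //; move: d20 q0; clear; lra.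
  have : Q * (x1 * x3) <= Q * 2 by rewrite ler_pM2l.
  move: dd; rewrite exprMn -/Q /x2; clear; lra.
have e6 : 6^-1 <= (e / x2) ^+ 2.
  rewrite expr_div_n ler_pdivlMr ?exprn_gt0 //.
  have : x2 ^+ 2 <= 2 by rewrite /x2; nra.
  lra.
move: (e / x1) (e / x3) (e / x2) a1 a2 a3 b1 b2 b3 gain e6 => A C D a1 a2 a3 b1 b2 b3 gain e6.
clearbody Q; clear -Q0 Q1 xi0 xi1 a1 a2 a3 b1 b2 b3 gain e6.
split; [by nra|by nra|].
have A0 : 0 <= A by lra.
have C0 : 0 <= C by lra.
have D0 : 0 <= D by lra.
have Q0' := ltW Q0.
have xi11 : xi <= 1 by move: xi1 Q1; clear; lra.
have AC0 := mulr_ge0 A0 C0.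
(* The gain 50 Q D^2, with D^2 >= 1/6, has to pay for all losses of order Q: the factors 1 - Q, the
   error [xi] on either side, and the final 1 + Q. *)
have l1 : A * C * (1 - 2 * Q) - 2 * Q <= ((1 - Q) * A - xi) * ((1 - Q) * C - xi).
  have := mulr_ge0 (mulr_ge0 Q0' Q0') AC0.
  have := mulr_ge0 Q0' (mulr_ge0 xi0 A0); have := mulr_ge0 Q0' (mulr_ge0 xi0 C0).
  have := ler_piMr xi0 b1; have := ler_piMr xi0 b3; have := mulr_ge0 xi0 xi0.
  clear gain e6; lra.
apply: le_trans l1.
have QQ : Q * Q <= 100^-1 * Q by rewrite ler_pM2r.
have l2 : D ^+ 2 * (1 + 47 * Q) <= A * C * (1 - 2 * Q).
  apply: (@le_trans _ _ (D ^+ 2 * (1 + 50 * Q) * (1 - 2 * Q))).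
    by rewrite -mulrA; apply: ler_wpM2l; [exact: sqr_ge0|clear gain e6; lra].
  by apply: ler_wpM2r => //; clear gain e6; lra.
have D21 : D ^+ 2 <= 1 by rewrite exprn_ile1.
have l3 : (D + xi) ^+ 2 <= D ^+ 2 + 3 * Q.
  have := ler_piMl xi0 b2.
  have : xi * xi <= Q by apply: le_trans xi1; exact: ler_piMl.
  by rewrite sqrrD expr2; clear gain e6 l2 D21; lra.
have l4 : (D + xi) ^+ 2 * (1 + Q) <= (D ^+ 2 + 3 * Q) * (1 + Q).
  by apply: ler_wpM2r => //; clear -Q0; lra.
have : Q * 6^-1 <= Q * D ^+ 2 by rewrite ler_pM2l.
move: QQ l2 l4; clear -Q0 xi1; lra.
Qed.

(** Since the windows lie below 4 r^2 = H, dividing the centres by sqrt H brings them into the range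
    of [gaussian_gain], and q is the window width relative to H. The product of the final window
    masses is at least (1 + q^2)^k r^(-24) times the squared bound for the middle weight, while
    [gdens_midpoint] allows only the factor (2 I)^2 e^2. *)
Lemma core_contradiction (R : realType) m (Omega : measurableType m) (P : probability Omega R)
    d (X : Omega -> 'rV[R]_d) n (v : 'I_n -> 'rV[R]_d) (r H w q eps eta b V : R)
    (L i0 k I : nat) (G B : set 'rV[R]_d) :
  random_vector X -> log_concave P X -> (0 < n)%N -> 64 <= r -> H = 4 * r ^+ 2 ->
  0 < w -> 64 * w = (64 * r)^-1 -> L%:R * w = 4 * r ^+ 2 -> L.+1%:R <= r ^+ 4 ->
  q = w / H -> q <= 10^-1 -> 8 * r ^+ 2 <= n%:R ->
  Num.sqrt H * (144 * r ^+ 4 / n%:R) <= eps -> 0 < eta -> eps + eta <= q ^+ 2 ->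
  b = 32 * 2 ^+ i0 * r + 1 -> V = (2 * b ^+ 2 + 392) / n%:R -> 4 * V < eta ^+ 3 ->
  2 * r * n%:R * 3^-1 ^+ (2 ^ i0) <= 4^-1 ^+ k * r^-1 ^+ 12 ->
  expR (- I%:R) <= 2^-1 * (4^-1 ^+ k * r^-1 ^+ 12) ->
  (2 * I%:R) ^+ 2 * expR 2 < (1 + q ^+ 2) ^+ k * (r^-1 ^+ 12) ^+ 2 ->
  closed G -> closed B -> B `<=` G ->
  (forall x y, G x -> G y -> G (2^-1 *: x + 2^-1 *: y)) ->
  (forall x, G x -> forall i, `|inner (v i) x| <= 2 * r) ->
  (forall x, B x -> forall i, `|inner (v i) x| <= 2^-1) ->
  3 / 4 <= prR P (X @^-1` B) ->
  prR P (X @^-1` ~` G) <= (2 * r)^-1 ->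
  (forall i, r^-1 <= prR P [set w | 1 <= `|inner (v i) (X w)|]) ->
  (forall i j, i != j -> `|\int[P]_w ((inner (v i) (X w) * \1_(X @^-1` G) w)
     * (inner (v j) (X w) * \1_(X @^-1` G) w))| <= n%:R^-1) ->
  False.
Proof.
move=> rX lc n0 r64 HE w0 w64 Lw L4 qE q10 nr heps eta0 epseta hb hVb hV4 hz hI hfin
  cG cB BG mG GM Bh PB PG PV hB.
have r1 : 1 <= r by apply: le_trans r64; clear; lra.
have r0 : 0 < r by exact: lt_le_trans ltr01 r1.
have [a1 [a3 [a10 a13 a3H P1 P3]]] :=
  separated_windows rX lc n0 r64 w0 w64 Lw L4 cG cB BG mG GM Bh PB PG PV.
have H1 : 1 <= H by rewrite HE; have := exprn_ege1 2 r1; clear; lra.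
have H0 : 0 < H by exact: lt_le_trans ltr01 H1.
have rH : 4 * r ^+ 2 <= H by rewrite HE.
have q0 : 0 < q by rewrite qE divr_gt0.
have wq : w = q * H by rewrite qE divfK // gt_eqF.
have a30 : 0 <= a3 by apply: le_trans a13; rewrite addr_ge0 // mulr_ge0 // ltW.
have a3H' : a3 <= H by rewrite HE.
have a1H' : a1 <= H by apply: le_trans a3H'; apply: le_trans a13; rewrite lerDl mulr_ge0 // ltW.
pose e := expR (- 2^-1) : R.
have [e3 e1] := expRN1_half R.
have e0 : 0 <= e by exact: expR_ge0.
pose s a := Num.sqrt (H + a).
have s0 a : 0 <= a -> 0 < s a by move=> a0; rewrite sqrtr_gt0 ltr_wpDr.
have s2 a : 0 <= a -> s a ^+ 2 = H + a by move=> a0; rewrite sqr_sqrtr // addr_ge0 // ltW.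
pose S := Num.sqrt H; have S0 : 0 < S by rewrite sqrtr_gt0.
have S2 : S ^+ 2 = H by rewrite sqr_sqrtr // ltW.
have x2 a : 0 <= a -> (s a / S) ^+ 2 = 1 + a / H.
  by move=> a0; rewrite expr_div_n s2 // S2 mulrDl divff // gt_eqF.
have x0 a : 0 <= a -> 0 <= s a / S by move=> a0; rewrite divr_ge0 ?sqrtr_ge0.
have x1 a : 0 <= a -> 1 <= s a / S.
  by move=> a0; rewrite ler_pdivlMr // mul1r ler_sqrt ?addr_ge0 ?(ltW H0) // lerDl.
have eps0 : 0 <= eps.
  apply: le_trans heps; apply: mulr_ge0; first exact: ltW.
  by apply: divr_ge0; [apply: mulr_ge0 (ler0n _ _) (exprn_ge0 _ (ltW r0))|exact: ler0n].
have xi0 : 0 <= eps + eta by exact: addr_ge0 eps0 (ltW eta0).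
have [||||||||g1 g3 g2] := @gaussian_gain R e q (eps + eta) (s a1 / S) (s a3 / S).
- by rewrite e0 e1.
- exact: e3.
- by rewrite q0 q10.
- by rewrite xi0 epseta.
- exact: x1.
- rewrite !x2 // -(@ler_pM2r _ H) // mulrBl !mulrDl !divfK ?gt_eqF //.
  by move: a13; rewrite wq; clear; lra.
- exact: x0.
- rewrite x2 //; have : a3 / H <= 1 by rewrite ler_pdivrMr // mul1r.
  by clear; lra.
pose t2 := (s a1 + s a3) / 2.
have t20 : 0 < t2 by rewrite divr_gt0 // addr_gt0 // s0.
(* The maximum over T of S times [heat T t], attained at T = t^2. *)
pose kk t := e / (t / S).
have kkE t : 0 < t -> kk t = S * (e / t).
  by move=> t0; rewrite /kk; field; rewrite !gt_eqF.
have k2E : kk t2 = e / ((s a1 / S + s a3 / S) / 2).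
  by rewrite /kk /t2; congr (e / _); ring.
pose A a := qwindow G v a w.
have AG a : A a `<=` G by move=> x [].
have cA a : closed (A a) by exact: closed_qwindow.
(* On the window the variance exceeds H + a by a relative amount of at most w / H = q, which costs
   only q^2 near the maximum. *)
have hk a : 0 <= a -> forall x, A a x -> (1 - q ^+ 2) * kk (s a) <= S * heat (H + qform v x) (s a).
  move=> a0 x [_ /andP[h1 h2]].
  have Ha : 0 < H + a by rewrite ltr_wpDr.
  have := @heat_ge R (H + a) ((qform v x - a) / (H + a)) q Ha.
  have -> : (H + a) * (1 + (qform v x - a) / (H + a)) = H + qform v x.
    by field; rewrite gt_eqF.
  rewrite kkE ?s0 // (mulrCA _ S) => h; rewrite ler_pM2l //; apply: h.
  rewrite divr_ge0 ?(ltW Ha) ?subr_ge0 //= ler_pdivrMr //.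
  apply: (@le_trans _ _ w); first by rewrite lerBlDl.
  by rewrite wq ler_pM2l // lerDl.
have hk2 x : G x -> S * heat (H + qform v x) t2 <= kk t2.
  move=> Gx; rewrite kkE // ler_pM2l //; apply: heat_le => //.
  by rewrite ltr_wpDr ?qform_ge0.
have kk20 : 0 <= kk t2 by rewrite /kk divr_ge0 // divr_ge0 ?(ltW t20) // ltW.
have kk21 : kk t2 <= 1.
  rewrite k2E ler_pdivrMr; last by have := x1 _ a10; have := x1 _ a30; clear; lra.
  by have := x1 _ a10; have := x1 _ a30; move: e1; rewrite -/e mul1r; clear; lra.
have hV : 2 * V * (kk t2 + eps + eta) < eta ^+ 3.
  apply: le_lt_trans hV4.
  have V0 : 0 <= V.
    rewrite hVb; apply: divr_ge0; last exact: ler0n.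
    by apply: addr_ge0; [apply: mulr_ge0 (ler0n _ _) (sqr_ge0 _)|exact: ler0n].
  have : V * (kk t2 + eps + eta) <= V * 2.
    apply: ler_wpM2l => //; have : q ^+ 2 <= 1 by rewrite exprn_ile1 ?(ltW q0) // (le_trans q10) //; clear; lra.
    by move: kk21 epseta; clear; lra.
  by clear; lra.
have th0 : 0 < r^-1 ^+ 12 by rewrite exprn_gt0 // invr_gt0.
have PG8 : prR P (X @^-1` ~` G) <= 8^-1.
  by apply: le_trans PG _; rewrite lef_pV2 ?posrE ?mulr_gt0 //; move: r64; clear; lra.
rewrite -/S in heps.
have g1' : 4^-1 <= (1 - q ^+ 2) * kk (s a1) - eps - eta by move: g1; rewrite /kk opprD addrA.
have g3' : 4^-1 <= (1 - q ^+ 2) * kk (s a3) - eps - eta by move: g3; rewrite /kk opprD addrA.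
have [gs [p1 p3 p2]] := gauss_iterate rX lc cG n0 r1 H1 rH nr GM PG8 hB (cA a1) (AG a1) (cA a3) (AG a3)
  (hk a1 a10) (hk a3 a30) hk2 kk20 heps eta0 hb hVb hV hz th0 P1 P3 g1' g3' (leqnn k).
have ge4 (c : R) : 4^-1 <= c -> 4^-1 ^+ k <= c ^+ k.
  by move=> hc; rewrite lerXn2r ?nnegrE //; move: hc; clear; lra.
have I1 : expR (- I%:R) <= 2^-1 * \int[P]_w gdens (A a1) H (s a1) gs (X w).
  apply: le_trans hI _; apply: ler_wpM2l; first by rewrite invr_ge0.
  apply: le_trans p1.
  by apply: ler_wpM2r (ge4 _ g1'); exact: ltW.
have I3 : expR (- I%:R) <= 2^-1 * \int[P]_w gdens (A a3) H (s a3) gs (X w).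
  apply: le_trans hI _; apply: ler_wpM2l; first by rewrite invr_ge0.
  apply: le_trans p3.
  by apply: ler_wpM2r (ge4 _ g3'); exact: ltW.
have fin := gdens_midpoint rX lc cG (cA a1) (cA a3) (AG a1) (AG a3) mG H0 I1 I3.
rewrite -/t2 in fin.
set b1 := _ - eps - eta in g1' p1; set b3 := _ - eps - eta in g3' p3.
have b10 : 0 <= b1 by move: g1'; clear; lra.
have b30 : 0 <= b3 by move: g3'; clear; lra.
set b2 := kk t2 + eps + eta in p2.
have b20 : 0 < b2.
  by apply: lt_le_trans eta0 _; rewrite /b2 lerDr addr_ge0.
have prod : b2 ^+ 2 * (1 + q ^+ 2) <= b1 * b3.
  by move: g2; rewrite -k2E /b1 /b2 /b3 /kk !opprD !addrA.
have th' := ltW th0.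
have m13 : b1 ^+ k * r^-1 ^+ 12 * (b3 ^+ k * r^-1 ^+ 12) <=
    (2 * I%:R) ^+ 2 * expR 2 * (b2 ^+ k) ^+ 2.
  apply: (@le_trans _ _ ((\int[P]_w gdens (A a1) H (s a1) gs (X w)) * (\int[P]_w gdens (A a3) H (s a3) gs (X w)))).
    by apply: ler_pM p1 p3; apply: mulr_ge0 (exprn_ge0 _ _) th'.
  apply: le_trans fin _; apply: ler_wpM2l; first by rewrite mulr_ge0 ?expR_ge0 // sqr_ge0.
  apply: lerXn2r (p2); rewrite nnegrE; last exact: exprn_ge0 (ltW b20).
  rewrite -(Rint_cst P 0); apply: Rint_le => [||w']; [exact: bmf_cst|exact: bmf_gdens|].
  by case/andP: (gdens_ge0_le1 G t2 gs (X w') H0).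
move: m13; rewrite mulrACA -exprMn -expr2 => m13.
have m2 : (b2 ^+ 2 * (1 + q ^+ 2)) ^+ k <= (b1 * b3) ^+ k.
  apply: lerXn2r (prod); rewrite nnegrE; last exact: mulr_ge0.
  exact: mulr_ge0 (sqr_ge0 _) (addr_ge0 ler01 (sqr_ge0 q)).
have B0 : 0 < (b2 ^+ k) ^+ 2 by rewrite !exprn_gt0.
have : (1 + q ^+ 2) ^+ k * (r^-1 ^+ 12) ^+ 2 <= (2 * I%:R) ^+ 2 * expR 2.
  rewrite -(@ler_pM2r _ ((b2 ^+ k) ^+ 2)) //; apply: le_trans m13.
  rewrite mulrAC; apply: ler_wpM2r; first exact: sqr_ge0.
  suff -> : (1 + q ^+ 2) ^+ k * (b2 ^+ k) ^+ 2 = (b2 ^+ 2 * (1 + q ^+ 2)) ^+ k by exact: m2.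
  by rewrite exprMn (exprAC b2) mulrC.
by rewrite leNgt hfin.
Qed.

(** * Numerical parameters as powers of two *)

Lemma mul_exp2_half (R : realType) (a b : nat) : (a <= b)%N ->
  2 ^+ a * 2^-1 ^+ b = 2^-1 ^+ (b - a) :> R.
Proof.
by move=> ab; rewrite -{1}(subnKC ab) exprD mulrA -exprMn divff // expr1n mul1r.
Qed.

Lemma bernoulli_ge (R : realType) (x : R) (n : nat) : 0 <= x -> 1 + n%:R * x <= (1 + x) ^+ n.
Proof.
move=> x0; elim: n => [|n IH]; first by rewrite mul0r addr0 expr0.
rewrite exprS -natr1; have : (1 + x) * (1 + n%:R * x) <= (1 + x) * (1 + x) ^+ n.
  by apply: ler_wpM2l => //; exact: addr_ge0.
have : 0 <= n%:R * (x * x) by rewrite !mulr_ge0.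
by clear IH; lra.
Qed.

(* The parameters: n = r^40 vectors, k = r^8 Gaussian factors, probabilities at least r^-12. *)
Lemma dyadic_contradiction (R : realType) m (Omega : measurableType m) (P : probability Omega R)
    d (X : Omega -> 'rV[R]_d) (l n : nat) (v : 'I_n -> 'rV[R]_d) (G B : set 'rV[R]_d) (r : R) :
  random_vector X -> log_concave P X -> (100 <= l)%N -> r = 2 ^+ l -> n = (2 ^ (40 * l))%N ->
  closed G -> closed B -> B `<=` G ->
  (forall x y, G x -> G y -> G (2^-1 *: x + 2^-1 *: y)) ->
  (forall x, G x -> forall i, `|inner (v i) x| <= 2 * r) ->
  (forall x, B x -> forall i, `|inner (v i) x| <= 2^-1) ->
  3 / 4 <= prR P (X @^-1` B) ->
  prR P (X @^-1` ~` G) <= (2 * r)^-1 ->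
  (forall i, r^-1 <= prR P [set w | 1 <= `|inner (v i) (X w)|]) ->
  (forall i j, i != j -> `|\int[P]_w ((inner (v i) (X w) * \1_(X @^-1` G) w)
     * (inner (v j) (X w) * \1_(X @^-1` G) w))| <= n%:R^-1) ->
  False.
Proof.
move=> rX lc l100 rE nE cG cB BG mG GM Bh PB PG PV hB.
have nR : n%:R = 2 ^+ (40 * l) :> R by rewrite nE natrX.
have nV : n%:R^-1 = 2^-1 ^+ (40 * l) :> R by rewrite nR exprVn.
have n0 : (0 < n)%N by rewrite nE expn_gt0.
have rV : r^-1 = 2^-1 ^+ l by rewrite rE exprVn.
have half01 : 0 <= (2^-1 : R) <= 1 by clear; lra.
have /andP[half0 half1] := half01.
have pos2 a : 0 < 2 ^+ a :> R by rewrite exprn_gt0.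
have le2 a c : (a <= c)%N -> 2 ^+ a <= 2 ^+ c :> R.
  by move=> ac; rewrite ler_eXn2l //; clear; lra.
have leh a c : (a <= c)%N -> 2^-1 ^+ c <= 2^-1 ^+ a :> R by move=> ac; exact: ler_wiXn2l.
have dbl a : 2 ^+ a + 2 ^+ a = 2 ^+ a.+1 :> R by rewrite exprS; move: (2 ^+ a) => z; clear; lra.
pose k := (2 ^ (8 * l))%N.
have kbig : (54 * l.+1 <= k)%N.
  have h7 : (64 * l.+1 <= 2 ^ (6 + l))%N by rewrite expnD; apply: leq_mul => //; exact: ltn_expl.
  apply: (@leq_trans (64 * l.+1)); first by rewrite leq_mul2r orbT.
  by apply: leq_trans h7 _; rewrite leq_exp2l //; clear -l100; lia.
have K0big : (64 * l.+1 <= 2 ^ (2 * l - 28))%N.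
  have h7 : (64 * l.+1 <= 2 ^ (6 + l))%N by rewrite expnD; apply: leq_mul => //; exact: ltn_expl.
  by apply: leq_trans h7 _; rewrite leq_exp2l //; clear -l100; lia.
have sqH : Num.sqrt (4 * r ^+ 2) = 2 ^+ l.+1.
  rewrite (_ : 4 * r ^+ 2 = (2 ^+ l.+1) ^+ 2); last by rewrite rE (exprS 2 l) exprMn; congr (_ * _); clear; lra.
  by rewrite sqrtr_sqr ger0_norm ?(ltW (pos2 _)).
(* Half of q^2, so that the central limit error and the selection tolerance share q^2 equally. *)
pose eta : R := 2^-1 ^+ (6 * l + 29).
have etaq : eta + eta = (2^-1 ^+ (3 * l + 14)) ^+ 2 :> R.
  rewrite /eta -exprM (_ : (6 * l + 29 = ((3 * l + 14) * 2).+1)%N); last by clear -l100; lia.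
  by rewrite exprS; clear; lra.
have c144 : 144 <= 2 ^+ 8 :> R by clear; lra.
have c392 : 392 <= 2 ^+ 9 :> R by clear; lra.
have c15 : 2^-1 ^+ 4 <= 10^-1 :> R by clear; lra.
(* The width w = 1 / (4096 r) is dictated by the midpoint drop; dividing by H = 4 r^2 gives q =
   2^-(3l + 14), and 1 / q is the number of windows. The choice 2^i0 = I = 4k makes the tails
   3^(-4k) and e^(-4k) beat the mass 4^(-k) r^(-12). *)
apply: (@core_contradiction R m Omega P d X n v r (4 * r ^+ 2) (2^-1 ^+ (l + 12))
  (2^-1 ^+ (3 * l + 14)) eta eta (32 * 2 ^+ (8 * l + 2) * r + 1)
  ((2 * (32 * 2 ^+ (8 * l + 2) * r + 1) ^+ 2 + 392) / n%:R)
  (2 ^ (3 * l + 14))%N (8 * l + 2)%N k (4 * k)%N G B rX lc n0 _ erefl _ _ _ _ _ _ _ _ _ _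
  erefl erefl _ _ _ _ cG cB BG mG GM Bh PB PG PV hB).
- rewrite rE (_ : 64 = 2 ^+ 6); first by apply: le2; clear -l100; lia.
  by clear; lra.
- by rewrite exprn_gt0 // invr_gt0.
- rewrite invfM rV (addnC l) exprD mulrA; congr (_ * _).
  by clear; lra.
- rewrite natrX rE (_ : (3 * l + 14 = (2 * l + 2) + (l + 12))%N); last by clear; lia.
  rewrite exprD -mulrA mul_exp2_half // subnn mulr1 exprD (mulnC 2) exprM mulrC.
  by congr (_ * _); clear; lra.
- rewrite -natr1 natrX rE -exprM; apply: (@le_trans _ _ (2 ^+ (3 * l + 14) + 2 ^+ (3 * l + 14))).
    by rewrite lerD2l exprn_ege1 //; clear; lra.
  by rewrite dbl; apply: le2; clear -l100; lia.
- have -> : 4 * r ^+ 2 = (2 ^+ l.+1) ^+ 2 by rewrite rE (exprS 2 l) exprMn; congr (_ * _); clear; lra.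
  rewrite -exprM -exprVn (_ : (3 * l + 14 = (l + 12) + l.+1 * 2)%N); last by clear -l100; lia.
  by rewrite exprD.
- by apply: le_trans c15; apply: leh; clear -l100; lia.
- rewrite nR rE -exprM (_ : 8 = 2 ^+ 3); last by clear; lra.
  by rewrite -exprD; apply: le2; clear -l100; lia.
- have key : 2 ^+ l.+1 * (2 ^+ 8 * 2 ^+ (l * 4) * 2^-1 ^+ (40 * l)) <= 2^-1 ^+ (6 * l + 29) :> R.
    have -> : 2 ^+ l.+1 * (2 ^+ 8 * 2 ^+ (l * 4) * 2^-1 ^+ (40 * l)) = 2 ^+ (l.+1 + 8 + l * 4) * 2^-1 ^+ (40 * l) :> R.
      by rewrite !exprD !mulrA.
    rewrite mul_exp2_half; last by clear -l100; lia.
    by apply: leh; clear -l100; lia.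
  apply: le_trans key; rewrite sqH nV rE -exprM; apply: ler_wpM2l; first exact: ltW.
  apply: ler_wpM2r; first exact: exprn_ge0.
  by apply: ler_wpM2r => //; exact: ltW.
- by rewrite exprn_gt0 // invr_gt0.
- by rewrite etaq.
- rewrite nV rE.
  have bE : 32 * 2 ^+ (8 * l + 2) * 2 ^+ l = 2 ^+ (9 * l + 7) :> R.
    rewrite (_ : 32 = 2 ^+ 5); last by clear; lra.
    by rewrite -!exprD; congr (_ ^+ _); clear -l100; lia.
  have b2 : (32 * 2 ^+ (8 * l + 2) * 2 ^+ l + 1) ^+ 2 <= 2 ^+ (18 * l + 16) :> R.
    rewrite (_ : (18 * l + 16 = (9 * l + 8) * 2)%N); last by clear -l100; lia.
    rewrite exprM; apply: lerXn2r; rewrite ?nnegrE ?(ltW (pos2 _)) //.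
    by rewrite bE (addnS (9 * l) 7) -dbl lerD2l exprn_ege1 //; clear; lra.
  (* This fixes the size of [n]: the left side bounds 4 V, the right side is eta^3, and 22 l - 20 >
     18 l + 87. *)
  have key : 2 ^+ (18 * l + 20) * 2^-1 ^+ (40 * l) < (2^-1 ^+ (6 * l + 29)) ^+ 3 :> R.
    rewrite mul_exp2_half; last by clear -l100; lia.
    by rewrite -exprM ltr_iXn2l; [clear -l100; lia|clear; lra|clear; lra].
  apply: le_lt_trans key; rewrite mulrA; apply: ler_wpM2r; first exact: exprn_ge0.
  have h9 : 2 ^+ 9 <= 2 ^+ (18 * l + 16) :> R by apply: le2; clear -l100; lia.
  rewrite (_ : (18 * l + 20 = 4 + (18 * l + 16))%N); last by clear -l100; lia.
  by rewrite (exprD 2 4); move: b2 h9 c392; clear; lra.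
- rewrite nR rV rE -!exprM.
  rewrite (_ : (2 ^ (8 * l + 2) = 4 * k)%N); last by rewrite /k expnD mulnC.
  have key : 2 * 2 ^+ l * 2 ^+ (40 * l) * 2^-1 ^+ (4 * k) <= 4^-1 ^+ k * 2^-1 ^+ (l * 12) :> R.
    rewrite -exprS -exprD mul_exp2_half; last by clear -kbig; lia.
    rewrite (_ : 4^-1 = 2^-1 ^+ 2); last by clear; lra.
    by rewrite -exprM -exprD; apply: leh; clear -kbig; lia.
  apply: le_trans key; apply: ler_wpM2l; first by rewrite !mulr_ge0 // ltW.
  by apply: lerXn2r; rewrite ?nnegrE ?invr_ge0 // lef_pV2 ?posrE //; clear; lra.
- rewrite rV -!exprM.
  have e1 : expR (- (4 * k)%:R) <= 2^-1 ^+ (4 * k) :> R.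
    rewrite -mulN1r expRM_natr; apply: lerXn2r; rewrite ?nnegrE ?expR_ge0 ?invr_ge0 //.
    by rewrite expRN lef_pV2 ?posrE ?expR_gt0 //; have := expR_ge1Dx (1 : R); clear; lra.
  apply: le_trans e1 _.
  rewrite (_ : 4^-1 = 2^-1 ^+ 2); last by clear; lra.
  by rewrite -exprM -exprD -exprS; apply: leh; clear -kbig; lia.
- have e2 : expR 2 <= 2 ^+ 4 :> R.
    have [e3 _] := expRN1_half R.
    have : expR 2 * (expR (- 2^-1) ^+ 2) ^+ 2 = 1 :> R.
      rewrite -!expRM_natl -expRD (_ : 2 + _ = 0) ?expR0 //; clear; lra.
    have : expR 2 * 3^-1 ^+ 2 <= expR 2 * (expR (- 2^-1) ^+ 2) ^+ 2 :> R.
      apply: ler_wpM2l; first exact: expR_ge0.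
      by apply: lerXn2r e3; rewrite nnegrE ?exprn_ge0 ?expR_ge0 // invr_ge0.
    by move=> h1 h2; move: h1; rewrite h2; clear; lra.
  have q2 : (2^-1 ^+ (3 * l + 14)) ^+ 2 = 2^-1 ^+ (6 * l + 28) :> R.
    by rewrite -exprM; congr (_ ^+ _); clear -l100; lia.
  have kN : k = (2 ^ (6 * l + 28) * 2 ^ (2 * l - 28))%N.
    by rewrite /k -expnD; congr (2 ^ _)%N; clear -l100; lia.
  (* By Bernoulli every block of 1 / q^2 = 2^(6l + 28) factors at least doubles the product, and [k]
     contains 2^(2l - 28) blocks. *)
  have K0 : 2 ^+ (2 ^ (2 * l - 28)) <= (1 + (2^-1 ^+ (3 * l + 14)) ^+ 2) ^+ k :> R.
    rewrite q2 kN exprM; apply: lerXn2r; rewrite ?nnegrE //.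
    apply: le_trans (bernoulli_ge _ (exprn_ge0 _ half0)).
    rewrite natrX mul_exp2_half // subnn expr0; clear; lra.
  have key : 2 ^+ (40 * l + 10) * 2^-1 ^+ (l * 12 * 2) <
      (1 + (2^-1 ^+ (3 * l + 14)) ^+ 2) ^+ k * 2^-1 ^+ (l * 12 * 2) :> R.
    rewrite ltr_pM2r; last by rewrite exprn_gt0 // invr_gt0.
    apply: lt_le_trans K0; rewrite ltr_eXn2l; last by clear; lra.
    by apply: leq_trans K0big; clear; lia.
  have -> : (r^-1 ^+ 12) ^+ 2 = 2^-1 ^+ (l * 12 * 2) by rewrite rV !exprM.
  apply: le_lt_trans key.
  rewrite (_ : (40 * l + 10 = (3 + 8 * l) * 2 + 4 + l * 12 * 2)%N); last by clear; lia.
  rewrite exprD -mulrA mul_exp2_half // subnn mulr1 exprD.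
  have kR : 2 * (4 * k)%:R = 2 ^+ (3 + 8 * l) :> R.
    by rewrite natrM /k natrX exprD mulrA; congr (_ * _); clear; lra.
  by rewrite kR -exprM; apply: ler_wpM2l e2; exact: ltW.
Qed.

(** * Selection of almost orthogonal differences *)

Lemma card_fibre (T : finType) (q s : nat) (A : {set T}) (h : T -> 'I_q) :
  (0 < s)%N -> (q * s <= #|A|)%N -> (0 < #|A|)%N -> exists c, (s <= #|[set a in A | h a == c]|)%N.
Proof.
move=> s0 qs A0; apply: contrapT => /forallNP H.
have q0 : (0 < q)%N by move: A0; rewrite card_gt0 => /set0Pn[a _]; case: q h {qs H} => // h; case: (h a).
suff : (#|A| <= q * s.-1)%N by move: qs; case: s s0 {H} => //= s _; nia.
rewrite -sum1_card (partition_big h predT) //=.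
rewrite -[X in (_ <= X * _)%N]card_ord -sum_nat_const; apply: leq_sum => c _.
rewrite sum1dep_card; have /negP := H c; rewrite -ltnNge => h1.
by rewrite -ltnS prednK.
Qed.

(** Take the first difference [v] from two points of [A], and sort [A] by the pairing of f a - f a0
    with [v], whose range of length 2 M is cut into at most [q] pieces of length 1 / n. Differences
    inside one piece pair with [v] by at most 1 / n, so the recursion continues in a large piece;
    the factor 2 guarantees two points at every stage. *)
Lemma select_almost_orthogonal (R : realType) (V : zmodType) (N n q : nat) (f : 'I_N -> V)
    (B : V -> V -> R) (M : R) : (0 < n)%N -> 0 <= M -> 2 * M * n%:R < q%:R ->
  (forall a b a0 c e, B (f a - f b) (f c - f e) =
     B (f a - f a0) (f c - f e) - B (f b - f a0) (f c - f e)) ->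
  (forall a b c e, `|B (f a - f b) (f c - f e)| <= M) ->
  forall k (A : {set 'I_N}), (2 * q ^ k <= #|A|)%N -> exists vs : seq V,
    [/\ size vs = k,
     forall v, v \in vs -> exists a b, [/\ a \in A, b \in A, a != b & v = f a - f b] &
     pairwise (fun v v' => `|B v' v| <= n%:R^-1) vs].
Proof.
move=> n0 M0 qM BB BM; elim=> [|k IH] A hA; first by exists [::].
have q0 : (0 < q)%N.
  by rewrite -(ltr_nat R); apply: le_lt_trans qM; rewrite !mulr_ge0.
have A2 : (1 < #|A|)%N.
  by apply: leq_trans hA; rewrite -[2%N]muln1 leq_mul // expn_gt0 q0.
have /card_gt1P[a0 [a1 [a0A a1A a01]]] := A2.
pose v := f a1 - f a0.
have n0' : 0 < n%:R :> R by rewrite ltr0n.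
pose g a := n%:R * (B (f a - f a0) v + M).
have g0 a : 0 <= g a.
  by rewrite mulr_ge0 //; have := BM a a0 a1 a0; rewrite ler_norml -/v; lra.
have gq a : (Num.truncn (g a) < q)%N.
  rewrite truncn_lt_nat //; apply: le_lt_trans qM.
  have := BM a a0 a1 a0; rewrite ler_norml -/v /g => /andP[_ h].
  by rewrite mulrC ler_pM2r //; lra.
have s0 : (0 < 2 * q ^ k)%N by rewrite muln_gt0 expn_gt0 q0.
have [||c hc] := @card_fibre _ q (2 * q ^ k)%N A (fun a => Ordinal (gq a)) s0.
- by move: hA; rewrite expnS mulnCA.
- exact: ltnW.
have [vs [sz hvs pw]] := IH _ hc.
exists (v :: vs); split => /=; first by rewrite sz.
  move=> u; rewrite inE => /orP[/eqP->|/hvs [a [b [aA bA ab ->]]]].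
    by exists a1, a0; rewrite eq_sym.
  by exists a, b; move: aA bA; rewrite !inE => /andP[-> _] /andP[-> _].
rewrite pw andbT; apply/allP => u /hvs [a [b [aA bA ab ->]]].
move: aA bA; rewrite !inE => /andP[_ /eqP/(congr1 val)/= ha] /andP[_ /eqP/(congr1 val)/= hb].
have -> : B (f a - f b) v = (g a - g b) / n%:R.
  by rewrite /v (BB a b a0) -/v /g; field; rewrite gt_eqF.
rewrite normrM (@ger0_norm _ n%:R^-1) ?invr_ge0 ?(ltW n0') // ler_piMl ?invr_ge0 ?(ltW n0') //.
have /andP[a1' a2'] := truncn_itv (g0 a); have /andP[b1 b2] := truncn_itv (g0 b).
move: a1' a2' b1 b2; rewrite ha hb -natr1 => *.
by rewrite ler_norml; apply/andP; split; lra.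
Qed.

(* No measurability is assumed: sup_diff over an uncountable T need not be measurable. *)
Lemma le_integral_ge0 d (T : measurableType d) (R : realType)
    (mu : {measure set T -> \bar R}) (f g : T -> \bar R) :
  (forall x, 0 <= f x)%E -> (forall x, f x <= g x)%E ->
  (\int[mu]_x f x <= \int[mu]_x g x)%E.
Proof.
move=> f0 fg; have g0 x : (0 <= g x)%E by exact: le_trans (f0 x) (fg x).
rewrite !ge0_integralTE //; apply: le_ereal_sup => _ [h hf <-].
by exists h => // x; exact: le_trans (hf x) (fg x).
Qed.

(** A continuous seminorm: its sublevel sets are closed and stable under midpoints, and supply both
    [G] and [B] before the vectors [v] have been selected. *)
Definition maxinner (R : realType) (d : nat) (us : seq 'rV[R]_d) (x : 'rV[R]_d) : R :=
  \big[Num.max/0]_(u <- us) `|inner u x|.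

Lemma maxinner_le (R : realType) (d : nat) (us : seq 'rV[R]_d) (x : 'rV[R]_d) (c : R) : 0 <= c ->
  reflect (forall u, u \in us -> `|inner u x| <= c) (maxinner us x <= c).
Proof.
move=> c0; apply: (iffP idP) => [h u uus|h].
  apply: le_trans h; elim: us uus => // u' us IH; rewrite inE /maxinner big_cons le_max.
  by move=> /orP[/eqP->|/IH ->]; rewrite ?lexx ?orbT.
by rewrite /maxinner big_seq; apply: bigmax_le.
Qed.

Lemma maxinner_ge0 (R : realType) (d : nat) (us : seq 'rV[R]_d) (x : 'rV[R]_d) : 0 <= maxinner us x.
Proof.
rewrite /maxinner; elim/big_rec: _ => // u y _ y0; by rewrite le_max y0 orbT.
Qed.

Lemma norm_inner_maxinner (R : realType) (d : nat) (us : seq 'rV[R]_d) u x :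
  u \in us -> `|inner u x| <= maxinner us x.
Proof. by move: u; apply/maxinner_le => //; exact: maxinner_ge0. Qed.

Lemma maxinner_attained (R : realType) (d : nat) (us : seq 'rV[R]_d) (x : 'rV[R]_d) (c : R) :
  0 < c -> c <= maxinner us x -> exists2 u, u \in us & c <= `|inner u x|.
Proof.
move=> c0 h; apply: contrapT => H; move: h; apply/negP; rewrite -ltNge /maxinner big_seq.
by apply: bigmax_lt => // u uus; rewrite ltNge; apply/negP => h; apply: H; exists u.
Qed.

Lemma continuous_maxinner (R : realType) (d : nat) (us : seq 'rV[R]_d) : continuous (maxinner us).
Proof.
move=> x; rewrite /maxinner; elim: us => [|u us IH].
  by under eq_fun do rewrite big_nil; exact: cst_continuous.
under eq_fun do rewrite big_cons.
apply: (@continuous_max _ _ (fun x => `|inner u x|)); last exact: IH.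
by apply: (@continuous_comp _ _ _ (inner u) Num.norm); [exact: continuous_inner|exact: norm_continuous].
Qed.

Lemma maxinner_midpoint_le (R : realType) (d : nat) (us : seq 'rV[R]_d) (x y : 'rV[R]_d) :
  maxinner us (2^-1 *: x + 2^-1 *: y) <= 2^-1 * maxinner us x + 2^-1 * maxinner us y.
Proof.
have h0 := maxinner_ge0 us; apply/maxinner_le => [|u uus].
  by rewrite addr_ge0 // mulr_ge0 // invr_ge0.
rewrite innerDr !innerZr; apply: le_trans (ler_normD _ _) _.
by rewrite !normrM ger0_norm ?invr_ge0 //; apply: lerD; rewrite ler_pM2l ?invr_gt0 //;
  exact: norm_inner_maxinner.
Qed.

(** The condition on [N] in [log_concave_tail]; it is the triangle inequality for x as twice the
    midpoint minus y. *)
Lemma maxinner_midpoint_ge (R : realType) (d : nat) (us : seq 'rV[R]_d) (x y : 'rV[R]_d) :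
  2^-1 * maxinner us x - 2^-1 * maxinner us y <= maxinner us (2^-1 *: x + 2^-1 *: y).
Proof.
have h0 := maxinner_ge0 us; set M := maxinner us (_ + _).
suff : maxinner us x <= 2 * M + maxinner us y by clear h0; lra.
apply/maxinner_le => [|u uus]; first by rewrite addr_ge0 ?mulr_ge0 //; exact: h0.
have hy := norm_inner_maxinner y uus.
have : `|inner u (2^-1 *: x + 2^-1 *: y)| <= M by exact: norm_inner_maxinner.
rewrite innerDr !innerZr => hM.
have := ler_normD (2 * (2^-1 * inner u x + 2^-1 * inner u y)) (- inner u y).
rewrite normrN normrM ger0_norm //.
rewrite (_ : 2 * (2^-1 * inner u x + 2^-1 * inner u y) - inner u y = inner u x); last by field.
by move: hy hM; clear; lra.
Qed.

(** Truncation to [G] has to precede the selection, because the bilinear form that is pigeonholed is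
    the covariance on [G], bounded there by (2 r)^2. *)
Lemma log_concave_many_points (R : realType) m (Omega : measurableType m) (P : probability Omega R)
    d (X : Omega -> 'rV[R]_d) (l N : nat) (f : 'I_N -> 'rV[R]_d) :
  random_vector X -> log_concave P X -> (100 <= l)%N -> (2 ^ (2 ^ (41 * l)) <= N)%N ->
  let us := [seq f ij.1 - f ij.2 | ij <- enum {: 'I_N * 'I_N}] in
  prR P [set w | 2^-1 <= maxinner us (X w)] <= 4^-1 ->
  (forall i j, i != j -> 2^-1 ^+ l <= prR P [set w | 1 <= `|inner (f i - f j) (X w)|]) ->
  False.
Proof.
move=> rX lc l100 hN us Phalf PV.
have usin i j : f i - f j \in us by apply/mapP; exists (i, j); rewrite ?mem_enum.
pose r : R := 2 ^+ l; have r1 : 1 <= r by rewrite exprn_ege1 //; clear; lra.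
have r0 : 0 < r by exact: lt_le_trans ltr01 r1.
have cN := @continuous_maxinner R d us.
pose G := [set x | maxinner us x <= 2 * r].
pose B := [set x | maxinner us x <= 2^-1].
have cG : closed G by exact: closed_le_fun.
have cB : closed B by exact: closed_le_fun.
have half2 : 2^-1 <= 2 * r by move: r1; clear; lra.
have BG : B `<=` G by rewrite /B /G => x /= h; exact: le_trans h half2.
have mG x y : G x -> G y -> G (2^-1 *: x + 2^-1 *: y).
  rewrite /G /= => hx hy; apply: le_trans (maxinner_midpoint_le _ _ _) _; by move: hx hy; clear; lra.
have mge c : measurable [set w | c <= maxinner us (X w)].
  have cl : closed [set x | c <= maxinner us x] by exact: closed_ge_fun.
  exact: (random_vector_closed rX cl).
have mB : measurable (X @^-1` B) by exact: random_vector_closed.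
have mXG : measurable (X @^-1` G) by exact: random_vector_closed.
have PB : 3 / 4 <= prR P (X @^-1` B).
  apply: (@le_trans _ _ (prR P (~` [set w | 2^-1 <= maxinner us (X w)]))).
    by rewrite prR_setC //; move: Phalf; clear; lra.
  apply: prR_le => //; first exact: measurableC.
  by move=> w /= /negP; rewrite -ltNge => /ltW.
(* The tail bound at index l + 1 has threshold (2^(l+2) - 1) / 2 < 2 r and probability 3^-(2^(l+1)),
   far below 1 / (2 r). *)
have PG : prR P (X @^-1` ~` G) <= (2 * r)^-1.
  have h0 : 0 < 2^-1 :> R by rewrite invr_gt0.
  have := log_concave_tail rX lc cN h0 (lexx _) (maxinner_midpoint_ge us) Phalf l.+1.
  rewrite (_ : 4 / 3 * 4^-1 = 3^-1); last by field.
  move=> tail; apply: (@le_trans _ _ (3^-1 ^+ (2 ^ l.+1))).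
    apply: le_trans tail; apply: prR_le => //.
      by rewrite preimage_setC; exact: measurableC.
    move=> w /= /negP; rewrite -ltNge => h; apply: le_trans (ltW h).
    by rewrite /r !exprS; move: (2 ^+ l) => z; clear; lra.
  apply: (@le_trans _ _ (2^-1 ^+ (2 ^ l.+1))).
    by apply: lerXn2r; rewrite ?nnegrE ?invr_ge0 // lef_pV2 ?posrE //; clear; lra.
  rewrite /r -exprS -exprVn; apply: ler_wiXn2l; rewrite ?invr_ge0 ?invf_le1 //; first by clear; lra.
  exact: ltnW (ltn_expl _ _).
(* [q] is twice 2 (2 r)^2 n. The 2 q^n points needed are at most 2^(2^(41 l)), because 42 l + 5 <=
   2^l. *)
pose n := (2 ^ (40 * l))%N; pose q := (2 ^ (42 * l + 4))%N.
have n0 : (0 < n)%N by rewrite expn_gt0.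
pose bil (u v : 'rV[R]_d) := \int[P]_w ((inner u (X w) * \1_(X @^-1` G) w)
     * (inner v (X w) * \1_(X @^-1` G) w)).
have GU u w : u \in us -> \1_(X @^-1` G) w != 0 :> R -> `|inner u (X w)| <= 2 * r.
  move=> uus; rewrite indicE; have [h _|h] := boolP (w \in _); last by rewrite eqxx.
  apply: le_trans (norm_inner_maxinner _ uus) _; by move: h; rewrite inE.
have bU u : u \in us -> bmf (fun w => inner u (X w) * \1_(X @^-1` G) w).
  move=> uus; apply: (bmf_inner_supported (c := 2 * r)) => //; first exact: bmf_indic.
  by move=> w; exact: GU.
have UM u w : u \in us -> `|inner u (X w) * \1_(X @^-1` G) w| <= 2 * r.
  move=> uus; have := GU u w uus; rewrite indicE; case: (_ \in _) => [h|_].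
    by rewrite mulr1; apply: h; exact: oner_neq0.
  by rewrite mulr0 normr0 mulr_ge0 // ltW.
have bilB a b a0 c e : bil (f a - f b) (f c - f e) =
    bil (f a - f a0) (f c - f e) - bil (f b - f a0) (f c - f e).
  rewrite /bil -RintB; [|by apply: bmfM; exact: bU|by apply: bmfM; exact: bU].
  by apply: eq_Rintegral => w _; rewrite !innerBl; ring.
have bilM a b c e : `|bil (f a - f b) (f c - f e)| <= (2 * r) ^+ 2.
  have bb : bmf (fun w => inner (f a - f b) (X w) * \1_(X @^-1` G) w *
    (inner (f c - f e) (X w) * \1_(X @^-1` G) w)) by apply: bmfM; exact: bU.
  apply: le_trans (Rint_norm P bb) _; rewrite -[X in _ <= X](Rint_cst P).
  apply: Rint_le => [||w]; [exact: bmf_norm|exact: bmf_cst|].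
  by rewrite normrM expr2; apply: ler_pM => //; exact: UM.
have qM : 2 * (2 * r) ^+ 2 * n%:R < q%:R.
  rewrite /q /n /r !natrX -exprS -exprM -exprS -exprD ltr_eXn2l; last by clear; lra.
  by clear; lia.
have M0 : 0 <= (2 * r) ^+ 2 by exact: sqr_ge0.
have hA : (2 * q ^ n <= #|[set: 'I_N]%SET|)%N.
  rewrite cardsT card_ord; apply: leq_trans hN.
  rewrite /q -expnM -expnS leq_exp2l // /n.
  have h41 : (2 ^ (41 * l) = 2 ^ l * 2 ^ (40 * l))%N.
    by rewrite -expnD; congr (2 ^ _)%N; clear; lia.
  rewrite h41; apply: (@leq_trans ((42 * l + 5) * 2 ^ (40 * l))%N).
    by rewrite ltn_pmul2r ?expn_gt0 //; clear; lia.
  rewrite leq_mul2r; apply/orP; right.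
  have h7 : ((l - 7).+1 <= 2 ^ (l - 7))%N by exact: ltn_expl.
  rewrite -[X in (2 ^ X)%N](subnKC (_ : 7 <= l)%N); last by apply: leq_trans l100.
  rewrite expnD; apply: (@leq_trans (128 * (l - 7).+1)%N); last by rewrite leq_mul2l h7 orbT.
  by clear -l100; lia.
have [vs [sz hvs pw]] := @select_almost_orthogonal R _ N n q f bil _ n0 M0 qM bilB bilM n [set: 'I_N]%SET hA.
pose v (i : 'I_n) := nth 0 vs i.
have vin i : v i \in vs by apply: mem_nth; rewrite sz.
have vus i : v i \in us by have [a [b [_ _ _ ->]]] := hvs _ (vin i); exact: usin.
apply: (@dyadic_contradiction R m Omega P d X l n v G B r) => //.
- by move=> x Gx i; apply: le_trans (norm_inner_maxinner _ (vus i)) _.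
- by move=> x Bx i; apply: le_trans (norm_inner_maxinner _ (vus i)) _.
- by move=> i; have [a [b [_ _ ab ->]]] := hvs _ (vin i); rewrite /r -exprVn; exact: PV.
move=> i j ij; rewrite -/(bil (v i) (v j)).
have bilC a b : bil a b = bil b a by apply: eq_Rintegral => w _; rewrite mulrC.
wlog lij : i j ij / (i < j)%N => [hw|].
  have [lij|lji|/val_inj eij] := ltngtP i j; first exact: hw.
    by rewrite bilC; apply: hw => //; rewrite eq_sym.
  by rewrite eij eqxx in ij.
have /(pairwiseP 0) h := pw.
by rewrite bilC; apply: (h i j) => //; rewrite inE sz.
Qed.

(** * From the supremum and the moments to dyadic scales *)

Lemma card_injection (T : pointedType) (S : set T) (N : nat) : (`I_N #<= S)%card ->
  exists g : 'I_N -> T, (forall i, S (g i)) /\ injective g.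
Proof.
move=> /pcard_leP[g]; exists (fun i : 'I_N => g i); split => [i|i j gij].
  by apply: (@funS _ _ _ _ g); exact: (ltn_ord i).
by apply: val_inj; apply: (@inj _ _ `I_N g) => //; rewrite inE; exact: ltn_ord.
Qed.

Lemma dyadic_scale (R : realType) (y : R) : 1 < y -> exists l : nat, y <= 2 ^+ l < 2 * y.
Proof.
move=> y1; have ex : exists l : nat, y <= 2 ^+ l.
  exists (Num.truncn y).+1; apply: (le_trans (ltW (truncnS_gt y))).
  by rewrite -natrX ler_nat ltnW // ltn_expl.
case: (ex_minnP ex) => -[|l] hl min; first by move: hl; rewrite expr0 leNgt y1.
exists l.+1; rewrite hl exprS ltr_pM2l // ltNge; apply/negP => /min.
by rewrite ltnn.
Qed.

(** The supremum runs over ordered pairs, so it dominates absolute values and is at least a/2 on the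
    event; Markov's inequality against an expectation below a/8 gives 1/4. *)
Lemma sup_diff_tail (R : realType) m (Omega : measurableType m) (P : probability Omega R)
    d (X : Omega -> 'rV[R]_d) (T : set 'rV[R]_d) (N : nat) (g : 'I_N -> 'rV[R]_d) (a : R) :
  random_vector X -> (0 < N)%N -> (forall i, T (g i)) -> 0 < a ->
  (\int[P]_w sup_diff T X w < (a / 8)%:E)%E ->
  prR P [set w | 2^-1 <= maxinner
    [seq a^-1 *: g ij.1 - a^-1 *: g ij.2 | ij <- enum {: 'I_N * 'I_N}] (X w)] <= 4^-1.
Proof.
move=> rX N0 Tg a0 hlt; set us := map _ _; set E := [set w | _].
have mE : measurable E.
  have cl : closed [set x | 2^-1 <= maxinner us x].
    by apply: closed_ge_fun; exact: continuous_maxinner.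
  exact: (random_vector_closed rX cl).
have supge w i j : ((inner (g i - g j) (X w))%:E <= sup_diff T X w)%E.
  by apply: ereal_sup_ubound; exists (g i) => //; exists (g j).
have low w : ((a / 2 * \1_E w)%:E <= sup_diff T X w)%E.
  rewrite indicE; have [h|h] := boolP (w \in E); last first.
    by rewrite mulr0; apply: le_trans (supge w (Ordinal N0) (Ordinal N0)); rewrite subrr inner0l.
  move: h; rewrite inE => /maxinner_attained[|u /mapP[[i j] _ ->] /=]; first by rewrite invr_gt0.
  rewrite -scalerBr innerZl normrM gtr0_norm ?invr_gt0 // mulrC ler_pdivlMr // => h.
  have {}h : a / 2 * 1 <= `|inner (g i - g j) (X w)| by rewrite mulr1 mulrC.
  have [y0|y0] := leP 0 (inner (g i - g j) (X w)).
    by apply: le_trans (supge w i j); rewrite lee_fin -(ger0_norm y0).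
  apply: le_trans (supge w j i); rewrite lee_fin -[g j - g i]opprB innerNl.
  by rewrite -(ltr0_norm y0).
have := le_lt_trans (le_integral_ge0 P (fun w => _) low) hlt.
have -> : (\int[P]_w (a / 2 * \1_E w)%:E = (a / 2 * prR P E)%:E)%E.
  have b : bmf (fun w => a / 2 * \1_E w) by apply: bmfZ; exact: bmf_indic.
  rewrite -(Rint_indic P mE) -RintZ; last exact: bmf_indic.
  by rewrite fineK //; apply: integrable_fin_num => //; exact: bmf_integrable.
rewrite lte_fin => /(_ _)/wrap[w|h]; first by rewrite lee_fin mulr_ge0 // divr_ge0 // ltW.
apply: ltW; rewrite -(@ltr_pM2l _ (a / 2)) ?divr_gt0 // (lt_le_trans h) //.
by clear; lra.
Qed.

Theorem theorem3p6 (R : realType) :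
  exists C : R, 0 < C /\
  forall (m : measure_display) (Omega : measurableType m)
    (P : probability Omega R) (d : nat) (X : Omega -> 'rV[R]_d)
    (p A : R) (T : set 'rV[R]_d),
    random_vector X -> log_concave P X ->
    1 <= p -> 0 < A ->
    (exists n : nat, expR (expR p) <= n%:R /\ (`I_n #<= T)%card) ->
    (forall t s, T t -> T s -> t <> s ->
       (A%:E <= 'N[P]_(p%:E)[(fun w => (inner (t - s) (X w))%:E)])%E) ->
    ((C^-1 * A)%:E <= \int[P]_w sup_diff T X w)%E.
Proof.
(* One factor 128 sets the scale 2^l of order e^(p/128). The other makes e^(-p/K) so much larger
   than 2^(-l) that the moment bound applies with delta = 2^(-l). *)
pose K : R := 128 * 128.
have KE : K = 128 * 128 by [].
have K1 : 1 <= K by rewrite KE; clear; lra.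
clearbody K; have K0 : 0 < K by exact: lt_le_trans ltr01 K1.
pose cM := 32 * K ^+ 2; have cM0 : 0 < cM by rewrite mulr_gt0 // exprn_gt0.
exists (16 * cM); split; first exact: mulr_gt0.
move=> m Omega P d X p A T rX lc p1 A0 [N [hN TN]] hT.
rewrite leNgt; apply/negP => hlt.
(* With this [a] the bound of [Lnorm_inner_le] equals A/2, contradicting the moment hypothesis, and
   A / C equals a/8, as [sup_diff_tail] wants. *)
pose a := A / (2 * cM); have a0 : 0 < a by rewrite divr_gt0 // mulr_gt0.
have aA : cM * a < A.
  by rewrite (_ : cM * a = A / 2); [move: A0; clear; lra|rewrite /a; field; rewrite gt_eqF].
have eh : 3^-1 <= expR (- 1) :> R /\ expR (- 1) <= 2^-1 :> R.
  split.
    have [e3 _] := expRN1_half R; apply: le_trans e3 _.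
    by rewrite -expRM_natl le_eqVlt; apply/orP; left; apply/eqP; congr expR; clear; lra.
  by rewrite expRN lef_pV2 ?posrE ?expR_gt0 //; have := expR_ge1Dx (1 : R); clear; lra.
have [e3 e2] := eh.
have e12 : 2 <= expR 1 :> R by have := expR_ge1Dx (1 : R); clear; lra.
have small t s delta : T t -> T s -> t <> s -> 0 <= delta <= 4^-1 ->
    4 / 3 * delta <= expR (- (p / K)) ->
    prR P [set w | a <= `|inner (t - s) (X w)|] <= delta -> False.
  move=> Tt Ts ts d01 dK hd.
  have := le_trans (hT t s Tt Ts ts) (Lnorm_inner_le rX lc K1 a0 p1 d01 dK hd).
  by rewrite lee_fin leNgt -/cM aA.
have [g [Tg ginj]] := card_injection TN.
have N2 : (1 < N)%N.
  rewrite -(ltr_nat R); apply: lt_le_trans hN; apply: lt_le_trans (expR_ge1Dx _).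
  by have := expR_ge1Dx p; move: p1; clear; lra.
have N0 : (0 < N)%N by exact: ltnW.
pose f i := a^-1 *: g i.
have Phalf : prR P [set w | 2^-1 <= maxinner
    [seq f ij.1 - f ij.2 | ij <- enum {: 'I_N * 'I_N}] (X w)] <= 4^-1.
  apply: (sup_diff_tail rX N0 Tg a0); move: hlt.
  rewrite (_ : (16 * cM)^-1 * A = a / 8) //.
  by rewrite /a; field; rewrite gt_eqF.
have fg i j w : (1 <= `|inner (f i - f j) (X w)|) = (a <= `|inner (g i - g j) (X w)|).
  rewrite /f -scalerBr innerZl normrM gtr0_norm ?invr_gt0 // mulrC.
  by rewrite ler_pdivlMr // mul1r.
have mge c i j : measurable [set w | c <= `|inner (f i - f j) (X w)|].
  have cl : closed [set x | c <= `|inner (f i - f j) x|].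
    apply: closed_ge_fun => x; apply: (@continuous_comp _ _ _ (inner (f i - f j)) Num.norm).
      exact: continuous_inner.
    exact: norm_continuous.
  exact: (random_vector_closed rX cl).
have gne i j : i != j -> g i <> g j by move=> ij /ginj eij; rewrite eij eqxx in ij.
(* For p <= K one pair suffices: e^(-p/K) >= 1/3 admits delta = 1/4, the bound that the maximum
   already provides. For larger p the exponent [l] is at least 100. *)
have [pK|Kp] := leP p K.
  pose i0 := Ordinal N0; pose i1 := Ordinal N2.
  have ne : i0 != i1 by [].
  apply: (small (g i0) (g i1) 4^-1 (Tg _) (Tg _) (gne _ _ ne)).
  - by clear; lra.
  - apply: (@le_trans _ _ (expR (- 1))); first by apply: le_trans e3; clear; lra.
    by rewrite ler_expR lerN2 ler_pdivrMr // mul1r.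
  apply: le_trans Phalf; apply: prR_le.
  - have := mge 1 i0 i1; congr (measurable _); apply/seteqP; split => w /=; by rewrite fg.
  - have cl : closed [set x | 2^-1 <= maxinner [seq f ij.1 - f ij.2 | ij <- enum {: 'I_N * 'I_N}] x].
      by apply: closed_ge_fun; exact: continuous_maxinner.
    exact: (random_vector_closed rX cl).
  move=> w /=; rewrite -fg => h; apply: le_trans (norm_inner_maxinner (u := f i0 - f i1) _ _).
    by apply: le_trans h; clear; lra.
  by apply/mapP; exists (i0, i1); rewrite ?mem_enum.
have p128 : 128 < p / 128 by rewrite ltr_pdivlMr // -KE.
have y1 : 1 < expR (p / 128) by rewrite expR_gt1; apply: lt_trans p128; clear; lra.
have [l /andP[l1 l2]] := dyadic_scale y1.
have l100 : (100 <= l)%N.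
  rewrite leqNgt; apply/negP => hl.
  have h1 : 2 ^+ l < 2 ^+ 100 :> R by rewrite ltr_eXn2l //; clear; lra.
  have h2 : 2 ^+ 100 <= expR 1 ^+ 100 :> R by rewrite lerXn2r ?nnegrE ?expR_ge0.
  have h3 : expR 1 ^+ 100 <= expR (p / 128).
    rewrite -expRM_natl mulr1 ler_expR; apply: ltW; apply: le_lt_trans p128.
    by clear; lra.
  by have := le_lt_trans (le_trans (le_trans h2 h3) l1) h1; rewrite ltxx.
apply: (@log_concave_many_points R m Omega P d X l N f rX lc l100 _ Phalf).
  (* As 2^l < 2 e^(p/128), the exponent 2^(41 l) is at most e^(41 (1 + p/128)), and 41 (1 + p/128)
     <= p once p > 128^2. *)
  rewrite -(ler_nat R) natrX; apply: le_trans hN.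
  apply: (@le_trans _ _ (expR 1 ^+ (2 ^ (41 * l)))); first by rewrite lerXn2r ?nnegrE ?expR_ge0.
  rewrite -expRM_natl mulr1 ler_expR natrX mulnC exprM.
  apply: (@le_trans _ _ ((2 * expR (p / 128)) ^+ 41)).
    by rewrite lerXn2r ?nnegrE ?mulr_ge0 ?expR_ge0 ?exprn_ge0 // ltW.
  apply: (@le_trans _ _ ((expR 1 * expR (p / 128)) ^+ 41)).
    rewrite lerXn2r ?nnegrE ?mulr_ge0 ?expR_ge0 // ler_pM2r ?expR_gt0 //.
  rewrite -expRD -expRM_natl ler_expR.
  by move: p128; clear; lra.
move=> i j ij; rewrite leNgt; apply/negP => hd.
have l2V : 2^-1 ^+ l <= expR (- (p / 128)).
  by rewrite exprVn expRN lef_pV2 ?posrE ?expR_gt0 ?exprn_gt0.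
(* The spare factor 1/2 covers the 4/3 in the moment bound; it is available because 1 + p/K <=
   p/128. *)
have dl : 2^-1 ^+ l <= 2^-1 * expR (- (p / K)).
  apply: le_trans l2V _; apply: (@le_trans _ _ (expR (- 1) * expR (- (p / K)))).
    rewrite -expRD ler_expR -opprD lerN2.
    have : p / K = p / 128 / 128 by rewrite KE; field.
    by move: p128 => + ->; clear; lra.
  by rewrite ler_pM2r ?expR_gt0.
have eK : expR (- (p / K)) <= 1.
  by rewrite expR_le1 oppr_le0 divr_ge0 ?(ltW K0) // (le_trans ler01 p1).
apply: (small (g i) (g j) (2^-1 ^+ l) (Tg _) (Tg _) (gne _ _ ij)).
- apply/andP; split; first by rewrite exprn_ge0 // invr_ge0.
  rewrite (_ : 4^-1 = 2^-1 ^+ 2); last by clear; lra.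
  by apply: ler_wiXn2l; rewrite ?invr_ge0 ?invf_le1 //; [clear; lra|exact: leq_trans l100].
- by move: dl (expR_ge0 (- (p / K))); clear; lra.
by apply: le_trans (ltW hd); rewrite le_eqVlt; apply/orP; left; apply/eqP; congr (prR P _);
  apply/seteqP; split => w /=; rewrite fg.
Qed.
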